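(* Let $R$ be a principal ideal domain with field of fractions $F$. (1) For a perfect complex $X$ put $\chi(X)=\sum_i(-1)^i\dim_F(H_i(X)\otimes_RF)$, and for every integer $k$ put $D_k=\{X\in D^b(\operatorname{proj} R):\chi(X)\equiv0\bmod k\}$. The $D_k$ are precisely the triangulated subcategories that are dense in $D^b(\operatorname{proj} R)$. (2) For a specialisation-closed subset $S\ne\operatorname{Spec}(R)$ of $\operatorname{Spec}(R)$ and a subgroup $H$ of $\bigoplus_{p\in S}\mathbb{Z}$, put $$\mathcal{T}(S,H)=\Big\{X\in\mathcal{T}_S:\Big(\bigoplus_{p\in S}\lambda_p\Big)(X)\in H\Big\}.$$ For fixed $S$, the $\mathcal{T}(S,H)$ are precisely the triangulated subcategories that are dense in $\mathcal{T}_S$. Moreover, every triangulated subcategory of $D^b(\operatorname{proj} R)$ is one of these two types.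
   Context: All subcategories are full (and closed under isomorphism). $D^b(\operatorname{proj} R)$ is the chain homotopy category of perfect complexes, i.e. bounded complexes of finitely generated projective $R$-modules. $\operatorname{Supp}(X)=\{\mathfrak{p}\in\operatorname{Spec}(R):X\otimes R_{\mathfrak{p}}\ne0\}$ (non-zero in the derived category). A subset $S$ of $\operatorname{Spec}(R)$ is specialisation-closed if $\mathfrak{p}\in S$ and $\mathfrak{p}\subseteq\mathfrak{q}$ imply $\mathfrak{q}\in S$. $\mathcal{T}_S=\{X\in D^b(\operatorname{proj} R):\operatorname{Supp}(X)\subseteq S\}$. If $S\neq\operatorname{Spec}(R)$ is specialisation-closed then its elements are maximal ideals $(p)$ generated by prime elements $p$, and for $p\in S$ and $X\in\mathcal{T}_S$, $\lambda_p(X)=\sum_i(-1)^i\,\ell(H_i(X)\otimes_RR_{(p)})$, where $\ell$ denotes the length of a module. A triangulated subcategory $\mathcal{C}\subseteq\mathcal{T}$ is dense in $\mathcal{T}$ if every object of $\mathcal{T}$ is a direct summand of an object of $\mathcal{C}$. Congruence modulo $0$ means equality. *)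

(* Defs.v *)
From HB Require Import structures.
From mathcomp Require Import all_boot all_order all_algebra.
From mathcomp Require Import generic_quotient ring_quotient fraction.
From mathcomp Require Import freeg.
From mathcomp Require Import zify.
From mathcomp Require Import boolp classical_sets functions cardinality fsbigop.

Set Implicit Arguments.
Unset Strict Implicit.
Unset Printing Implicit Defensive.

Import Order.TTheory GRing.Theory Num.Theory.
Local Open Scope classical_set_scope.
Local Open Scope ring_scope.
Local Open Scope quotient_scope.

Section QuotientModule.
Variables (A : nzRingType) (V : lmodType A).
Variables (N : {pred V}) (Nsub : GRing.submod_closed N).

Definition submod_of of GRing.submod_closed N : {pred V} := N.
Local Notation NN := (submod_of Nsub).

HB.instance Definition _ :=
  GRing.isZmodClosed.Build V NN (GRing.submod_closedB Nsub).

Definition quotmod := @Quotient.quot V NN.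

HB.instance Definition _ := GRing.Zmodule.on quotmod.

Definition quotmod_pi (v : V) : quotmod := \pi_(@Quotient.quot V NN) v.

Definition quotmod_scale (a : A) (q : quotmod) : quotmod :=
  quotmod_pi (a *: repr q).

Lemma quotmod_piE u v : (quotmod_pi u == quotmod_pi v) = (u - v \in N).
Proof. by rewrite /quotmod_pi (Quotient.idealrBE NN). Qed.

Lemma quotmod_reprK q : quotmod_pi (repr q) = q.
Proof. by rewrite /quotmod_pi reprK. Qed.

Lemma quotmod_pi_zmod : zmod_morphism quotmod_pi.
Proof. by move=> u v; rewrite /quotmod_pi; exact: (pi_is_zmod_morphism _). Qed.

Lemma quotmod_scale_pi a v : quotmod_scale a (quotmod_pi v) = quotmod_pi (a *: v).
Proof.
apply/eqP; rewrite /quotmod_scale quotmod_piE -scalerBr; case: (Nsub) => N0 NL.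
by rewrite -[_ *: _]addr0 NL // -quotmod_piE quotmod_reprK.
Qed.

Lemma quotmod_scaleA a b q :
  quotmod_scale a (quotmod_scale b q) = quotmod_scale (a * b) q.
Proof. by rewrite -[q]quotmod_reprK !quotmod_scale_pi scalerA. Qed.

Lemma quotmod_scale1 : left_id 1 quotmod_scale.
Proof. by move=> q; rewrite -[q]quotmod_reprK quotmod_scale_pi scale1r. Qed.

Lemma quotmod_piD u v : quotmod_pi (u + v) = quotmod_pi u + quotmod_pi v.
Proof.
have sB := quotmod_pi_zmod; have s0 : quotmod_pi 0 = 0 by rewrite -(subr0 0) sB subrr.
by rewrite -[v in LHS]opprK sB -[- v]sub0r sB s0 sub0r opprK.
Qed.

Lemma quotmod_scaleDr : right_distributive quotmod_scale +%R.
Proof.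
move=> a p q; rewrite -[p]quotmod_reprK -[q]quotmod_reprK -quotmod_piD.
by rewrite !quotmod_scale_pi scalerDr quotmod_piD.
Qed.

Lemma quotmod_scaleDl q : {morph quotmod_scale^~ q : a b / a + b}.
Proof.
move=> a b; rewrite -[q]quotmod_reprK.
by rewrite !quotmod_scale_pi scalerDl quotmod_piD.
Qed.

HB.instance Definition _ := GRing.Zmodule_isLmodule.Build A quotmod
  quotmod_scaleA quotmod_scale1 quotmod_scaleDr quotmod_scaleDl.

Lemma quotmod_pi_linear : linear quotmod_pi.
Proof. by move=> a u v; rewrite quotmod_piD -quotmod_scale_pi. Qed.

HB.instance Definition _ := GRing.isLinear.Build A V quotmod *:%R quotmod_pi
  quotmod_pi_linear.

End QuotientModule.

Lemma quotmod_piP (A : nzRingType) (V : lmodType A) (N : {pred V})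
    (Nsub : GRing.submod_closed N) (u v : V) :
  u - v \in N -> quotmod_pi Nsub u = quotmod_pi Nsub v.
Proof. by move=> uv; apply/eqP; rewrite quotmod_piE. Qed.

Section Tensor.
Variables (R A : comNzRingType) (phi : {rmorphism R -> A}).

Section TensorModule.
Variable M : lmodType R.

(* A \otimes_R M is the free A-module on the set M modulo the A-submodule
   generated by the elements <<m + n>> - <<m>> - <<n>> and
   <<r *: m>> - phi r *: <<m>>; the class of a *: <<m>> is a \otimes m. *)
Definition tensor_relations : set {freeg M / A} :=
  [set t | (exists m n : M, t = << m + n >> - << m >> - << n >>) \/
           (exists (r : R) (m : M), t = << r *: m >> - phi r *: << m >>)].

Definition tensor_null : {pred {freeg M / A}} := fun t =>
  `[< forall N : {pred {freeg M / A}}, GRing.submod_closed N ->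
        (forall u, tensor_relations u -> u \in N) -> t \in N >].

Lemma tensor_null_submod : GRing.submod_closed tensor_null.
Proof.
split=> [|a u v /asboolP hu /asboolP hv].
  by apply/asboolP => N [].
apply/asboolP => N Nsub NP; case: (Nsub) => _; apply; [exact: hu|exact: hv].
Qed.

Lemma tensor_null_rel u : tensor_relations u -> u \in tensor_null.
Proof. by move=> hu; apply/asboolP => N _; apply. Qed.

Definition tensor : lmodType A := quotmod tensor_null_submod.

Definition tensor_pure (a : A) (m : M) : tensor :=
  quotmod_pi tensor_null_submod (a *: << m >>).

Lemma tensor_pure1D m n : tensor_pure 1 (m + n) = tensor_pure 1 m + tensor_pure 1 n.
Proof.
rewrite /tensor_pure !scale1r -raddfD; apply: quotmod_piP.
by rewrite opprD addrA; apply: tensor_null_rel; left; exists m, n.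
Qed.

Lemma tensor_pure1Z r m : tensor_pure 1 (r *: m) = phi r *: tensor_pure 1 m.
Proof.
rewrite /tensor_pure !scale1r -linearZ; apply: quotmod_piP.
by apply: tensor_null_rel; right; exists r, m.
Qed.

Lemma fglift_linear (W : lmodType A) (g : M -> W) : linear (fglift g).
Proof.
have gB : zmod_morphism (fglift g) := freeg.lift_is_additive g.
pose G := GRing.isZmodMorphism.Build _ _ (fglift g) gB.
pose gA : {additive {freeg M / A} -> W} := HB.pack (fglift g) G.
move=> a u v; rewrite -[fglift g]/(gA : _ -> _) raddfD; congr (_ + _).
rewrite -[u in RHS]freeg_sumE [X in gA X](_ : _ = fgscale a u) // /fgscale.
rewrite raddf_sum [in RHS]raddf_sum scaler_sumr; apply: eq_bigr => m _ /=.
by rewrite !liftU scalerA.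
Qed.

Lemma tensor_pure_span (t : tensor) :
  t = \sum_(m <- dom (repr t)) coeff m (repr t) *: tensor_pure 1 m.
Proof.
rewrite -[LHS]quotmod_reprK -[repr t in LHS]freeg_sumE linear_sum.
apply: eq_bigr => m _; rewrite -linearZ /tensor_pure scale1r /=; congr quotmod_pi.
by apply/eqP/freeg_eqP => n; rewrite coeffZ !coeffU mulrA mulr1.
Qed.

Lemma tensor_ext (W : lmodType A) (g h : {linear tensor -> W}) :
  (forall m, g (tensor_pure 1 m) = h (tensor_pure 1 m)) -> g =1 h.
Proof.
move=> gh t; rewrite (tensor_pure_span t) !linear_sum.
by apply: eq_bigr => m _; rewrite !linearZ gh.
Qed.
End TensorModule.

Section Functoriality.
Variables (M M' : lmodType R) (f : {linear M -> M'}).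

(* The A-linear map a \otimes m |-> a \otimes f m. *)
Definition tensor_map (t : tensor M) : tensor M' :=
  fglift (fun m => tensor_pure 1 (f m)) (repr t).

Lemma tensor_map_pi u :
  tensor_map (quotmod_pi (@tensor_null_submod M) u) =
  fglift (fun m => tensor_pure 1 (f m)) u.
Proof.
set g := fun m : M => _.
have gL := fglift_linear g; have gB : zmod_morphism (fglift g).
  by move=> x y; rewrite addrC -scaleN1r gL scaleN1r addrC.
apply/eqP; rewrite -subr_eq0 -gB; set v := _ - _.
have : v \in @tensor_null M.
  by rewrite -(quotmod_piE (@tensor_null_submod M)) quotmod_reprK.
have g0 : fglift g 0 = 0 by rewrite -(subrr 0) gB subrr.
move=> /asboolP/(_ (fun t => fglift g t == 0)); apply.
  split=> [|a x y /eqP x0 /eqP y0]; rewrite unfold_in ?g0 //.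
  by rewrite gL x0 y0 scaler0 addr0.
move=> w [[m [n ->]]|[r [m ->]]]; rewrite unfold_in.
  by rewrite !gB !liftU !scale1r /g raddfD tensor_pure1D addrAC addrK subrr.
rewrite -[phi r *: _]addr0 gB gL g0 addr0 !liftU !scale1r /g linearZ.
by rewrite tensor_pure1Z subrr.
Qed.

Lemma tensor_map_linear : linear tensor_map.
Proof.
move=> a s t; rewrite -[s]quotmod_reprK -[t]quotmod_reprK -linearP.
by rewrite !tensor_map_pi fglift_linear.
Qed.

HB.instance Definition _ := GRing.isLinear.Build A (tensor M) (tensor M') *:%R
  tensor_map tensor_map_linear.

Lemma tensor_mapE m : tensor_map (tensor_pure 1 m) = tensor_pure 1 (f m).
Proof. by rewrite [LHS]tensor_map_pi scale1r liftU scale1r. Qed.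

End Functoriality.
End Tensor.

Arguments tensor_pure {R A} phi {M} a m.
Arguments tensor_map {R A} phi {M M'} f t.

(* The differential lowers the degree, and its target is literally indexed by
   i - 1, so that shifts and cones need no transport along degree equations. *)
Record complex (A : nzRingType) := Complex {
  cobj :> int -> lmodType A;
  cdiff : forall i, {linear cobj i -> cobj (i - 1)};
  cdiffK : forall i (x : cobj i), cdiff (i - 1) (cdiff i x) = 0 }.
Arguments cdiff {A} c i : rename.

Section Complexes.
Variable A : nzRingType.
Implicit Types X Y Z : complex A.

Record chain_map X Y := ChainMap {
  cmap :> forall i, {linear X i -> Y i};
  cmapP : forall i (x : X i), cmap (i - 1) (cdiff X i x) = cdiff Y i (cmap i x) }.

(* h i is the component X_(i-1) -> Y_i, and the equation is the usual
   f - g = d h + h d in degree i - 1; i ranges over all integers. *)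
Definition homotopic_maps X Y (f g : forall i, X i -> Y i) :=
  exists h : forall i, {linear X (i - 1) -> Y i},
    forall i (x : X (i - 1)),
      f (i - 1) x - g (i - 1) x =
      cdiff Y i (h i x) + h (i - 1) (cdiff X (i - 1) x).

(* Isomorphism in the chain homotopy category. *)
Definition homotopy_equivalent X Y :=
  exists (f : chain_map X Y) (g : chain_map Y X),
    homotopic_maps (fun i x => g i (f i x)) (fun i x => x) /\
    homotopic_maps (fun i y => f i (g i y)) (fun i y => y).

End Complexes.

Section Homology.
Variable A : nzRingType.

Record cycle (X : complex A) i :=
  Cycle { cycle_val : X i; _ : cdiff X i cycle_val == 0 }.

HB.instance Definition _ X i := [isSub for @cycle_val X i].
HB.instance Definition _ X i := [Choice of cycle X i by <:].

Lemma cycle_submod (X : complex A) i :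
  GRing.subsemimod_closed (fun x : X i => cdiff X i x == 0).
Proof.
split=> [|a x]; first split=> [|x y]; rewrite !unfold_in ?linear0 //.
  by move=> /eqP x0 /eqP y0; rewrite linearD x0 y0 addr0.
by move=> /eqP x0; rewrite linearZZ x0 scaler0.
Qed.

HB.instance Definition _ (X : complex A) i :=
  GRing.SubChoice_isSubLmodule.Build A (X i) _ (cycle X i) (@cycle_submod X i).

Inductive is_boundary (X : complex A) : forall i, X i -> Prop :=
  IsBoundary i (z : X i) : is_boundary (cdiff X i z).

Lemma is_boundaryP (X : complex A) i (x : X i) : is_boundary x <->
  exists j (e : j - 1 = i) (z : X j), x = ecast k (X k) e (cdiff X j z).
Proof.
split=> [[j z]|[j [e [z ->]]]]; first by exists j, erefl, z.
by case: i / e {x}; constructor.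
Qed.

Lemma ecast_linear (X : int -> lmodType A) i j (e : j = i) a (x y : X j) :
  ecast k (X k) e (a *: x + y) = a *: ecast k (X k) e x + ecast k (X k) e y.
Proof. by case: i / e. Qed.

Definition boundary (X : complex A) i : {pred cycle X i} :=
  fun z => `[< is_boundary (cycle_val z) >].

Lemma boundary_submod X i : GRing.submod_closed (@boundary X i).
Proof.
split=> [|a u v /asboolP/is_boundaryP[j [e [x ux]]]
                /asboolP/is_boundaryP[k [e' [y vy]]]]; apply/asboolP.
  apply/is_boundaryP; exists (i + 1), (addrK 1 i), 0; rewrite linear0.
  have := ecast_linear (addrK 1 i) (-1) (0 : X (i + 1 - 1)) 0.
  by rewrite scaler0 addr0 scaleN1r addNr => ->.
have jk : k = j by apply: (addIr (-1)); rewrite e e'.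
rewrite {}jk in e' y vy; rewrite (eq_irrelevance e' e) {e'} in vy.
apply/is_boundaryP; exists j, e, (a *: x + y).
by rewrite linearP ecast_linear -ux -vy.
Qed.

(* H_i(X) = ker d_i / im d_(i+1) *)
Definition homology (X : complex A) i : lmodType A :=
  quotmod (@boundary_submod X i).

Section HomologyMap.
Variables (X Y : complex A) (f : chain_map X Y) (i : int).

Lemma cycle_map_subproof (z : cycle X i) :
  cdiff Y i (f i (cycle_val z)) == 0.
Proof. by case: z => z /= /eqP z0; rewrite -cmapP z0 linear0. Qed.

Definition cycle_map (z : cycle X i) : cycle Y i :=
  Cycle (cycle_map_subproof z).

Definition homology_map (c : homology X i) : homology Y i :=
  quotmod_pi _ (cycle_map (repr c)).

Lemma homology_map_pi (z : cycle X i) :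
  homology_map (quotmod_pi (@boundary_submod X i) z) = quotmod_pi _ (cycle_map z).
Proof.
apply/eqP; rewrite /homology_map quotmod_piE; set w := repr _.
have /asboolP/is_boundaryP[j [e [x wx]]] : w - z \in @boundary X i.
  by rewrite -(quotmod_piE (@boundary_submod X i)) quotmod_reprK.
apply/asboolP/is_boundaryP; exists j, e, (f j x).
rewrite -cmapP [LHS](_ : _ = f i (cycle_val (w - z))); last by rewrite linearB.
by rewrite wx; case: i / e {wx w z}.
Qed.

End HomologyMap.

Definition quasi_isomorphism (X Y : complex A) (f : chain_map X Y) :=
  forall i, bijective (homology_map f (i := i)).

(* Isomorphism in the derived category: two complexes are isomorphic there iff
   they are joined by a roof of quasi-isomorphisms. *)
Definition derived_isomorphic (X Y : complex A) :=
  exists (Z : complex A) (f : chain_map Z X) (g : chain_map Z Y),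
    quasi_isomorphism f /\ quasi_isomorphism g.

End Homology.

Section Constructions.
Variable A : nzRingType.

Definition zero_complex : complex A.
Proof.
refine (@Complex A (fun _ => 'rV[A]_0) (fun _ => \0) _).
by [].
Defined.

Section DirectSum.
Variables X Y : complex A.

Definition dsum_diff i (v : X i * Y i) : X (i - 1) * Y (i - 1) :=
  (cdiff X i v.1, cdiff Y i v.2).

Lemma dsum_diff_linear i : linear (@dsum_diff i).
Proof. by move=> a u v; congr pair; rewrite /= linearP. Qed.

HB.instance Definition _ i :=
  GRing.isLinear.Build A _ _ *:%R (@dsum_diff i) (@dsum_diff_linear i).

Definition dsum_complex : complex A.
Proof.
refine (@Complex A (fun i => (X i * Y i)%type) (fun i => @dsum_diff i) _).
by move=> i v; rewrite /= /dsum_diff !cdiffK.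
Defined.

End DirectSum.

(* X[1]_i = X_(i-1), with differential - d *)
Definition shift_complex (X : complex A) : complex A.
Proof.
refine (@Complex A (fun i => X (i - 1)) (fun i => \- cdiff X (i - 1)) _).
by move=> i x /=; rewrite linearN opprK cdiffK.
Defined.

Section Cone.
Variables (X Y : complex A) (f : chain_map X Y).

Definition cone_diff i (v : X (i - 1) * Y i) : X (i - 1 - 1) * Y (i - 1) :=
  (- cdiff X (i - 1) v.1, f (i - 1) v.1 + cdiff Y i v.2).

Lemma cone_diff_linear i : linear (@cone_diff i).
Proof.
move=> a u v; congr pair; rewrite /= !linearP ?opprD ?scalerN //.
by rewrite scalerDr addrACA.
Qed.

HB.instance Definition _ i :=
  GRing.isLinear.Build A _ _ *:%R (@cone_diff i) (@cone_diff_linear i).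

(* cone(f)_i = X_(i-1) + Y_i with d (x, y) = (- d x, f x + d y) *)
Definition cone_complex : complex A.
Proof.
refine (@Complex A (fun i => (X (i - 1) * Y i)%type) (fun i => @cone_diff i) _).
move=> i v; congr pair; rewrite /= ?linearN ?linearD /= ?cdiffK ?oppr0 //.
by rewrite cmapP addr0 addNr.
Defined.

End Cone.
End Constructions.

Section Perfect.
Variable R : nzRingType.

Definition finitely_generated (M : lmodType R) :=
  exists n (v : 'I_n -> M), forall m, exists c : 'I_n -> R,
    m = \sum_(k < n) c k *: v k.

Definition projective (M : lmodType R) :=
  forall (P Q : lmodType R) (g : {linear P -> Q}) (f : {linear M -> Q}),
    (forall q, exists p, g p = q) ->
    exists h : {linear M -> P}, forall m, g (h m) = f m.

Definition perfect (X : complex R) :=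
  (exists n : nat, forall i, n%:Z < `|i| -> forall x : X i, x = 0) /\
  (forall i, finitely_generated (X i) /\ projective (X i)).

(* The objects of D^b(proj R); its isomorphisms are the homotopy
   equivalences. *)
Record perf := Perf { perf_val :> complex R; perfP : perfect perf_val }.

Lemma fg_prod (M N : lmodType R) : finitely_generated M ->
  finitely_generated N -> finitely_generated (M * N)%type.
Proof.
move=> [m [u uP]] [n [v vP]]; exists (m + n)%N.
exists (fun k : 'I_(m + n) =>
  match fintype.split k with inl i => (u i, 0 : N) | inr j => (0 : M, v j) end).
move=> [x y]; have [c ->] := uP x; have [d ->] := vP y.
exists (fun k : 'I_(m + n) => match fintype.split k with inl i => c i | inr j => d j end).
have splL i : fintype.split (lshift n i) = inl i :> 'I_m + 'I_n := unsplitK (inl i).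
have splR j : fintype.split (rshift m j) = inr j :> 'I_m + 'I_n := unsplitK (inr j).
rewrite big_split_ord /=.
rewrite (eq_bigr (fun i => c i *: (u i, 0 : N))); last first.
  by move=> i _; rewrite splL.
rewrite [X in _ + X](eq_bigr (fun j => d j *: (0 : M, v j))); last first.
  by move=> j _; rewrite splR.
apply/esym; congr pair; rewrite /= !raddf_sum /=.
  by rewrite [X in _ + X]big1 ?addr0 // => *; exact: scaler0.
by rewrite [X in X + _]big1 ?add0r // => *; exact: scaler0.
Qed.

Lemma projective_prod (M N : lmodType R) : projective M -> projective N ->
  projective (M * N)%type.
Proof.
move=> Mproj Nproj P Q g f gS.
have f1L : linear (fun x : M => f (x, 0)).
  move=> a x y; rewrite -linearP; congr (f _); apply/esym.
  by congr pair; rewrite /= scaler0 addr0.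
have f2L : linear (fun y : N => f (0, y)).
  move=> a x y; rewrite -linearP; congr (f _); apply/esym.
  by congr pair; rewrite /= scaler0 addr0.
pose f1 : {linear M -> Q} := HB.pack (fun x : M => f (x, 0))
  (GRing.isLinear.Build _ _ _ _ _ f1L).
pose f2 : {linear N -> Q} := HB.pack (fun y : N => f (0, y))
  (GRing.isLinear.Build _ _ _ _ _ f2L).
have [h1 h1P] := Mproj P Q g f1 gS; have [h2 h2P] := Nproj P Q g f2 gS.
have hL : linear (fun v : M * N => h1 v.1 + h2 v.2).
  by move=> a u v /=; rewrite !linearP scalerDr addrACA.
pose h : {linear (M * N)%type -> P} := HB.pack
  (fun v : M * N => h1 v.1 + h2 v.2) (GRing.isLinear.Build _ _ _ _ _ hL).
exists h => -[x y] /=.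
rewrite linearD h1P h2P /= -linearD; congr (f _).
by congr pair; rewrite /= ?addr0 ?add0r.
Qed.

Lemma perfect_zero : perfect (zero_complex R).
Proof.
split; first by exists 0%N => i _ x; apply/rowP => -[].
move=> i; split.
  exists 0%N, (fun _ => 0) => m; exists (fun _ => 0).
  by rewrite big_ord0; apply/rowP => -[].
by move=> P Q g f _; exists \0 => m; rewrite linear0 (_ : m = 0) ?linear0 //; apply/rowP => -[].
Qed.

Lemma perfect_dsum (X Y : complex R) :
  perfect X -> perfect Y -> perfect (dsum_complex X Y).
Proof.
move=> [[m mP] hX] [[n nP] hY]; split; last first.
  move=> i; have [? ?] := hX i; have [? ?] := hY i.
  by split; [exact: fg_prod|exact: projective_prod].
exists (m + n)%N => i hi [x y]; rewrite PoszD in hi.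
by congr pair; [apply: mP|apply: nP]; apply: le_lt_trans hi; rewrite ?lerDl ?lerDr.
Qed.

Lemma perfect_shift (X : complex R) : perfect X -> perfect (shift_complex X).
Proof.
move=> [[m mP] hX]; split=> [|i]; last exact: hX.
exists m.+1 => i hi x; apply: mP; lia.
Qed.

Lemma perfect_cone (X Y : complex R) (f : chain_map X Y) :
  perfect X -> perfect Y -> perfect (cone_complex f).
Proof.
move=> [[m mP] hX] [[n nP] hY]; split; last first.
  move=> i; have [? ?] := hX (i - 1); have [? ?] := hY i.
  by split; [exact: fg_prod|exact: projective_prod].
exists (m + n).+1%N => i hi [x y].
by congr pair; [apply: mP|apply: nP]; lia.
Qed.

Definition perf0 : perf := Perf perfect_zero.
Definition perf_dsum (X Y : perf) : perf := Perf (perfect_dsum (perfP X) (perfP Y)).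
Definition perf_shift (X : perf) : perf := Perf (perfect_shift (perfP X)).
Definition perf_cone (X Y : perf) (f : chain_map X Y) : perf :=
  Perf (perfect_cone f (perfP X) (perfP Y)).

(* A full subcategory of D^b(proj R) is given by its class of objects. *)
Definition subcategory := perf -> Prop.

Definition same_objects (C D : subcategory) := forall X, C X <-> D X.

(* Every distinguished triangle is isomorphic to a triangle
   X -> Y -> cone f -> X[1]; tri_shift gives closure under both [1] and [-1]. *)
Record triangulated_subcategory (C : subcategory) : Prop := {
  tri_iso : forall X Y : perf, homotopy_equivalent X Y -> C X -> C Y;
  tri_zero : C perf0;
  tri_shift : forall X : perf, C (perf_shift X) <-> C X;
  tri_cone : forall (X Y : perf) (f : chain_map X Y), C X -> C Y -> C (perf_cone f) }.

Definition dense_in (T C : subcategory) :=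
  (forall X, C X -> T X) /\
  forall X, T X -> exists Y Z : perf,
    [/\ T Y, C Z & homotopy_equivalent (perf_dsum X Y) Z].

End Perfect.

Section BaseChange.
Variables (R A : comNzRingType) (phi : {rmorphism R -> A}).

Lemma tensor_map_diffK (X : complex R) i (t : tensor phi (X i)) :
  tensor_map phi (cdiff X (i - 1)) (tensor_map phi (cdiff X i) t) = 0.
Proof.
pose g := tensor_map phi (cdiff X (i - 1)) \o tensor_map phi (cdiff X i).
rewrite -[LHS]/(g t); apply: (@tensor_ext _ _ phi _ _ g \0) => m /=.
by rewrite /g /= !tensor_mapE cdiffK -(scale0r 0) tensor_pure1Z rmorph0 scale0r.
Qed.

Definition tensor_complex (X : complex R) : complex A :=
  @Complex A (fun i => tensor phi (X i))
    (fun i => tensor_map phi (cdiff X i)) (@tensor_map_diffK X).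

End BaseChange.

Definition all_ideals_principal (R : comNzRingType) :=
  forall I : set R, I 0 -> (forall a x y, I x -> I y -> I (a * x + y)) ->
    exists g, I = [set a * g | a in [set: R]].

Notation Spec R := (prime_idealr R).

Lemma Spec_ext (R : comNzRingType) (p q : Spec R) : p =i q -> p = q.
Proof.
case: p q => [p [[a] [b] [c] [d]]] [q [[a'] [b'] [c'] [d']]] pq.
have {pq} epq : p = q by apply/funext => x; exact: pq.
case: q / epq a' b' c' d' => a' b' c' d'.
by rewrite (Prop_irrelevance a a') (Prop_irrelevance b b')
  (Prop_irrelevance c c') (Prop_irrelevance d d').
Qed.

Section Localisation.
Variables (R : idomainType) (p : Spec R).

Definition localisation_pred : {pred {fraction R}} := fun x =>
  `[< exists a s : R, s \notin p /\ x = tofrac a / tofrac s >].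

Lemma localisation_subring : GRing.subring_closed localisation_pred.
Proof.
have np (s t : R) : s \notin p -> t \notin p -> s * t \notin p.
  by move=> sp tp; rewrite prime_idealrM negb_or sp.
have n0 (s : R) : s \notin p -> tofrac s != 0.
  by apply: contraNneq => /eqP; rewrite tofrac_eq0 => /eqP->; exact: idealr0.
split.
- apply/asboolP; exists 1, 1; rewrite tofrac1 divr1; split=> //.
  by rewrite idealr1.
- move=> x y /asboolP[a [s [sp ->]]] /asboolP[b [t [tp ->]]]; apply/asboolP.
  exists (a * t - b * s), (s * t); split; first exact: np.
  by rewrite -mulNr addf_div ?n0 // tofracB !tofracM mulNr.
- move=> x y /asboolP[a [s [sp ->]]] /asboolP[b [t [tp ->]]]; apply/asboolP.
  exists (a * b), (s * t); split; first exact: np.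
  by rewrite mulf_div !tofracM.
Qed.

HB.instance Definition _ :=
  GRing.isSubringClosed.Build {fraction R} localisation_pred
    localisation_subring.

(* R_p, as a subring of the field of fractions *)
Record localisation := Localisation {
  localisation_val : {fraction R}; _ : localisation_val \in localisation_pred }.

HB.instance Definition _ := [isSub for localisation_val].
HB.instance Definition _ := [Choice of localisation by <:].
HB.instance Definition _ := [SubChoice_isSubComNzRing of localisation by <:].

Lemma localisation_of_subproof (a : R) : tofrac a \in localisation_pred.
Proof.
by apply/asboolP; exists a, 1; rewrite idealr1 tofrac1 divr1.
Qed.

Definition localisation_of (a : R) : localisation :=
  Localisation (localisation_of_subproof a).

Lemma localisation_of_zmod : zmod_morphism localisation_of.
Proof. by move=> a b; apply: val_inj; rewrite /= tofracB. Qed.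

Lemma localisation_of_monoid : monoid_morphism localisation_of.
Proof.
by split=> [|a b]; apply: val_inj; rewrite /= ?tofrac1 ?tofracM.
Qed.

HB.instance Definition _ := GRing.isZmodMorphism.Build R localisation
  localisation_of localisation_of_zmod.
HB.instance Definition _ := GRing.isMonoidMorphism.Build R localisation
  localisation_of localisation_of_monoid.

End Localisation.

Definition submodule_chain (A : nzRingType) (M : lmodType A) (n : nat)
    (N : nat -> {pred M}) :=
  (forall i, (i <= n)%N -> GRing.submod_closed (N i)) /\
  (forall i, (i < n)%N -> {subset N i <= N i.+1} /\
                          exists2 x, x \in N i.+1 & x \notin N i).

Definition has_length (A : nzRingType) (M : lmodType A) (n : nat) :=
  (exists N : nat -> {pred M}, submodule_chain n N) /\
  (forall m (N : nat -> {pred M}), submodule_chain m N -> (m <= n)%N).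

(* 0 by convention for modules of infinite length *)
Definition module_length (A : nzRingType) (M : lmodType A) : nat :=
  xget 0%N [set n | has_length M n].

(* 0 by convention for spaces of infinite dimension *)
Definition dimension (F : fieldType) (V : lmodType F) : nat :=
  xget 0%N [set n | inhabited (Vector.axiom n V)].

Section Classification.
Variable R : idomainType.
Implicit Types (X : perf R) (S : set (Spec R)).

Definition chi X : int :=
  \sum_(i \in [set: int]) (-1) ^ i *
    (dimension (tensor (@tofrac R) (homology X i)))%:Z.

Definition D_ (k : int) : subcategory R := fun X => (chi X = 0 %[mod k])%Z.

Definition Supp X : set (Spec R) :=
  [set p | ~ derived_isomorphic (tensor_complex (@localisation_of R p) X)
                                (zero_complex (localisation p))].

Definition specialisation_closed S :=
  forall p q : Spec R, S p -> {subset p <= q} -> S q.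

Definition T_ S : subcategory R := fun X => Supp X `<=` S.

Definition lambda (p : Spec R) X : int :=
  \sum_(i \in [set: int]) (-1) ^ i *
    (module_length (tensor (@localisation_of R p) (homology X i)))%:Z.

(* \bigoplus_(p in S) Z *)
Definition int_dsum S : set ({p | S p} -> int) :=
  [set c | finite_set [set p | c p != 0]].

Definition subgroup_of_dsum S (H : set ({p | S p} -> int)) :=
  [/\ H `<=` @int_dsum S, H (fun=> 0) &
      forall c d, H c -> H d -> H (fun p => c p - d p)].

Definition T_H S (H : set ({p | S p} -> int)) : subcategory R :=
  fun X => T_ S X /\ H (fun p => lambda (sval p) X).

End Classification.

(* Main.v *)
(** Over a principal ideal domain every perfect complex is homotopy equivalent to a finite
    direct sum of shifts of R and of cones of multiplications a : R -> R with a <> 0.  Take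
    such a decomposition of an object X of a triangulated subcategory C.  The cone of an
    endomorphism of X that is the identity on all summands but one, where it is a
    multiplication, shows that C contains G (+) G[1], where G = R if X has a summand R[i],
    and G = R/p for every nonzero p in Supp X.  Hence in the quotient of the monoid of
    objects by C the class of G[1] is opposite to that of G, and all classes are integral
    combinations of those of the G.  The combination is determined by the Euler
    characteristics, so that an object belongs to C as soon as it has the same Euler
    characteristics as some object of C.  Both chi and lambda_p are alternating sums of the
    lengths of A (x) H_i(X), with A the localisation of R at 0 or at p, and they are
    additive by the long exact homology sequence of a cone. *)

Require Import Defs.
From HB Require Import structures.
From mathcomp Require Import freeg finmap.
From mathcomp Require Import all_boot all_order all_algebra.
From mathcomp Require Import generic_quotient ring_quotient fraction.
From mathcomp Require Import zify.
From mathcomp Require Import boolp classical_sets functions cardinality fsbigop.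

Set Implicit Arguments.
Unset Strict Implicit.
Unset Printing Implicit Defensive.

Import Order.TTheory GRing.Theory Num.Theory.
Local Open Scope classical_set_scope.
Local Open Scope ring_scope.
Local Open Scope quotient_scope.

Local Notation cycle := Defs.cycle.

(** The last assertion assumes no density, so the doubles $G\oplus G[1]$ must be extracted from a
    single object of $C$. For $R/p$ this rests on an interchange: if $a=bg$ with $g$ a generator of
    $p$, then the cone of $g$ on the cone of $a$ is the cone of $a$ on the cone of $g$, and there
    $a$ is null-homotopic, which leaves the double of the cone of $g$. The zero ideal decides the
    type: an object of $C$ that is not acyclic there yields the double of $R$, and $R$ generates
    every perfect complex; otherwise the union $S$ of the supports misses the zero ideal, and the
    cones of the generators of the primes in $S$ generate $T_S$. A dense $C$ fits in because it
    meets the support of every object, and conversely $X\oplus X[1]$ has vanishing Euler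
    characteristics. A relation between objects replaces the Grothendieck group: all that is used of
    it is cancellation of members of $C$. Lengths are maximal lengths of chains, with value 0 by
    convention in the infinite case, so finiteness has to be propagated from the generators before
    additivity can be applied. *)

(** * Reflection for identities in abelian groups *)

Inductive zexp := ZVar of nat | ZAdd of zexp & zexp | ZOpp of zexp | ZZero.

Section ZmodReflection.
Variable V : zmodType.
Fixpoint zeval (env : seq V) e := match e with
  | ZVar n => nth 0 env n
  | ZAdd e f => zeval env e + zeval env f
  | ZOpp e => - zeval env e
  | ZZero => 0 end.
Fixpoint zcoef e (n : nat) : int := match e with
  | ZVar m => (n == m)%:Z
  | ZAdd e f => zcoef e n + zcoef f n
  | ZOpp e => - zcoef e n
  | ZZero => 0 end.

Lemma zeval_coef env e :
  zeval env e = \sum_(n < size env) nth 0 env n *~ zcoef e n.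
Proof.
elim: e => [m|e IHe f IHf|e IHe|] /=.
- have [lt|ge] := ltnP m (size env); last first.
    rewrite nth_default // big1 // => k _.
    by have /negPf-> : k != m :> nat by rewrite neq_ltn (leq_trans (ltn_ord k) ge).
  rewrite (bigD1 (Ordinal lt)) //= eqxx mulr1z big1 ?addr0 // => k.
  by rewrite -val_eqE /= => /negPf->.
- by rewrite IHe IHf -big_split; apply: eq_bigr => k _; rewrite mulrzDr.
- by rewrite IHe -sumrN; apply: eq_bigr => k _; rewrite mulrNz.
- by rewrite big1 // => k _; rewrite mulr0z.
Qed.

Lemma zmod_reflect env e f :
  all (fun n => zcoef e n == zcoef f n) (iota 0 (size env)) ->
  zeval env e = zeval env f.
Proof.
move=> /allP ef; rewrite !zeval_coef; apply: eq_bigr => k _.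
by rewrite (eqP (ef _ _)) // mem_iota ltn_ord.
Qed.
End ZmodReflection.

(* The degrees of two occurrences of the same atom may be convertible without being
   syntactically equal; comparing the atoms up to conversion would be too slow. *)
Ltac zsame x y := first
  [ constr_eq x y
  | lazymatch x with
    | @GRing.Linear.sort _ _ _ _ ?f ?u => lazymatch y with
      | @GRing.Linear.sort _ _ _ _ ?g ?v =>
        lazymatch f with ?f' ?i => lazymatch g with ?g' ?j =>
          constr_eq f' g'; let _ := constr:(erefl i : i = j) in zsame u v end end end
    | @GRing.scale _ _ ?a ?u => lazymatch y with
      | @GRing.scale _ _ ?b ?v => let _ := constr:(erefl a : a = b) in zsame u v end
    end ].
Ltac zfind x env := match env with
  | ?y :: _ => let _ := match goal with _ => zsame x y end in constr:(0%N)
  | _ :: ?env' => let n := zfind x env' in constr:(S n) end.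
Ltac zatoms env e := match e with
  | (?a + ?b)%R => let env := zatoms env a in zatoms env b
  | (- ?a)%R => zatoms env a
  | 0%R => env
  | _ => match env with
         | _ => let _ := zfind e env in env
         | _ => constr:(e :: env) end end.
Ltac zreify env e := match e with
  | (?a + ?b)%R => let a := zreify env a in let b := zreify env b in constr:(ZAdd a b)
  | (- ?a)%R => let a := zreify env a in constr:(ZOpp a)
  | 0%R => constr:(ZZero)
  | _ => let n := zfind e env in constr:(ZVar n) end.
Ltac abelian := match goal with |- @eq ?T ?l ?r =>
  let env := zatoms (@nil T) l in let env := zatoms env r in
  let e := zreify env l in let f := zreify env r in
  apply: (@zmod_reflect _ env e f); vm_compute; reflexivity end.
Ltac zsimp := rewrite /= ?(opprK, oppr0, linearD, linear0, linearN) /=.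

Lemma pair_ext (V W : Type) (p q : V * W) : p.1 = q.1 -> p.2 = q.2 -> p = q.
Proof. by case: p q => [? ?] [? ?] /= -> ->. Qed.

(** * Bundled linear maps *)

Section LinearMaps.
Variables (A : nzRingType).

Definition lin (V W : lmodType A) (f : V -> W) (fL : linear f) : {linear V -> W} :=
  HB.pack f (GRing.isLinear.Build A V W *:%R f fL).

Lemma lpair_linear (V W W' : lmodType A) (f : {linear V -> W}) (g : {linear V -> W'}) :
  linear (fun v => (f v, g v)).
Proof. by move=> a u v; rewrite !linearP. Qed.

Definition lpair V W W' f g := lin (@lpair_linear V W W' f g).
Definition lfst (V W : lmodType A) : {linear (V * W)%type -> V} := fst.
Definition lsnd (V W : lmodType A) : {linear (V * W)%type -> W} := snd.
Definition lcomp (V W Z : lmodType A) (f : {linear W -> Z}) (g : {linear V -> W}) :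
  {linear V -> Z} := f \o g.
Definition ladd (V W : lmodType A) (f g : {linear V -> W}) : {linear V -> W} := f \+ g.
Definition lopp (V W : lmodType A) (f : {linear V -> W}) : {linear V -> W} := \- f.
End LinearMaps.
Arguments lfst {A V W}.
Arguments lsnd {A V W}.

(** * Homotopy equivalences between cones *)

Section Toolkit.
Variable A : comNzRingType.
Implicit Types X Y Z W : complex A.

Lemma iso_homotopy_equivalent X Y (f : chain_map X Y) (g : chain_map Y X) :
  (forall i x, g i (f i x) = x) -> (forall i y, f i (g i y) = y) ->
  homotopy_equivalent X Y.
Proof.
move=> gf fg; exists f, g; split; exists (fun=> \0) => i x; 
by rewrite ?gf ?fg linear0 addr0 subrr.
Qed.

Lemma homotopy_equivalent_sym X Y :
  homotopy_equivalent X Y -> homotopy_equivalent Y X.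
Proof. by move=> [f [g [gf fg]]]; exists g, f. Qed.

Definition id_map X : chain_map X X := @ChainMap _ X X (fun i => idfun) (fun i x => erefl).
Definition zero_map X Y : chain_map X Y.
Proof. by refine (@ChainMap _ X Y (fun i => \0) _) => i x; rewrite linear0. Defined.

Lemma homotopy_equivalent_refl X : homotopy_equivalent X X.
Proof. exact: (@iso_homotopy_equivalent _ _ (id_map X) (id_map X)). Qed.

Definition scal (a : A) X : chain_map X X.
Proof. by refine (@ChainMap _ X X (fun i => (a \*: idfun)) _) => i x /=; rewrite linearZ. Defined.

Definition comp_map X Y Z (g : chain_map Y Z) (f : chain_map X Y) : chain_map X Z.
Proof. by refine (@ChainMap _ X Z (fun i => lcomp (g i) (f i)) _) => i x /=; rewrite !cmapP. Defined.

Definition dsum_map X Y X' Y' (f : chain_map X X') (g : chain_map Y Y') :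
  chain_map (dsum_complex X Y) (dsum_complex X' Y').
Proof.
refine (@ChainMap _ (dsum_complex X Y) (dsum_complex X' Y')
  (fun i => lpair (lcomp (f i) lfst) (lcomp (g i) lsnd)) _).
by move=> i x; rewrite /= /dsum_diff !cmapP.
Defined.

Lemma dsum_cong X Y X' Y' : homotopy_equivalent X X' -> homotopy_equivalent Y Y' ->
  homotopy_equivalent (dsum_complex X Y) (dsum_complex X' Y').
Proof.
move=> [f [g [[h hP] [k kP]]]] [f' [g' [[h' hP'] [k' kP']]]].
exists (dsum_map f f'), (dsum_map g g'); split.
  exists (fun i => lpair (lcomp (h i) lfst) (lcomp (h' i) lsnd)) => i [x y].
  by congr pair; [exact: hP | exact: hP'].
exists (fun i => lpair (lcomp (k i) lfst) (lcomp (k' i) lsnd)) => i [x y].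
by congr pair; [exact: kP | exact: kP'].
Qed.

Lemma dsumC X Y : homotopy_equivalent (dsum_complex X Y) (dsum_complex Y X).
Proof.
pose f X Y : chain_map (dsum_complex X Y) (dsum_complex Y X) :=
  @ChainMap _ (dsum_complex X Y) (dsum_complex Y X) (fun i => lpair lsnd lfst)
    (fun i x => erefl).
by apply: (@iso_homotopy_equivalent _ _ (f X Y) (f Y X)) => i [].
Qed.

Lemma dsumA X Y Z : homotopy_equivalent (dsum_complex (dsum_complex X Y) Z)
  (dsum_complex X (dsum_complex Y Z)).
Proof.
set L := dsum_complex _ _; set M := dsum_complex X _.
pose f : chain_map L M := @ChainMap _ L M
  (fun i => lpair (lcomp lfst lfst) (lpair (lcomp lsnd lfst) lsnd)) (fun i x => erefl).
pose g : chain_map M L := @ChainMap _ M L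
  (fun i => lpair (lpair lfst (lcomp lfst lsnd)) (lcomp lsnd lsnd)) (fun i x => erefl).
by apply: (@iso_homotopy_equivalent _ _ f g) => i [] => [[]|? []].
Qed.

(** Both complexes have the differential $-d$ on $X_{i-1}\oplus Y_{i-1}$. This is the source of
    closure under direct sums, as the axioms speak only of cones and shifts. *)
Lemma shift_dsum_cone X Y : homotopy_equivalent (cone_complex (zero_map X (shift_complex Y)))
   (shift_complex (dsum_complex X Y)).
Proof.
set L := cone_complex _; set M := shift_complex _.
unshelve epose (f := @ChainMap _ L M (fun i => idfun) _).
  by move=> i [x y]; congr pair; rewrite /= add0r.
unshelve epose (g := @ChainMap _ M L (fun i => idfun) _).
  by move=> i [x y]; congr pair; rewrite /= add0r.
exact: (@iso_homotopy_equivalent _ _ f g).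
Qed.

Lemma cone_zero_map X Y (f : chain_map X Y) : (forall i x, f i x = 0) ->
  homotopy_equivalent (cone_complex f) (dsum_complex (shift_complex X) Y).
Proof.
move=> f0; set L := cone_complex _; set M := dsum_complex _ _.
unshelve epose (u := @ChainMap _ L M (fun i => idfun) _).
  by move=> i [x y]; congr pair; rewrite /= f0 add0r.
unshelve epose (v := @ChainMap _ M L (fun i => idfun) _).
  by move=> i [x y]; congr pair; rewrite /= f0 add0r.
exact: (@iso_homotopy_equivalent _ _ u v).
Qed.

Section Rotation.
Variables (X Y : complex A) (f : chain_map X Y).

Definition cone_in : chain_map Y (cone_complex f).
Proof.
refine (@ChainMap _ Y (cone_complex f) (fun i => lpair \0 idfun) _).
by move=> i y; congr pair; rewrite /= linear0 ?oppr0 ?add0r.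
Defined.

Definition cone_out : chain_map (cone_complex f) (shift_complex X).
Proof. by refine (@ChainMap _ (cone_complex f) (shift_complex X) (fun i => lfst) _). Defined.

(** Rotation of the triangle: the two copies of $X$ in the iterated cone cancel, and the homotopy
    moves one onto the other with a sign. *)
Lemma cone_cone_out : homotopy_equivalent (cone_complex cone_out) (shift_complex Y).
Proof.
set L := cone_complex _; set M := shift_complex _.
unshelve epose (u := @ChainMap _ L M
  (fun i => ladd (lcomp lsnd lfst) (lcomp (f (i - 1)) lsnd)) _).
  by move=> i [[x y] x']; zsimp; rewrite cmapP; abelian.
unshelve epose (v := @ChainMap _ M L (fun i => lpair (lpair \0 idfun) \0) _).
  by move=> i y; congr pair; [congr pair|]; zsimp; abelian.
exists u, v; split.
  exists (fun i => lpair (lpair (lopp lsnd) \0) \0) => i [[x y] x'].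
  by congr pair; [congr pair|]; zsimp; abelian.
by exists (fun=> \0) => i x; zsimp; abelian.
Qed.
End Rotation.

(** The shear $(x,y)\mapsto(x,y+hx)$ along a homotopy $h$ is a chain map between the cones, inverse
    to the shear along $-h$. *)
Lemma cone_homotopic X Y (f g : chain_map X Y) : 
  homotopic_maps (fun i x => f i x) (fun i x => g i x) ->
  homotopy_equivalent (cone_complex f) (cone_complex g).
Proof.
move=> [h hP]; set L := cone_complex _; set M := cone_complex _.
unshelve epose (u := @ChainMap _ L M
  (fun i => lpair lfst (ladd lsnd (lcomp (h i) lfst))) _).
  move=> i [x y]; congr pair; zsimp.
  by move/(canRL (subrK _)): (hP i x) => ->; abelian.
unshelve epose (v := @ChainMap _ M L
  (fun i => lpair lfst (ladd lsnd (lopp (lcomp (h i) lfst)))) _).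
  move=> i [x y]; congr pair; zsimp.
  by move/(canRL (subrK _)): (hP i x) => ->; abelian.
apply: (@iso_homotopy_equivalent _ _ u v) => i [x y]; congr pair; zsimp; abelian.
Qed.

Lemma cone_ext X Y (f g : chain_map X Y) : (forall i x, f i x = g i x) ->
  homotopy_equivalent (cone_complex f) (cone_complex g).
Proof.
move=> fg; apply: cone_homotopic; exists (fun=> \0) => i x.
by rewrite fg subrr linear0 addr0.
Qed.

(** The octahedral axiom: [phi] is the identity on $X$ and $g$ on $Y$, and in its cone the two
    copies of $X$ cancel. The composite [k] is given pointwise, so that it may be a multiplication
    by a product. *)
Lemma cone_octahedron X Y Z (f : chain_map X Y) (g : chain_map Y Z) (k : chain_map X Z) :
  (forall i x, k i x = g i (f i x)) ->
  exists phi : chain_map (cone_complex f) (cone_complex k),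
    homotopy_equivalent (cone_complex phi) (cone_complex g).
Proof.
move=> kP.
unshelve epose (phi := @ChainMap _ (cone_complex f) (cone_complex k)
  (fun i => lpair lfst (lcomp (g i) lsnd)) _).
  by move=> i [x y]; congr pair; zsimp; rewrite kP cmapP.
exists phi; set L := cone_complex _; set M := cone_complex _.
unshelve epose (u := @ChainMap _ L M (fun i =>
  lpair (ladd (lcomp lsnd lfst) (lcomp (f (i - 1)) (lcomp lfst lsnd))) (lcomp lsnd lsnd)) _).
  by move=> i [[x y] [x' z]]; congr pair; zsimp; rewrite ?kP ?cmapP; abelian.
unshelve epose (v := @ChainMap _ M L (fun i => lpair (lpair \0 lfst) (lpair \0 lsnd)) _).
  by move=> i [y z]; congr pair; congr pair; zsimp; abelian.
exists u, v; split.
  exists (fun i => lpair (lpair (lopp (lcomp lfst lsnd)) \0) \0) => i [[x y] [x' z]].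
  by congr pair; congr pair; zsimp; abelian.
by exists (fun=> \0) => i [x y]; congr pair; zsimp; abelian.
Qed.

Lemma cone_dsum X Y X' Y' (f : chain_map X X') (g : chain_map Y Y') :
  homotopy_equivalent (cone_complex (dsum_map f g))
    (dsum_complex (cone_complex f) (cone_complex g)).
Proof.
set L := cone_complex _; set M := dsum_complex _ _.
unshelve epose (u := @ChainMap _ L M (fun i =>
  lpair (lpair (lcomp lfst lfst) (lcomp lfst lsnd))
        (lpair (lcomp lsnd lfst) (lcomp lsnd lsnd))) _); first by move=> i [[x y] [x' y']].
unshelve epose (v := @ChainMap _ M L (fun i =>
  lpair (lpair (lcomp lfst lfst) (lcomp lfst lsnd))
        (lpair (lcomp lsnd lfst) (lcomp lsnd lsnd))) _); first by move=> i [[x y] [x' y']].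
by apply: (@iso_homotopy_equivalent _ _ u v) => i [[x y] [x' y']].
Qed.

Lemma contractible_zero X (h : forall i, {linear X (i - 1) -> X i}) :
  (forall i (x : X (i - 1)), x = cdiff X i (h i x) + h (i - 1) (cdiff X (i - 1) x)) ->
  homotopy_equivalent X (zero_complex A).
Proof.
move=> hP; exists (zero_map X (zero_complex A)), (zero_map (zero_complex A) X); split.
  by exists (fun i => lopp (h i)) => i x; zsimp; rewrite {1}(hP i x); abelian.
by exists (fun=> \0) => i x; apply/rowP => -[].
Qed.

(** Multiplication by the inverse, from the second summand to the first, is a contraction. *)
Lemma cone_scal_unit X (a b : A) : b * a = 1 ->
  homotopy_equivalent (cone_complex (scal a X)) (zero_complex A).
Proof.
move=> ba; apply: (@contractible_zero (cone_complex (scal a X))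
  (fun i => lpair ((b \*: idfun) \o lsnd : {linear _ -> _}) \0)) => i [x y].
by congr pair; zsimp; rewrite ?(linearZZ (cdiff _ _)) ?scalerDr ?scalerN !scalerA ?[a * b]mulrC ba !scale1r; abelian.
Qed.

(** The homotopy is $(x,y)\mapsto(by,0)$. This is the counterpart for complexes of the fact that
    multiples of $a$ annihilate $R/a$. *)
Lemma scal_cone_null X (a b : A) : homotopic_maps
  (fun i x => scal (b * a) (cone_complex (scal a X)) i x)
  (fun i x => scal 0 (cone_complex (scal a X)) i x).
Proof.
exists (fun i => lpair ((b \*: idfun) \o lsnd : {linear _ -> _}) \0) => i [x y].
congr pair; zsimp.
  by rewrite (linearZZ (cdiff _ _)) scale0r scalerA; abelian.
by rewrite scalerA [b * a]mulrC scale0r; abelian.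
Qed.

(** The isomorphism is $(x,y)\mapsto(-x,y)$: its sign absorbs the one that the shift puts on $f$
    inside the differential of the cone. *)
Lemma cone_shift X Y (f : chain_map X Y) (k : chain_map (shift_complex X) (shift_complex Y)) :
  (forall i x, k i x = f (i - 1) x) ->
  homotopy_equivalent (shift_complex (cone_complex f)) (cone_complex k).
Proof.
move=> kP; set L := shift_complex _; set M := cone_complex _.
unshelve epose (u := @ChainMap _ L M (fun i => lpair (lopp lfst) lsnd) _).
  by move=> i [x y]; congr pair; zsimp; rewrite ?kP; zsimp; abelian.
unshelve epose (v := @ChainMap _ M L (fun i => lpair (lopp lfst) lsnd) _).
  by move=> i [x y]; congr pair; zsimp; rewrite ?kP; zsimp; abelian.
by apply: (@iso_homotopy_equivalent _ _ u v) => i [x y]; congr pair; zsimp; abelian.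
Qed.

Definition cone_scal_map X Y (f : chain_map X Y) (a : A) :
  chain_map (cone_complex (scal a X)) (cone_complex (scal a Y)).
Proof.
refine (@ChainMap _ (cone_complex (scal a X)) (cone_complex (scal a Y))
  (fun i => lpair (lcomp (f (i - 1)) lfst) (lcomp (f i) lsnd)) _).
by move=> i [x y]; congr pair; zsimp; rewrite !cmapP ?(linearZZ (f _)).
Defined.

(** Both sides are total complexes of the same square with sides $f$ and $a$. Exchanging the two
    directions swaps the middle summands and costs a sign on all summands but the first. *)
Lemma cone_scal_cone X Y (f : chain_map X Y) (a : A) :
  homotopy_equivalent (cone_complex (cone_scal_map f a))
    (cone_complex (scal a (cone_complex f))).
Proof.
set L := cone_complex _; set M := cone_complex _.
unshelve epose (u := @ChainMap _ L M (fun i =>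
  lpair (lpair (lcomp lfst lfst) (lopp (lcomp lfst lsnd)))
        (lpair (lopp (lcomp lsnd lfst)) (lopp (lcomp lsnd lsnd)))) _).
  by move=> i [[x y] [x' y']]; congr pair; congr pair; zsimp; rewrite ?(linearZZ (cdiff _ _)) ?scalerN; abelian.
unshelve epose (v := @ChainMap _ M L (fun i =>
  lpair (lpair (lcomp lfst lfst) (lopp (lcomp lfst lsnd)))
        (lpair (lopp (lcomp lsnd lfst)) (lopp (lcomp lsnd lsnd)))) _).
  by move=> i [[x y] [x' y']]; congr pair; congr pair; zsimp; rewrite ?(linearZZ (cdiff _ _)) ?scalerN; abelian.
by apply: (@iso_homotopy_equivalent _ _ u v) => i [[x y] [x' y']];
  congr pair; congr pair; zsimp; abelian.
Qed.

Lemma cone_scal_cong X Y (a : A) : homotopy_equivalent X Y ->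
  homotopy_equivalent (cone_complex (scal a X)) (cone_complex (scal a Y)).
Proof.
have mH Z W (f : chain_map Z W) (g : chain_map W Z) :
    homotopic_maps (fun i x => g i (f i x)) (fun i x => x) ->
    homotopic_maps (fun i x => cone_scal_map g a i (cone_scal_map f a i x))
      (fun i (x : cone_complex (scal a Z) i) => x).
  (* The sign is that of the differential on the shifted summand. *)
  move=> [h hP]; exists (fun i => lpair (lopp (lcomp (h (i - 1)) lfst)) (lcomp (h i) lsnd)).
  move=> i [x y]; congr pair; zsimp; rewrite hP; first by abelian.
  by rewrite (linearZZ (h _)); abelian.
move=> [f [g [gf fg]]]; exists (cone_scal_map f a), (cone_scal_map g a).
by split; exact: mH.
Qed.

Lemma shift_zero : homotopy_equivalent (shift_complex (zero_complex A)) (zero_complex A).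
Proof.
exists (zero_map _ _), (zero_map _ _); split; exists (fun=> \0) => i x;
by apply/rowP => -[].
Qed.
End Toolkit.

(** * Closure properties of triangulated subcategories *)

Section Triangulated.
Variables (R : comNzRingType) (C : subcategory R) (Ctri : triangulated_subcategory C).
Implicit Types X Y Z : perf R.

Lemma tri_iff X Y : homotopy_equivalent X Y -> C X <-> C Y.
Proof.
by move=> XY; split; apply: (tri_iso Ctri) => //; apply: homotopy_equivalent_sym.
Qed.

Lemma tri_dsum X Y : C X -> C Y -> C (perf_dsum X Y).
Proof.
move=> CX CY; apply/(tri_shift Ctri).
apply/(@tri_iff (perf_cone (zero_map X (perf_shift Y)))); first exact: shift_dsum_cone.
by apply: (tri_cone Ctri) => //; apply/(tri_shift Ctri).
Qed.

(** By rotation $Y[1]$ is the cone of the map from the cone of $f$ to $X[1]$. *)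
Lemma tri_cone_target X Y (f : chain_map X Y) : C X -> C (perf_cone f) -> C Y.
Proof.
move=> CX Cf; apply/(tri_shift Ctri).
apply/(@tri_iff (@perf_cone _ (perf_cone f) (perf_shift X) (cone_out f))).
  exact: cone_cone_out.
by apply: (tri_cone Ctri) => //; apply/(tri_shift Ctri).
Qed.

Lemma tri_dsum_cancel X Y : C X -> C (perf_dsum X Y) -> C Y.
Proof.
move=> CX /(tri_shift Ctri) CXY; apply/(tri_shift Ctri).
apply: (@tri_cone_target X (perf_shift Y) (zero_map X (perf_shift Y))) => //.
by apply/(@tri_iff _ (perf_shift (perf_dsum X Y))) => //; exact: shift_dsum_cone.
Qed.

Lemma tri_dsumC X Y : C (perf_dsum X Y) <-> C (perf_dsum Y X).
Proof. by apply: tri_iff; exact: dsumC. Qed.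

Lemma tri_dsumA X Y Z :
  C (perf_dsum (perf_dsum X Y) Z) <-> C (perf_dsum X (perf_dsum Y Z)).
Proof. by apply: tri_iff; exact: dsumA. Qed.

Lemma tri_dsum_iffr X Y : C X -> C (perf_dsum X Y) <-> C Y.
Proof. by move=> CX; split; [exact: tri_dsum_cancel | exact: tri_dsum]. Qed.

(** Taking the cone of $a$ commutes with shifts and cones. Hence a statement about the cone of $a$
    on an object only has to be checked on generators, and on $R$ only in one degree. *)
Lemma tri_scal a : triangulated_subcategory (fun X => C (perf_cone (scal a X))).
Proof.
split=> [X Y XY| |X|X Y f CX CY].
- by apply: (tri_iso Ctri); exact: cone_scal_cong.
- apply/(@tri_iff _ (perf0 R)); last exact: (tri_zero Ctri).
  by exists (zero_map _ _), (zero_map _ _); split; exists (fun=> \0) => i x;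
    [congr pair|]; apply/rowP => -[].
- rewrite -(tri_shift Ctri (perf_cone (scal a X))).
  by apply: tri_iff; apply: homotopy_equivalent_sym; exact: (@cone_shift _ X X).
- apply/(@tri_iff (@perf_cone _ (perf_cone (scal a X)) (perf_cone (scal a Y))
    (cone_scal_map f a))); first exact: cone_scal_cone.
  exact: (tri_cone Ctri).
Qed.

(** The double $X[1]\oplus X$ is written as the cone of 0 below, because [tri_scal] applies to that
    form. *)
Lemma tri_cone_scal0 X : C (perf_cone (scal 0 X)) <-> C (perf_dsum (perf_shift X) X).
Proof. by apply: tri_iff; apply: cone_zero_map => i x /=; rewrite scale0r. Qed.

Lemma tri_cone_unit X a b : b * a = 1 -> C (perf_cone (scal a X)).
Proof.
move=> ba; apply/(@tri_iff _ (perf0 R)); last exact: (tri_zero Ctri).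
exact: cone_scal_unit ba.
Qed.

(** The octahedron on $b$ followed by $a$ presents the cone of $a$ as the cone of a map from the
    cone of $b$ to that of $ab$. *)
Lemma tri_scalM X a b : C (perf_cone (scal a X)) -> C (perf_cone (scal b X)) ->
  C (perf_cone (scal (a * b) X)).
Proof.
move=> Ca Cb.
have [|phi phiP] := @cone_octahedron _ X X X (scal b X) (scal a X) (scal (a * b) X).
  by move=> i x /=; rewrite scalerA.
apply: (@tri_cone_target (perf_cone (scal b X)) (perf_cone (scal (a * b) X)) phi) => //.
by apply/(@tri_iff _ (perf_cone (scal a X))).
Qed.

(* The cone of a (+) id on Z (+) X is the cone of a on Z. *)
Lemma tri_summand_scal a (Z X : perf R) : C (perf_dsum Z X) -> C (perf_cone (scal a Z)).
Proof.
move=> CZX; pose f : chain_map (perf_dsum Z X) (perf_dsum Z X) := dsum_map (scal a Z) (scal 1 X).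
have := tri_cone Ctri f CZX CZX.
move/(tri_iso Ctri (X := perf_cone f)
  (Y := perf_dsum (perf_cone (scal a Z)) (perf_cone (scal 1 X))) (cone_dsum _ _)).
move/tri_dsumC; apply: tri_dsum_cancel.
exact: tri_cone_unit (mulr1 1).
Qed.

(* The cones of a and of b a commute, and b a is null-homotopic on the cone of a. *)
Lemma tri_summand_cone_scal a b (U X : perf R) : C (perf_dsum (perf_cone (scal (b * a) U)) X) ->
  C (perf_cone (scal 0 (perf_cone (scal a U)))).
Proof.
move=> /(@tri_summand_scal a) Ca.
apply/(@tri_iff (perf_cone (scal (b * a) (perf_cone (scal a U))))).
  exact: cone_homotopic (scal_cone_null U a b).
apply/(@tri_iff _ (@perf_cone _ (perf_cone (scal a U)) (perf_cone (scal a U))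
    (cone_scal_map (scal (b * a) U) a))); first by apply: cone_ext => i [x y].
apply/(@tri_iff _ (perf_cone (scal a (perf_cone (scal (b * a) U))))) => //.
exact: (cone_scal_cone (scal (b * a) U) a).
Qed.
End Triangulated.

(** * Decomposition of perfect complexes over a principal ideal domain *)

Section PrincipalIdeals.
Variables (R : idomainType) (R_pid : all_ideals_principal R).

Definition divides (a b : R) := exists c, b = c * a.

(** The ascending chain condition. Without a minimal element, choice yields an infinite sequence of
    proper divisors. *)
Lemma pid_minimal (P : R -> Prop) x0 : P x0 ->
  exists2 d, P d & forall e, P e -> divides e d -> divides d e.
Proof.
move=> Px0; apply: contrapT => noP.
have step (d : {d | P d}) :
    exists e : {d | P d}, divides (sval e) (sval d) /\ ~ divides (sval d) (sval e).
  apply: contrapT => noe; apply: noP; exists (sval d); first exact: svalP.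
  move=> e Pe ed; apply: contrapT => de; apply: noe.
  by exists (exist _ e Pe).
have [f fP] := choice step.
pose u n := iter n f (exist _ x0 Px0).
have uS n : divides (sval (u n.+1)) (sval (u n)) by have [] := fP (u n).
have ule n k : divides (sval (u (n + k)%N)) (sval (u n)).
  elim: k => [|k [c ->]]; first by exists 1; rewrite addn0 mul1r.
  by have [d ->] := uS (n + k)%N; exists (c * d); rewrite addnS mulrA.
(* The union of the ideals of the sequence is an ideal, since they are nested. Its generator already
   lies in one of them, so the next step is not proper. *)
have [||g gP] := R_pid (I := fun x => exists n, divides (sval (u n)) x).
- by exists 0%N, 0; rewrite mul0r.
- move=> a x y [n [c ->]] [m [d ->]]; exists (n + m)%N.
  have [c' ->] := ule n m; have [d' ->] := ule m n.
  by exists (a * c * c' + d * d'); rewrite [(m + n)%N]addnC mulrDl !mulrA.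
have [n [c gn]] : exists n, divides (sval (u n)) g.
  by move/seteqP: gP => [_ /(_ g)]; apply; exists 1; rewrite ?mul1r.
have [a _ aE] : [set a * g | a in [set: R]] (sval (u n.+1)).
  by move/seteqP: gP => [/(_ (sval (u n.+1))) + _]; apply; exists n.+1, 1; rewrite mul1r.
by have [_] := fP (u n); apply; exists (a * c); rewrite -aE gn mulrA.
Qed.

Lemma pid_bezout (a b : R) : exists x y c d : R, a = c * (x * a + y * b) /\ b = d * (x * a + y * b).
Proof.
have [||g gP] := R_pid (I := fun z => exists x y, z = x * a + y * b).
- by exists 0, 0; rewrite !mul0r addr0.
- move=> c _ _ [x [y ->]] [x' [y' ->]]; exists (c * x + x'), (c * y + y').
  by rewrite !mulrDl mulrDr !mulrA addrACA.
move/seteqP: gP => [gP gP'].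
have [|x [y gE]] := gP' g; first by exists 1; rewrite ?mul1r.
have [|c _ ca] := gP a; first by exists 1, 0; rewrite mul1r mul0r addr0.
have [|d _ db] := gP b; first by exists 0, 1; rewrite mul1r mul0r add0r.
by exists x, y, c, d; rewrite -gE ca db.
Qed.
End PrincipalIdeals.

Section ProjectiveModules.
Variable (R : idomainType).
Implicit Types M N V : lmodType R.

(** Lifting the identity along a surjection from a free module provides coordinates, which do duty
    for a basis in what follows. *)
Lemma projective_retract M : finitely_generated M -> projective M ->
  exists n (f : {linear M -> 'rV[R]_n}) (g : {linear 'rV[R]_n -> M}), cancel f g.
Proof.
move=> [n [v vP]] Mproj.
have gL : linear (fun x : 'rV[R]_n => \sum_k x 0 k *: v k).
  move=> a x y; rewrite scaler_sumr -big_split; apply: eq_bigr => k _ /=.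
  by rewrite !mxE scalerDl scalerA.
have [m|f fP] := Mproj _ _ (lin gL) (idfun : {linear M -> M}).
  have [c ->] := vP m; exists (\row_k c k).
  by apply: eq_bigr => k _; rewrite mxE.
by exists n, f, (lin gL) => m; exact: fP.
Qed.

Lemma retract_projective M N (f : {linear N -> M}) (g : {linear M -> N}) :
  cancel f g -> projective M -> projective N.
Proof.
move=> fK Mproj P Q u w uS.
have [h hP] := Mproj P Q u (lcomp w g) uS.
by exists (lcomp h f) => x /=; rewrite hP /= fK.
Qed.

Lemma retract_finitely_generated M N (f : {linear N -> M}) (g : {linear M -> N}) :
  cancel f g -> finitely_generated M -> finitely_generated N.
Proof.
move=> fK [n [v vP]]; exists n, (fun k => g (v k)) => x.
have [c cP] := vP (f x); exists c.
by rewrite -[x]fK cP linear_sum; apply: eq_bigr => k _; rewrite linearZ.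
Qed.

(** An upper bound on the rank, by linear dependence; it is the measure for the induction over
    complexes. *)
Definition rank_le M b := forall u : 'I_b.+1 -> M,
  exists2 c : 'I_b.+1 -> R, (exists k, c k != 0) & \sum_k c k *: u k = 0.


Lemma row_rank_le n : rank_le 'rV[R]_n n.
Proof.
(* The $n+1$ rows are padded with a zero last column. The determinant vanishes, and a vector in the
   left kernel is the relation sought. *)
move=> u; pose A : 'M[R]_n.+1 :=
  \matrix_(k, j) oapp (fun j' => u k 0 j') 0 (unlift ord_max j).
have /eqP/det0P[v v0 vA] : \det A = 0.
  rewrite (expand_det_col _ ord_max) big1 // => k _.
  by rewrite mxE unlift_none mul0r.
exists (fun k => v 0 k).
  apply: contrapT => vk; move/eqP: v0; apply; apply/rowP => k; rewrite mxE.
  by apply: contrapT => /eqP vk0; apply: vk; exists k.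
apply/rowP => j; rewrite summxE [RHS]mxE.
move/rowP/(_ (lift ord_max j)): vA; rewrite !mxE => vAj; rewrite -[RHS]vAj.
by apply: eq_bigr => k _; rewrite !mxE liftK.
Qed.

Lemma rank_le_inj M N (f : {linear M -> N}) b : injective f -> rank_le N b -> rank_le M b.
Proof.
move=> f_inj Nb u; have [c c0 cu] := Nb (fun k => f (u k)); exists c => //.
apply: f_inj; rewrite linear0 -[RHS]cu linear_sum.
by apply: eq_bigr => k _; rewrite linearZ.
Qed.

Lemma projective_rank M : finitely_generated M -> projective M -> exists b, rank_le M b.
Proof.
move=> Mfg Mproj; have [n [f [g fK]]] := projective_retract Mfg Mproj.
by exists n; apply: (rank_le_inj (can_inj fK)); exact: row_rank_le.
Qed.

Lemma projective_torsion_free M (a : R) (x : M) : finitely_generated M -> projective M ->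
  a *: x = 0 -> a = 0 \/ x = 0.
Proof.
move=> Mfg Mproj; have [n [f [g fK]]] := projective_retract Mfg Mproj.
move=> ax0; have [->|a0] := eqVneq a 0; [by left|right].
apply: (can_inj fK); rewrite linear0; apply/rowP => k; rewrite mxE.
have /rowP/(_ k) : a *: f x = 0 by rewrite -linearZ ax0 linear0.
by rewrite !mxE => /eqP; rewrite mulf_eq0 (negPf a0) => /eqP.
Qed.

(** Adjoin $w$ to vectors from $N$: applying [phi] to the relation among them shows that the
    coefficient of $w$ is 0. *)
Lemma rank_le_kernel M N (f : {linear N -> M}) (phi : {linear M -> R^o}) w b :
  injective f -> (forall x, phi (f x) = 0) -> phi w = 1 ->
  rank_le M b.+1 -> rank_le N b.
Proof.
move=> f_inj phif phiw Mb u.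
have [c [k ck] cu] := Mb (fun k => oapp (fun k => f (u k)) w (unlift ord0 k)).
move: cu; rewrite big_ord_recl unlift_none /=.
under eq_bigr do rewrite liftK /=.
move=> cu; have c0 : c ord0 = 0.
  move/(congr1 phi): (cu); rewrite linearD linearZ linear0 linear_sum big1 ?addr0.
    by rewrite /= phiw => /eqP; rewrite /GRing.scale /= mulr1 => /eqP.
  by move=> j _; rewrite linearZ /= phif scaler0.
exists (fun k => c (lift ord0 k)).
  case: (unliftP ord0 k) ck => [j ->|->]; last by rewrite c0 eqxx.
  by exists j.
apply: f_inj; move: cu; rewrite c0 scale0r add0r linear0 linear_sum => cu; rewrite -[RHS]cu.
by apply: eq_bigr => j _; rewrite linearZ.
Qed.

Lemma rank_le0 M : finitely_generated M -> projective M -> rank_le M 0 ->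
  forall x : M, x = 0.
Proof.
move=> Mfg Mproj M0 x; have [c [k ck]] := M0 (fun=> x).
rewrite big_ord1; move: k ck => k; rewrite (ord1 k) => ck.
by move/(projective_torsion_free Mfg Mproj) => [c0|//]; rewrite c0 eqxx in ck.
Qed.

Hypothesis R_pid : all_ideals_principal R.

(* The ideal (a) is maximal among the ideals phi (im f), phi ranging over the linear
   forms on M; Bezout then shows that a divides f v and all of phi (im f). *)
Lemma split_pair V M (f : {linear V -> M}) : finitely_generated M -> projective M ->
  (exists v, f v != 0) -> exists (a : R) v w (phi : {linear M -> R^o}) (theta : {linear V -> R^o}),
  [/\ a != 0, f v = a *: w, phi w = 1, theta v = 1 & forall x, phi (f x) = a * theta x].
Proof.
move=> Mfg Mproj [v0 fv0]; have [n [i [r iK]]] := projective_retract Mfg Mproj.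
pose P (a : R) := a != 0 /\ exists (phi : {linear M -> R^o}) v, phi (f v) = a.
have coordL k : linear (fun x : M => i x 0 k : R^o) by move=> c x y; rewrite linearP !mxE.
have [a0 Pa0] : exists a, P a.
  have [k ik] : exists k, i (f v0) 0 k != 0.
    apply: contrapT => nok; move/eqP: fv0; apply; apply: (can_inj iK).
    rewrite linear0; apply/rowP => k; rewrite mxE; apply: contrapT => /eqP ik.
    by apply: nok; exists k.
  by exists (i (f v0) 0 k); split=> //; exists (lin (coordL k)), v0.
have [a [an0 [phi [v phiv]]] amin] := pid_minimal R_pid Pa0.
have div_gcd b : (exists (psi : {linear M -> R^o}) x, psi (f x) = b) ->
    divides b a -> divides a b.
  move=> Pb ba; apply: amin => //; split=> //; apply: contra_neq an0 => b0.
  by case: ba => c ->; rewrite b0 mulr0.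
have divl (psi : {linear M -> R^o}) : divides a (psi (f v)).
  have [x [y [c [d [ac bd]]]]] := pid_bezout R_pid a (psi (f v)).
  have [||e eE] := div_gcd (x * a + y * psi (f v)).
  - by exists (ladd (x \*: phi) (y \*: psi)), v; rewrite /= phiv.
  - by exists c.
  - by exists (d * e); rewrite bd {1}eE mulrA.
have divr x' : divides a (phi (f x')).
  have [x [y [c [d [ac bd]]]]] := pid_bezout R_pid a (phi (f x')).
  have [||e eE] := div_gcd (x * a + y * phi (f x')).
  - by exists phi, (x *: v + y *: x'); rewrite !(linearD, linearZ) /= phiv.
  - by exists c.
  - by exists (d * e); rewrite bd {1}eE mulrA.
have [th thP] := choice divr.
have thL : linear (th : V -> R^o).
  move=> c x y; apply: (mulIf an0); rewrite -thP mulrDl -thP.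
  rewrite linearD linearZ /= linearD linearZ /=. by rewrite -mulrA -thP.
have [d dP] := choice (fun k => divl (lin (coordL k))).
have vw : f v = a *: r (\row_k d k).
  rewrite -[LHS]iK -linearZ; congr (r _).
  by apply/rowP => k; rewrite !mxE mulrC -(dP k).
exists a, v, (r (\row_k d k)), phi, (lin thL); split=> //.
- by apply: (mulfI an0); rewrite mulr1 -[RHS]phiv vw linearZ.
- by apply: (mulIf an0); rewrite /= -thP phiv mul1r. 
- by move=> x; rewrite thP mulrC.
Qed.
End ProjectiveModules.

Section Kernel.
Variables (A : nzRingType) (V W : lmodType A) (f : {linear V -> W}).

Record ker_type := KerType { ker_val : V; _ : f ker_val == 0 }.
HB.instance Definition _ := [isSub for ker_val].
HB.instance Definition _ := [Choice of ker_type by <:].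

Lemma ker_submod : GRing.subsemimod_closed (fun x : V => f x == 0).
Proof.
split=> [|a x]; first split=> [|x y]; rewrite !unfold_in ?linear0 //.
  by move=> /eqP x0 /eqP y0; rewrite linearD x0 y0 addr0.
by move=> /eqP x0; rewrite linearZ x0 /= scaler0.
Qed.
HB.instance Definition _ :=
  GRing.SubChoice_isSubLmodule.Build A V _ ker_type ker_submod.

Lemma ker_val_linear : linear ker_val.
Proof. by []. Qed.
Definition ker_incl : {linear ker_type -> V} := lin ker_val_linear.

Lemma ker_incl0 x : f (ker_incl x) = 0.
Proof. by case: x => x /= /eqP. Qed.

Lemma ker_incl_inj : injective ker_incl.
Proof. exact: val_inj. Qed.

Lemma ker_lift_linear (U : lmodType A) (g : {linear U -> V}) (fg : forall x, f (g x) == 0) :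
  linear (fun x => KerType (fg x)).
Proof. by move=> a x y; apply: val_inj; rewrite /= linearP. Qed.
Definition ker_lift U g fg := lin (@ker_lift_linear U g fg).
End Kernel.

Section Retract.
Variables (R : idomainType) (X E : perf R) (i : chain_map E X) (p : chain_map X E).
Hypothesis iK : forall j, cancel (i j) (p j).

Let kobj j : lmodType R := ker_type (p j).
Lemma retract_diff_subproof j (x : kobj j) : p (j - 1) (cdiff X j (ker_incl _ x)) == 0.
Proof. by rewrite cmapP ker_incl0 linear0. Qed.

Definition retract_kernel_complex : complex R.
Proof.
refine (@Complex R kobj (fun j => ker_lift (g := lcomp (cdiff X j) (ker_incl (p j)))
  (@retract_diff_subproof j)) _).
by move=> j x; apply: val_inj; rewrite /= cdiffK.
Defined.

Lemma retract_proj_subproof j (x : X j) :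
  p j (ladd idfun (lopp (lcomp (i j) (p j))) x) == 0.
Proof. by rewrite /= linearD linearN iK subrr. Qed.
Let q j := ker_lift (@retract_proj_subproof j).
Let qK j : cancel (ker_incl (p j)) (q j).
Proof. by move=> x; apply: val_inj; rewrite /= ker_incl0 linear0 subr0. Qed.

Lemma retract_kernel_perfect : perfect retract_kernel_complex.
Proof.
have [[n nP] XP] := perfP X; split=> [|j].
  by exists n => j nj x; apply: val_inj; exact: nP.
have [fg pr] := XP j; split.
  exact: retract_finitely_generated (@qK j) fg.
exact: retract_projective (@qK j) pr.
Qed.
Definition retract_kernel : perf R := Perf retract_kernel_perfect.

(** The retraction holds strictly in each degree, so the kernel of $p$ is a complement on the level
    of complexes, by $x\mapsto(px,x-ipx)$. No idempotent has to be split up to homotopy. *)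
Lemma retract_split : homotopy_equivalent (perf_dsum E retract_kernel) X.
Proof.
set L := perf_dsum _ _.
unshelve epose (u := @ChainMap _ L X
  (fun j => ladd (lcomp (i j) lfst) (lcomp (ker_incl (p j)) lsnd)) _).
  by move=> j [e k] /=; rewrite cmapP linearD.
unshelve epose (v := @ChainMap _ X L (fun j => lpair (p j) (q j)) _).
  by move=> j x; congr pair; [rewrite /= cmapP|apply: val_inj; rewrite /= !cmapP linearB].
apply: (@iso_homotopy_equivalent _ _ _ u v) => j x /=.
  case: x => e k; congr pair; [|apply: val_inj]; rewrite /= linearD iK ker_incl0 addr0 //.
  by rewrite addrAC subrr add0r.
by rewrite addrCA subrr addr0.
Qed.
End Retract.

(** * Stalk complexes and the splitting of elementary summands *)

Section Stalk.
Variable (R : idomainType).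
Implicit Types (X Y : complex R) (V W : lmodType R).

(** Row vectors whose length is a truth value give $R$ in degree $i$ and 0 elsewhere, with no case
    distinction between types. *)
Definition stalk_complex (i : int) : complex R.
Proof.
by refine (@Complex R (fun j => 'rV[R]_(j == i)) (fun j => \0) _).
Defined.

Lemma rowV_fg n : finitely_generated 'rV[R]_n.
Proof.
exists n, (fun k => delta_mx 0 k) => x; exists (fun k => x 0 k).
exact: row_sum_delta.
Qed.

Lemma rowV_projective n : projective 'rV[R]_n.
Proof.
move=> P Q g f gS; have [h hP] := choice (fun k : 'I_n => gS (f (delta_mx 0 k))).
have hL : linear (fun x : 'rV[R]_n => \sum_k x 0 k *: h k).
  move=> a x y; rewrite scaler_sumr -big_split; apply: eq_bigr => k _ /=.
  by rewrite !mxE scalerDl scalerA.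
exists (lin hL) => x; rewrite [in RHS](row_sum_delta x) !linear_sum.
by apply: eq_bigr => k _; rewrite !linearZ hP.
Qed.

Lemma stalk_perfect i : perfect (stalk_complex i).
Proof.
split; last by move=> j; split; [exact: rowV_fg | exact: rowV_projective].
exists `|i|%N => j ij x; apply/rowP => -[k kP]; exfalso; move: kP.
by case: eqP => // ji; rewrite ji in ij; lia.
Qed.
Definition stalk i : perf R := Perf (stalk_perfect i).

(** For length 1 this is the map $R\to V$ that sends 1 to $v$, and for length 0 it is zero; so one
    formula defines the maps out of a stalk in every degree. [row_of] plays the same role for maps
    into a stalk. *)
Definition row_comb (V : lmodType R) n (v : V) (x : 'rV[R]_n) := \sum_k x 0 k *: v.
Lemma row_comb_linear V n v : linear (@row_comb V n v).
Proof.
move=> a x y; rewrite scaler_sumr -big_split; apply: eq_bigr => k _ /=.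
by rewrite !mxE scalerDl scalerA.
Qed.
Definition row_of (V : lmodType R) n (phi : {linear V -> R^o}) (v : V) : 'rV[R]_n :=
  \row_k phi v.
Lemma row_of_linear V n phi : linear (@row_of V n phi).
Proof. by move=> a x y; apply/rowP => k; rewrite !mxE linearP. Qed.

Lemma row_combZ V n (v : V) a (x : 'rV[R]_n) :
  row_comb (a *: v) x = row_comb v (a *: x).
Proof. by apply: eq_bigr => k _; rewrite !mxE scalerA mulrC. Qed.

Lemma row_comb_map V W n (f : {linear V -> W}) v (x : 'rV[R]_n) :
  f (row_comb v x) = row_comb (f v) x.
Proof. by rewrite linear_sum; apply: eq_bigr => k _; rewrite linearZ. Qed.

Lemma row_comb0 V n (x : 'rV[R]_n) : row_comb (0 : V) x = 0.
Proof. by rewrite /row_comb big1 // => k _; rewrite scaler0. Qed.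

Lemma row_comb_empty V n (v : V) (x : 'rV[R]_n) : n = 0%N -> row_comb v x = 0.
Proof. by move=> n0; subst n; rewrite /row_comb big_ord0. Qed.

Lemma row_of_comb V (b : bool) (phi : {linear V -> R^o}) v (x : 'rV[R]_b) :
  (b -> phi v = 1) -> row_of b phi (row_comb v x) = x.
Proof.
case: b x => x phiv; apply/rowP => k; last by case: k.
rewrite mxE /row_comb linear_sum big_ord1 linearZ phiv //= [k]ord1.
exact: mulr1.
Qed.

Lemma row_empty n (x : 'rV[R]_n) : n = 0%N -> x = 0.
Proof. by move=> n0; subst n; apply/rowP => -[]. Qed.

Lemma row_of_eq0 V n (phi : {linear V -> R^o}) x :
  (0 < n)%N -> row_of n phi x = 0 -> phi x = 0.
Proof. by move=> n0 /rowP/(_ (Ordinal n0)); rewrite !mxE. Qed.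

Lemma stalk_zero i j (x : stalk i j) : j != i -> x = 0.
Proof. by move=> /negPf ji; apply: row_empty; rewrite ji. Qed.

Section ElementaryRetract.
Variables (X : perf R) (a : R) (i : int).
Variables (v w : forall j, X j) (theta phi : forall j, {linear X j -> R^o}).
Hypothesis dv : forall j, cdiff X j (v j) = a *: w (j - 1).
Hypothesis dw : forall j, cdiff X j (w j) = 0.
Hypothesis thetad : forall j x, theta (j - 1) (cdiff X j x) = 0.
Hypothesis phid : forall j x, phi (j - 1) (cdiff X j x) = a * theta j x.
Hypothesis phiw : phi i (w i) = 1.
Hypothesis thetav : theta (i + 1) (v (i + 1)) = 1.
Let E := perf_cone (scal a (stalk i)).

Let inc_lin j : {linear E j -> X j} :=
  ladd (lcomp (lin (@row_comb_linear (X j) (j - 1 == i) (v j))) lfst)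
       (lcomp (lin (@row_comb_linear (X j) (j == i) (w j))) lsnd).
Let out_lin j : {linear X j -> E j} :=
  lpair (lin (@row_of_linear (X j) (j - 1 == i) (theta j)))
        (lin (@row_of_linear (X j) (j == i) (phi j))).

(** $E$ is $a:R\to R$ in degrees $i+1$ and $i$; [v] and [w] embed its basis vectors, and [theta] and
    [phi] are the dual coordinates. Families over all degrees avoid transport along equations. The
    last clause makes the complement lie in the kernel of [phi], which lowers the rank. *)
Lemma cone_stalk_retract : exists (f : chain_map E X) (g : chain_map X E),
  (forall j, cancel (f j) (g j)) /\
  forall x, g i x = 0 -> phi i x = 0.
Proof.
unshelve epose (f := @ChainMap _ E X inc_lin _).
  move=> j [x y] /=; rewrite linearD !row_comb_map dv dw row_comb0 addr0.
  by rewrite oppr0 row_combZ addr0 -[0]/(0 : 'rV_ _) /row_comb big1 ?add0r // => k _; 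
    rewrite mxE scale0r.
unshelve epose (g := @ChainMap _ X E out_lin _).
  move=> j x; congr pair; apply/rowP => k; rewrite !mxE.
    by rewrite thetad oppr0.
  by rewrite phid addr0.
exists f, g; split=> [j [x y]|x].
  have [ji|ji] := eqVneq (j - 1) i.
    have nji : j != i by rewrite -subr_eq0 -ji opprB addrC subrK.
    rewrite /= (@row_comb_empty _ _ (w j)) ?(negPf nji) // addr0; congr pair.
      by apply: row_of_comb; move: ji => /(canRL (subrK 1)) ->.
    exact: etrans (stalk_zero _ nji) (esym (stalk_zero _ nji)).
  rewrite /= (@row_comb_empty _ _ (v j)) ?(negPf ji) // add0r; congr pair.
    have e : nat_of_bool (j - 1 == i) = 0%N by rewrite (negPf ji).
    exact: etrans (row_empty _ e) (esym (row_empty _ e)).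
  by apply: row_of_comb => /eqP ->.
by move=> /(congr1 snd) /=; apply: row_of_eq0; rewrite eqxx.
Qed.
End ElementaryRetract.

Section StalkRetract.
Variables (X : perf R) (i : int) (w : forall j, X j) (phi : forall j, {linear X j -> R^o}).
Hypothesis dw : forall j, cdiff X j (w j) = 0.
Hypothesis phid : forall j x, phi (j - 1) (cdiff X j x) = 0.
Hypothesis phiw : phi i (w i) = 1.

Let inc_lin j : {linear stalk i j -> X j} := lin (@row_comb_linear (X j) (j == i) (w j)).
Let out_lin j : {linear X j -> stalk i j} := lin (@row_of_linear (X j) (j == i) (phi j)).

Lemma stalk_retract : exists (f : chain_map (stalk i) X) (g : chain_map X (stalk i)),
  (forall j, cancel (f j) (g j)) /\
  forall x, g i x = 0 -> phi i x = 0.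
Proof.
unshelve epose (f := @ChainMap _ (stalk i) X inc_lin _).
  move=> j x /=; rewrite row_comb_map dw row_comb0.
  by rewrite /row_comb big1 // => k _; rewrite mxE scale0r.
unshelve epose (g := @ChainMap _ X (stalk i) out_lin _).
  by move=> j x; apply/rowP => k; rewrite !mxE phid.
exists f, g; split=> [j x|x]; first by apply: row_of_comb => /eqP ->.
by apply: row_of_eq0; rewrite eqxx.
Qed.
End StalkRetract.

(** Turns a datum in one degree into a family over all degrees, with a default value elsewhere. *)
Lemma family_at (T : int -> Type) (d : forall j, T j) i (x : T i) :
  exists f : forall j, T j, f i = x /\ forall j, j != i -> f j = d j.
Proof.
exists (dfwith d x); split=> [|j ji]; first exact: dfwith_in.
by apply: dfwith_out; rewrite eq_sym.
Qed.

Lemma elementary_retract (X : perf R) (a : R) i (v : X i) (w : X (i - 1))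
    (theta : {linear X i -> R^o}) (phi : {linear X (i - 1) -> R^o}) :
  a != 0 -> cdiff X i v = a *: w -> phi w = 1 -> theta v = 1 ->
  (forall x, phi (cdiff X i x) = a * theta x) ->
  exists (f : chain_map (perf_cone (scal a (stalk (i - 1)))) X)
         (g : chain_map X (perf_cone (scal a (stalk (i - 1))))),
    (forall j, cancel (f j) (g j)) /\ forall x, g (i - 1) x = 0 -> phi x = 0.
Proof.
move=> a0 dv phiw thetav phid.
have [v' [v'i v'0]] := family_at (fun j => 0 : X j) v.
have [w' [w'i w'0]] := family_at (fun j => 0 : X j) w.
have [th [thi th0]] := family_at (fun j => \0 : {linear X j -> R^o}) theta.
have [ph [phi' ph0]] := family_at (fun j => \0 : {linear X j -> R^o}) phi.
have eq1 j : (j - 1 == i - 1) = (j == i) by rewrite (inj_eq (addIr _)).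
have dw : cdiff X (i - 1) w = 0.
  have [fg pr] := (perfP X).2 (i - 1 - 1).
  have : a *: cdiff X (i - 1) w = 0 by rewrite -linearZ -dv cdiffK.
  by case/(projective_torsion_free fg pr) => // aE; rewrite aE eqxx in a0.
have phd j x : ph (j - 1) (cdiff X j x) = a * th j x.
  have [ji|ji] := eqVneq j i; last by rewrite th0 // ph0 ?eq1 //= mulr0.
  by move: x; rewrite ji phi' thi => x; rewrite phid.
have [||||||f [g [fK gP]]] := @cone_stalk_retract X a (i - 1) v' w' th ph => //.
- move=> j; have [->|ji] := eqVneq j i; first by rewrite v'i w'i.
  by rewrite v'0 // w'0 ?eq1 // linear0 scaler0.
- move=> j; have [->|ji] := eqVneq j (i - 1); first by rewrite w'i.
  by rewrite w'0 // linear0.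
(* Here $a\theta d=\varphi dd=0$, and $a$ can be cancelled. *)
- move=> j x; apply: (mulfI a0); rewrite mulr0.
  by apply: etrans (esym (phd _ _)) _; rewrite cdiffK linear0.
- by rewrite phi' w'i.
- by rewrite subrK thi v'i.
by exists f, g; split=> // x /gP; rewrite phi'.
Qed.

Lemma summand_retract (X : perf R) i (w : X i) (phi : {linear X i -> R^o}) :
  phi w = 1 -> cdiff X i w = 0 -> (forall j (e : j - 1 = i) x, cdiff X j x = 0) ->
  exists (f : chain_map (stalk i) X) (g : chain_map X (stalk i)),
    (forall j, cancel (f j) (g j)) /\ forall x, g i x = 0 -> phi x = 0.
Proof.
move=> phiw dw d0.
have [w' [w'i w'0]] := family_at (fun j => 0 : X j) w.
have [ph [phi' ph0]] := family_at (fun j => \0 : {linear X j -> R^o}) phi.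
have [|||f [g [fK gP]]] := @stalk_retract X i w' ph => //.
- move=> j; have [->|ji] := eqVneq j i; first by rewrite w'i.
  by rewrite w'0 // linear0.
- move=> j x; have [ji|ji] := eqVneq (j - 1) i; last by rewrite ph0.
  by rewrite d0 // linear0.
- by rewrite phi' w'i.
by exists f, g; split=> // x /gP; rewrite phi'.
Qed.

Lemma zero_homotopy_equivalent X : (forall i (x : X i), x = 0) ->
  homotopy_equivalent X (zero_complex R).
Proof.
by move=> X0; apply: (@contractible_zero _ _ (fun=> \0)) => i x; rewrite [LHS]X0 [RHS]X0.
Qed.

Section Decomposition.
Hypothesis R_pid : all_ideals_principal R.
Variable P : perf R -> Prop.
Hypothesis P_iso : forall X Y : perf R, homotopy_equivalent X Y -> P X -> P Y.
Hypothesis P_zero : P (perf0 R).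
Hypothesis P_stalk : forall i (X : perf R), P X -> P (perf_dsum (stalk i) X).
Hypothesis P_cone : forall a i (X : perf R), a != 0 -> P X ->
  P (perf_dsum (perf_cone (scal a (stalk i))) X).

(* Induction on the width m of X and on the rank b of its lowest module X_(i-1). *)
Lemma decomposition_bounded (m : nat) : forall (i : int) b (X : perf R),
  (forall j : int, j < i - 1 -> forall x : X j, x = 0) ->
  (forall j : int, i - 1 + m%:Z <= j -> forall x : X j, x = 0) ->
  rank_le (X (i - 1)) b -> P X.
Proof.
elim: m => [|m IHm] i b X Xlow Xhigh Xb.
  apply: P_iso P_zero; apply/homotopy_equivalent_sym/zero_homotopy_equivalent => j x.
  by have [ij|ij] := ltP j (i - 1); [exact: Xlow|apply: Xhigh; rewrite addr0].
elim: b X Xlow Xhigh Xb => [|b IHb] X Xlow Xhigh Xb; have [_ Xp] := perfP X.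
  have X0 x : x = 0 :> X (i - 1) by apply: rank_le0 Xb x; case: (Xp (i - 1)).
  (* The lowest module is zero, so the window moves up by one degree. *)
  have [b' Xb'] := projective_rank (Xp (i + 1 - 1)).1 (Xp (i + 1 - 1)).2.
  apply: (IHm (i + 1) b') => // j ij x; last by apply: Xhigh; lia.
  have [ji|ji] := eqVneq j (i - 1); first by move: x; rewrite ji.
  by apply: Xlow; lia.
have inj_kernel (E : perf R) (f : chain_map E X) (g : chain_map X E) (fK : forall j, cancel (f j) (g j))
    (w : X (i - 1)) (phi : {linear X (i - 1) -> R^o}) : phi w = 1 ->
    (forall x, g (i - 1) x = 0 -> phi x = 0) -> P (retract_kernel fK).
  move=> phiw gphi; apply: IHb.
  - by move=> j ij x; apply: val_inj; exact: Xlow.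
  - by move=> j ij x; apply: val_inj; exact: Xhigh.
  apply: (rank_le_kernel (f := ker_incl (g (i - 1))) _ _ phiw Xb).
    exact: ker_incl_inj.
  by move=> x; apply: gphi; exact: ker_incl0.
(* A nonzero differential into the lowest module splits off a cone. If that differential vanishes, a
   stalk splits off, unless the module is zero and satisfies every rank bound. *)
have [[v dv]|d0] := pselect (exists v, cdiff X i v != 0).
  have [|a [v' [w [phi [theta [a0 dvw phiw thv phid]]]]]] :=
    @split_pair R R_pid _ _ (cdiff X i) (Xp (i - 1)).1 (Xp (i - 1)).2; first by exists v.
  have [f [g [fK gphi]]] := elementary_retract a0 dvw phiw thv phid.
  apply: P_iso (retract_split fK) _; apply: P_cone => //.
  exact: inj_kernel phiw gphi.
have [[w w0]|X0] := pselect (exists w : X (i - 1), w != 0).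
  have [|a [v' [w' [phi [theta [a0 vw phiw thv phid]]]]]] :=
    @split_pair R R_pid _ _ (idfun : {linear X (i - 1) -> _}) (Xp (i - 1)).1 (Xp (i - 1)).2;
    first by exists w.
  have [||f [g [fK gphi]]] := @summand_retract X (i - 1) w' phi phiw.
  - by apply: Xlow; lia.
  - move=> j /(addIr _) ji x; move: x; rewrite ji => x.
    by apply: contrapT => /eqP dx; apply: d0; exists x.
  apply: P_iso (retract_split fK) _; apply: P_stalk.
  exact: inj_kernel phiw gphi.
apply: IHb => // u; exists (fun=> 1); first by exists ord0; rewrite oner_eq0.
by apply: contrapT => /eqP x0; apply: X0; eexists; exact: x0.
Qed.

(** The decomposition has the form of an induction principle for homotopy invariant properties, so
    that each application can strengthen [P] with hypotheses of its own. *)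
Lemma perf_decomposition (X : perf R) : P X.
Proof.
have [[n Xn] Xp] := perfP X.
have [b Xb] := projective_rank (Xp (- n%:Z - 1)).1 (Xp (- n%:Z - 1)).2.
(* The window covers the degrees from $-n-1$ to $n$; it begins below $-n$ because the lowest module
   is the one in degree $i-1$. *)
apply: (@decomposition_bounded (n + n).+2 (- n%:Z) b) => // j jn x; apply: Xn; lia.
Qed.
End Decomposition.

End Stalk.

(** * Lengths and localisation *)

Section Length.
Variable A : nzRingType.
Implicit Types V W : lmodType A.

Definition chain_in V (N : {pred V}) n c := submodule_chain n c /\ {subset c n <= N}.

(** Length of a submodule, measured by chains in the ambient module: kernels and images remain
    predicates. *)
Definition slen V (N : {pred V}) n :=
  (exists c, chain_in N n c) /\ (forall m c, chain_in N m c -> (m <= n)%N).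

Definition ker_pred V W (f : {linear V -> W}) : {pred V} := fun x => f x == 0.
Definition im_pred V W (f : {linear V -> W}) : {pred W} := fun y => `[< exists x, f x = y >].

Lemma has_lengthE V n : has_length V n <-> slen (predT : {pred V}) n.
Proof.
split=> -[[c cP] mx]; split.
- by exists c; split.
- by move=> m d [dP _]; exact: mx dP.
- by exists c; case: cP.
- by move=> m d dP; apply: (mx m d); split.
Qed.

Lemma slen_uniq V (N : {pred V}) n m : slen N n -> slen N m -> n = m.
Proof.
by move=> [[c cP] cx] [[d dP] dx]; apply/eqP; rewrite eqn_leq (cx _ _ dP) (dx _ _ cP).
Qed.

Lemma has_length_uniq V n m : has_length V n -> has_length V m -> n = m.
Proof. by rewrite !has_lengthE; exact: slen_uniq. Qed.

Lemma eq_slen V (N N' : {pred V}) n : N =i N' -> slen N n -> slen N' n.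
Proof. by move=> NN; suff -> : N = N' by []; apply/funext. Qed.

Lemma slen_exists V (N : {pred V}) b : GRing.submod_closed N ->
  (forall m c, chain_in N m c -> (m <= b)%N) -> exists n, slen N n.
Proof.
move=> Nsub Nb; pose P n := `[< exists c, chain_in N n c >].
have P0 : exists n, P n by exists 0%N; apply/asboolP; exists (fun=> N); split.
have Pb n : P n -> (n <= b)%N by move=> /asboolP[c] /Nb.
have [n /asboolP nP nx] := ex_maxnP P0 Pb; exists n; split=> // m c cP.
by apply: nx; apply/asboolP; exists c.
Qed.

Definition strict_step V (c : nat -> {pred V}) i : bool :=
  `[< exists2 x, x \in c i.+1 & x \notin c i >].

(** Dropping the repetitions from a weakly increasing chain leaves as many steps as were strict, and
    keeps the top. *)
Lemma chain_refine V (c : nat -> {pred V}) m :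
  (forall i, (i <= m)%N -> GRing.submod_closed (c i)) ->
  (forall i, (i < m)%N -> {subset c i <= c i.+1}) ->
  exists d, submodule_chain (\sum_(i < m) strict_step c i)%N d /\
            d (\sum_(i < m) strict_step c i)%N = c m.
Proof.
elim: m => [|m IHm] cs cc; first by exists c; rewrite big_ord0; split=> //; split=> // -[|i] // _; exact: cs.
have [i im|i im|d [[ds dc] dE]] := IHm; [exact: cs (leqW im)|exact: cc (leqW im)|].
rewrite big_ord_recr /=; set k := (\sum_(i < m) _)%N in ds dc dE *.
case: (boolP (strict_step c m)) => [/asboolP[x xm nxm]|nstrict]; last first.
  exists d; rewrite addn0; split=> //; rewrite dE; apply/funext => x; apply/idP/idP.
    exact: cc.
  move=> xm; apply: contraNT nstrict => nx; apply/asboolP; exists x => //.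
exists (fun i => if (i <= k)%N then d i else c m.+1); rewrite addn1 ltnn; split=> //.
split=> i; first by case: ifP => [ik _|_ _]; [exact: ds|exact: cs].
rewrite ltnS => ik; rewrite ik; case: ltnP => ik'; first exact: dc.
have -> : i = k by apply/eqP; rewrite eqn_leq ik.
by rewrite dE; split; [exact: cc | exists x].
Qed.

Lemma count_strict_le V (N : {pred V}) n (c : nat -> {pred V}) m : slen N n ->
  (forall i, (i <= m)%N -> GRing.submod_closed (c i)) ->
  (forall i, (i < m)%N -> {subset c i <= c i.+1}) -> {subset c m <= N} ->
  (\sum_(i < m) strict_step c i <= n)%N.
Proof.
move=> [_ Nx] cs cc cN; have [d [dP dE]] := chain_refine cs cc.
by apply: (Nx _ d); split; rewrite ?dE.
Qed.

Lemma submodB V (N : {pred V}) x y : GRing.submod_closed N -> x \in N -> y \in N -> x - y \in N.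
Proof. by case=> _ NL xN yN; have := NL (-1) y x yN xN; rewrite scaleN1r addrC. Qed.

Lemma submodD V (N : {pred V}) x y : GRing.submod_closed N -> x \in N -> y \in N -> x + y \in N.
Proof. by case=> _ NL xN yN; have := NL 1 x y xN yN; rewrite scale1r. Qed.

Section RankNullity.
Variables (V W : lmodType A) (f : {linear V -> W}).

Lemma ker_pred_submod : GRing.submod_closed (ker_pred f).
Proof.
split=> [|a x y]; rewrite !unfold_in /ker_pred ?linear0 //.
by move=> /eqP x0 /eqP y0; rewrite linearP x0 y0 scaler0 addr0.
Qed.

Definition im_of (N : {pred V}) : {pred W} := fun y => `[< exists2 x, x \in N & f x = y >].

Lemma im_of_submod N : GRing.submod_closed N -> GRing.submod_closed (im_of N).
Proof.
case=> N0 NL; split=> [|a x y /asboolP[u uN <-] /asboolP[v vN <-]]; apply/asboolP.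
  by exists 0; rewrite ?linear0.
by exists (a *: u + v); rewrite ?linearP //; exact: NL.
Qed.

Lemma im_pred_submod : GRing.submod_closed (im_pred f).
Proof.
split=> [|a x y /asboolP[u <-] /asboolP[v <-]]; apply/asboolP.
  by exists 0; rewrite linear0.
by exists (a *: u + v); rewrite linearP.
Qed.

Definition preim_of (N : {pred W}) : {pred V} := fun x => f x \in N.

Lemma preim_of_submod N : GRing.submod_closed N -> GRing.submod_closed (preim_of N).
Proof.
case=> N0 NL; split=> [|a x y]; rewrite !unfold_in /preim_of ?linear0 //.
by rewrite linearP; exact: NL.
Qed.

(** A chain in the kernel continues with preimages of a chain in the image, which bounds the length
    from below. For the upper bound, each step of a chain in $V$ remains strict after intersection
    with the kernel or after application of $f$. *)
Lemma rank_nullity k r : slen (ker_pred f) k -> slen (im_pred f) r -> has_length V (k + r).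
Proof.
move=> kP rP; split.
  have [[c [[cs cc] cker]] _] := kP; have [[d [[ds dc] dim]] _] := rP.
  exists (fun i => if (i <= k)%N then c i else preim_of (d (i - k)%N)); split=> i.
    case: ifP => [ik _|/negbT]; first exact: cs.
    rewrite -ltnNge => ki ikr; apply: preim_of_submod; apply: ds; lia.
  move=> ikr; have [ik|ki|ik] := ltngtP i k.
  - by apply: cc.
  - have lt : (i - k < r)%N by lia.
    have [sub [y yd nyd]] := dc _ lt.
    rewrite subSn; last exact: ltnW.
    split=> [x|]; first exact: sub.
    have dle j : (i - k < j)%N -> (j <= r)%N -> {subset d (i - k).+1 <= d j}.
      elim: j => // j IHj; rewrite ltnS leq_eqVlt => /orP[/eqP <-|ij] jr z zd //.
      by apply: (dc j jr).1; apply: IHj => //; exact: ltnW.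
    have /asboolP[x xy] := dim y (dle r lt (leqnn r) y yd).
    by exists x; rewrite unfold_in /preim_of xy.
  (* Where the two pieces meet: [d 0] contains 0, so a preimage of an element outside [d 0] is
     outside the kernel. *)
  - rewrite ik in ikr *; rewrite subSn // subnn.
    have r0 : (0 < r)%N by lia.
    have [sub [y yd nyd]] := dc _ r0.
    have [d0 _] := ds 0%N isT.
    split=> [x /cker|].
      rewrite unfold_in => /eqP fx; rewrite unfold_in /preim_of fx.
      by have [] := ds 1%N r0.
    have dle j : (0 < j)%N -> (j <= r)%N -> {subset d 1%N <= d j}.
      elim: j => // j IHj _; have [->|j0] := posnP j; move=> jr z zd //.
      by apply: (dc j jr).1; apply: IHj => //; exact: ltnW.
    have /asboolP[x xy] := dim y (dle r r0 (leqnn r) y yd).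
    exists x; first by rewrite unfold_in /preim_of xy.
    apply: contra nyd => /cker; rewrite unfold_in => /eqP fx.
    by rewrite -xy fx.
move=> m c [cs cc].
pose c1 i : {pred V} := fun x => (x \in c i) && (f x == 0).
have c1E i x : (x \in c1 i) = (x \in c i) && (f x == 0) by [].
pose c2 i := im_of (c i).
have cnt1 : (\sum_(i < m) strict_step c1 i <= k)%N.
  apply: count_strict_le kP _ _ _ => [i im|i im x|x].
  - have [c0 cL] := cs i im; split=> [|a x y]; rewrite c1E.
      by rewrite c0 linear0 eqxx.
    rewrite !c1E => /andP[xc /eqP x0] /andP[yc /eqP y0].
    by rewrite linearP x0 y0 scaler0 addr0 eqxx andbT; exact: cL.
  - by rewrite !c1E => /andP[/(cc i im).1 -> ->].
  - by rewrite c1E => /andP[].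
have cnt2 : (\sum_(i < m) strict_step c2 i <= r)%N.
  apply: count_strict_le rP _ _ _ => [i im|i im x|x].
  - by apply: im_of_submod; exact: cs.
  - by move=> /asboolP[u uc ux]; apply/asboolP; exists u => //; exact: (cc i im).1.
  - by move=> /asboolP[u uc ux]; apply/asboolP; exists u.
apply: leq_trans (leq_add cnt1 cnt2); rewrite -big_split /=.
rewrite -[X in (X <= _)%N]card_ord -sum1_card leq_sum // => i _.
have [sub [x xc nxc]] := cc i (ltn_ord i).
case: (boolP (strict_step c2 i)) => [_|ns]; first by rewrite addn1.
(* If the image does not grow, then $f(x)=f(y)$ for some $y$ of the smaller module, and $x-y$ is a
   new element of the kernel. *)
suff -> : strict_step c1 i by [].
have : f x \in c2 i.
  apply: contraNT ns => nfx; apply/asboolP; exists (f x) => //.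
  by apply/asboolP; exists x.
move=> /asboolP[y yc fxy]; apply/asboolP; exists (x - y).
  rewrite c1E linearB fxy subrr eqxx andbT.
  by apply: submodB => //; [exact: cs (ltn_ord i)|exact: sub].
apply: contra nxc; rewrite c1E => /andP[xyc _].
by rewrite -(subrK y x); apply: submodD => //; exact: cs (ltnW (ltn_ord i)).
Qed.

(** Chains in the kernel are chains in $V$ and chains in the image pull back to $V$, so the length
    of $V$ bounds both. *)
Lemma rank_nullity_inv n : has_length V n ->
  exists k r, [/\ slen (ker_pred f) k, slen (im_pred f) r & n = (k + r)%N].
Proof.
move=> Vn; have [_ Vx] := Vn.
have [k kP] : exists k, slen (ker_pred f) k.
  apply: (@slen_exists _ _ n); first exact: ker_pred_submod.
  by move=> m c [cP _]; exact: Vx cP.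
have [r rP] : exists r, slen (im_pred f) r.
  apply: (@slen_exists _ _ n); first exact: im_pred_submod.
  move=> m c [[cs cc] cim]; apply: (Vx _ (fun i => preim_of (c i))); split=> i im.
    by apply: preim_of_submod; exact: cs.
  have [sub [y yc nyc]] := cc i im; split=> [x|]; first exact: sub.
  have cle j : (i < j)%N -> (j <= m)%N -> {subset c i.+1 <= c j}.
    elim: j => // j IHj; rewrite ltnS leq_eqVlt => /orP[/eqP <-|ij] jr z zd //.
    by apply: (cc j jr).1; apply: IHj => //; exact: ltnW.
  have /asboolP[x xy] := cim y (cle m im (leqnn m) y yc).
  by exists x; rewrite unfold_in /preim_of xy.
by exists k, r; split=> //; apply: has_length_uniq Vn (rank_nullity kP rP).
Qed.
End RankNullity.

Lemma has_length0 V : has_length V 0 <-> forall x : V, x = 0.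
Proof.
split=> [[_ Vx] x|V0]; last first.
  split; first by exists (fun=> predT : {pred V}).
  move=> [//|m] c [cs cc]; have [_ [x _ nx]] := cc 0%N isT; case/negP: nx.
  by rewrite [x]V0; have [] := cs 0%N isT.
apply: contrapT => x0; have := Vx 1%N (fun i => if i is 0%N then pred1 (0 : V) : {pred V} else predT).
suff H : submodule_chain 1 (fun i => if i is 0%N then pred1 (0 : V) : {pred V} else predT) by move/(_ H).
split=> [[|i] _ //|[|i] // _].
  split=> [|a u v]; rewrite !inE // => /eqP-> /eqP->.
  by rewrite scaler0 addr0.
by split=> //; exists x; rewrite ?inE //; apply/eqP.
Qed.

Lemma slen0 V (N : {pred V}) : GRing.submod_closed N -> (forall x, x \in N -> x = 0) -> slen N 0.
Proof.
move=> Nsub N0; split; first by exists (fun=> N); split.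
move=> [//|m] c [[cs cc] cN]; have [_ [x xc nx]] := cc m (leqnn _); case/negP: nx.
by rewrite [x]N0; [have [] := cs m (leqW (leqnn m))|exact: cN].
Qed.

Lemma slen_im_inj V W (f : {linear V -> W}) n : injective f -> has_length V n -> slen (im_pred f) n.
Proof.
move=> f_inj /(rank_nullity_inv f)[k [r [kP rP ->]]].
suff -> : k = 0%N by [].
apply: slen_uniq kP _; apply: slen0; first exact: ker_pred_submod.
by move=> x /eqP fx; apply: f_inj; rewrite fx linear0.
Qed.

Lemma has_length_iso V W (f : {linear V -> W}) n : injective f -> (forall y, exists x, f x = y) ->
  has_length V n -> has_length W n.
Proof.
move=> f_inj f_surj /(slen_im_inj f_inj) Wn; rewrite has_lengthE.
by apply: eq_slen Wn => y; rewrite [RHS]inE; apply/asboolP; exact: f_surj.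
Qed.

Lemma module_lengthE V n : has_length V n -> module_length V = n.
Proof.
move=> Vn; rewrite /module_length; case: xgetP => [m _ mP|/(_ n)/(_ Vn)[]].
exact: has_length_uniq Vn.
Qed.

(** The middle term consists of the cokernel of $f$ and the kernel of $f'$. The ranks of $f$ and
    $f'$ stay in the formula because they cancel in the alternating sum. *)
Lemma has_length_exact (X Y C X' Y' : lmodType A) (f : {linear X -> Y}) (g : {linear Y -> C})
    (h : {linear C -> X'}) (f' : {linear X' -> Y'}) a b a' :
  im_pred f =i ker_pred g -> im_pred g =i ker_pred h -> im_pred h =i ker_pred f' ->
  has_length X a -> has_length Y b -> has_length X' a' ->
  exists r r' c, [/\ slen (im_pred f) r, slen (im_pred f') r', has_length C c &
    (c + (r + r') = b + a')%N].
Proof.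
move=> fg gh hf Xa Yb Xa'.
have [_ [r [_ rP _]]] := rank_nullity_inv f Xa.
have [r1 [s [r1P sP bE]]] := rank_nullity_inv g Yb.
have [k' [r' [kP' rP' aE']]] := rank_nullity_inv f' Xa'.
have r1E : r1 = r by apply: slen_uniq r1P _; exact: eq_slen rP.
exists r, r', (s + k')%N; split=> //; last by lia.
apply: (rank_nullity (f := h)); first exact: eq_slen sP.
by apply: eq_slen kP' => x; rewrite hf.
Qed.

End Length.

Section FieldLength.

Lemma has_length1 (A : nzRingType) (V : lmodType A) (v : V) : v != 0 ->
  (forall x y : V, x != 0 -> exists a, y = a *: x) -> has_length V 1.
Proof.
move=> v0 Vsimple; split.
  exists (fun i => if i is 0%N then pred1 (0 : V) : {pred V} else predT).
  split=> [[|i] _ //|[|i] // _].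
    by split=> [|a u w]; rewrite !inE // => /eqP-> /eqP->; rewrite scaler0 addr0.
  by split=> //; exists v; rewrite ?inE.
move=> [|[|m]] // c [cs cc].
have [_ [x x1 nx0]] := cc 0%N isT; have [_ [y _ ny1]] := cc 1%N isT.
have x0 : x != 0 by apply: contraNneq nx0 => ->; have [] := cs 0%N isT.
case/negP: ny1; have [a ->] := Vsimple x y x0.
by have [c0 cL] := cs 1%N isT; rewrite -[_ *: _]addr0; exact: cL.
Qed.

Variable F : fieldType.

Lemma has_length_row m : has_length 'rV[F]_m m.
Proof.
elim: m => [|m IHm]; first by apply/has_length0 => x; apply/rowP => -[].
have L1 : linear (fun x : 'rV[F]_m.+1 => \row_(k < 1) x 0 ord0).
  by move=> a x y; apply/rowP => k; rewrite !mxE.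
have L2 : linear (fun x : 'rV[F]_m => \row_(k < m.+1) oapp (fun j => x 0 j) 0 (unlift ord0 k)).
  move=> a x y; apply/rowP => k; rewrite !mxE; case: (unliftP ord0 k) => [j _|_] /=.
    by rewrite !mxE.
  by rewrite mulr0 addr0.
rewrite -[X in has_length _ X]addn1; apply: (rank_nullity (f := lin L1)).
  apply: (@eq_slen _ _ (im_pred (lin L2))).
    move=> x; apply/asboolP/idP => [[y <-]|].
      by rewrite unfold_in; apply/eqP/rowP => k; rewrite !mxE unlift_none.
    rewrite unfold_in => /eqP/rowP/(_ ord0); rewrite !mxE => x0.
    exists (\row_j x 0 (lift ord0 j)); apply/rowP => k; rewrite !mxE.
    by case: (unliftP ord0 k) => [j ->|->] /=; rewrite ?mxE ?x0.
  apply: slen_im_inj IHm => x y /rowP xy; apply/rowP => j.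
  by move: (xy (lift ord0 j)); rewrite !mxE liftK.
have : has_length 'rV[F]_1 1.
  apply: (@has_length1 _ _ (const_mx 1)).
    by apply/eqP => /rowP/(_ ord0); rewrite !mxE => /eqP; rewrite oner_eq0.
  move=> x y x0; have x00 : x 0 0 != 0.
    by apply: contraNneq x0 => x0; apply/eqP/rowP => k; rewrite (ord1 k) mxE.
  exists (y 0 0 / x 0 0); apply/rowP => k; rewrite (ord1 k) !mxE.
  by rewrite divfK.
rewrite has_lengthE; apply: eq_slen => y; rewrite [LHS]inE; apply/esym/asboolP.
by exists (const_mx (y 0 0)); apply/rowP => k; rewrite (ord1 k) !mxE.
Qed.

Lemma vector_has_length (V : lmodType F) m : Vector.axiom m V -> has_length V m.
Proof.
move=> [f fL [g fK gK]].
have gL : linear g by move=> a x y; rewrite -[in RHS](fK (a *: g x + g y)) fL !gK.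
apply: (has_length_iso (f := lin gL)) (has_length_row m); first exact: can_inj gK.
by move=> y; exists (f y); exact: fK.
Qed.

(** The length bounds the $m$ for which $F^m$ embeds into $V$. An embedding with maximal $m$ is
    onto, as a vector outside its image would extend it. *)
Lemma has_length_vector (V : lmodType F) n : has_length V n -> inhabited (Vector.axiom n V).
Proof.
move=> Vn.
pose P m := `[< exists f : {linear 'rV[F]_m -> V}, injective f >].
have P0 : exists m, P m.
  by exists 0%N; apply/asboolP; exists \0 => x y _; apply/rowP => -[].
have Pn m : P m -> (m <= n)%N.
  move=> /asboolP[f f_inj]; have [[c [cP _]] _] := slen_im_inj f_inj (has_length_row m).
  by have [_ Vx] := Vn; exact: Vx cP.
have [m /asboolP[f f_inj] mx] := ex_maxnP P0 Pn.
have f_surj y : exists x, f x = y.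
  apply: contrapT => ny; suff /mx : P m.+1 by rewrite ltnn.
  apply/asboolP.
  have gL : linear (fun x : 'rV[F]_m.+1 => f (\row_j x 0 (lift ord0 j)) + x 0 ord0 *: y).
    move=> a u v; rewrite [X in f X](_ : _ = a *: (\row_j u 0 (lift ord0 j)) +
      (\row_j v 0 (lift ord0 j))); last by apply/rowP => j; rewrite !mxE.
    by rewrite linearP !mxE scalerDl scalerDr -scalerA addrACA.
  exists (lin gL); apply: raddf_inj => x /=.
  have [x0|x0] := eqVneq (x 0 ord0) 0.
    rewrite x0 scale0r addr0 -[RHS](linear0 f) => /f_inj/rowP xx.
    apply/rowP => k; rewrite mxE; case: (unliftP ord0 k) => [j ->|->] //.
    by have := xx j; rewrite !mxE.
  move=> /eqP; rewrite addr_eq0 => /eqP fx; exfalso; apply: ny.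
  exists (- (x 0 ord0)^-1 *: \row_j x 0 (lift ord0 j)).
  by rewrite linearZ fx /= scalerN scaleNr opprK scalerA mulVf // scale1r.
have [g gP] := choice f_surj.
have gK : cancel f g by move=> x; apply: f_inj; rewrite gP.
have ax : Vector.axiom m V.
  exists g; last by exists f.
  by move=> a x y; apply: f_inj; rewrite linearP !gP.
by rewrite (has_length_uniq Vn (vector_has_length ax)).
Qed.

(** [chi] is defined by dimensions and [lambda] by lengths; through this equality one theory of
    Euler characteristics serves both. *)
Lemma dimensionE (V : lmodType F) n : has_length V n -> dimension V = module_length V.
Proof.
move=> Vn; rewrite (module_lengthE Vn) /dimension; have ax := has_length_vector Vn.
case: xgetP => [m _ [mP]|/(_ n)/(_ ax)[]].
exact: has_length_uniq (vector_has_length mP) Vn.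
Qed.
End FieldLength.

(* A is the ring of fractions of R with denominators in S, which contains no zero divisor. *)
Record localising (R A : comNzRingType) (phi : {rmorphism R -> A}) (S : R -> Prop) : Prop := {
  loc_one : S 1;
  loc_mul : forall s t, S s -> S t -> S (s * t);
  loc_unit : forall s, S s -> exists u, u * phi s = 1;
  loc_frac : forall a, exists s b, S s /\ phi s * a = phi b;
  loc_inj : injective phi }.

Section Localise.
Variables (R A : comNzRingType) (phi : {rmorphism R -> A}) (S : R -> Prop).
Hypothesis loc : localising phi S.
Let S1 := loc_one loc.
Let SM := loc_mul loc.
Let S_unit := loc_unit loc.
Let S_frac := loc_frac loc.
Let phi_inj := loc_inj loc.
Implicit Types M N P : lmodType R.

Lemma tensor_pure0 M : tensor_pure phi 1 (0 : M) = 0.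
Proof. by rewrite -(scale0r (0 : M)) tensor_pure1Z rmorph0 scale0r. Qed.

(** Common denominators: the finitely many coefficients of a representative are cleared one at a
    time. *)
Lemma tensor_frac M (t : tensor phi M) :
  exists s m, S s /\ phi s *: t = tensor_pure phi 1 m.
Proof.
rewrite (tensor_pure_span t); elim: (dom _) => [|m r [s [n [Ss sn]]]].
  by exists 1, 0; rewrite big_nil scaler0 tensor_pure0.
rewrite big_cons; have [s' [b [Ss' s'b]]] := S_frac (coeff m (repr t)).
exists (s * s'), ((s * b) *: m + s' *: n); split; first exact: SM.
rewrite tensor_pure1D !tensor_pure1Z -sn scalerDr !scalerA !rmorphM -!mulrA s'b.
by rewrite [phi s * phi s']mulrC.
Qed.

Lemma tensor_scale_eq0 M (t : tensor phi M) s : S s -> phi s *: t = 0 -> t = 0.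
Proof.
move=> Ss st; have [u us] := S_unit Ss.
by rewrite -[t]scale1r -us -scalerA st scaler0.
Qed.

Lemma tensor_pure_eq0 M (m : M) :
  tensor_pure phi 1 m = 0 <-> exists2 s, S s & s *: m = 0.
Proof.
split=> [|[s Ss sm]]; last first.
  by apply: (tensor_scale_eq0 Ss); rewrite -tensor_pure1Z sm tensor_pure0.
have -> : 0 = quotmod_pi (@tensor_null_submod _ _ phi M) 0 by rewrite linear0.
move/eqP; rewrite quotmod_piE subr0 => /asboolP.
pose ev := fglift (fun m : M => m) : {freeg M / R} -> M.
have evL : linear ev := @fglift_linear R R M M (fun m : M => m).
have ev0 : ev 0 = 0 by have := evL (-1) 0 0; rewrite !scaleN1r !oppr0 addr0 addNr.
have evZ a u : ev (a *: u) = a *: ev u by rewrite -[a *: u]addr0 evL ev0 addr0.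
have evD u v : ev (u + v) = ev u + ev v by rewrite -[u in LHS]scale1r evL scale1r.
(* The elements $u$ with a multiple $su$ that has coefficients in $R$ and evaluates to 0 in $M$.
   They form a submodule that contains the relations of the tensor product, hence all that vanishes
   there. *)
pose N (u : {freeg M / A}) := `[< exists s (w : {freeg M / R}),
  [/\ S s, forall k, phi (coeff k w) = phi s * coeff k u & ev w = 0] >].
move=> /(_ N) H; have {H} : (1 *: << m >> : {freeg M / A}) \in N; last move=> /asboolP.
apply: H.
- split=> [|a u v /asboolP[s [w [Ss wu w0]]] /asboolP[s' [w' [Ss' wv w'0]]]]; apply/asboolP.
    by exists 1, 0; split=> // k; rewrite !coeff0 rmorph0 mulr0.
  have [s2 [b [Ss2 s2b]]] := S_frac a.
  exists (s2 * (s * s')), ((b * s') *: w + (s2 * s) *: w'); split.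
  + by do 2?apply: SM.
  + move=> k; rewrite !coeffD !coeffZ rmorphD !rmorphM wu wv -s2b mulrDr.
    congr (_ + _); last by rewrite !mulrA.
    rewrite -!mulrA; congr (_ * _).
    by rewrite [LHS]mulrCA [RHS]mulrCA [X in _ = _ * X]mulrCA.
  + by rewrite evD !evZ w0 w'0 !scaler0 addr0.
- move=> u ur; apply/asboolP; case: ur => [[m1 [m2 ->]]|[r [m1 ->]]].
    exists 1, (<< m1 + m2 >> - << m1 >> - << m2 >>); split=> //.
      by move=> k; rewrite rmorph1 mul1r !coeffB !coeffU !rmorphB !rmorphM !rmorph_nat !rmorph1.
    rewrite !evD -!scaleN1r !evZ /ev !liftU !scale1r !scaleN1r addrAC addrK subrr //.
  exists 1, (<< r *: m1 >> - r *: << m1 >>); split=> //.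
    by move=> k; rewrite rmorph1 mul1r !coeffB !coeffZ !coeffU !rmorphB !rmorphM !rmorph_nat !rmorph1.
  by rewrite evD -scaleN1r !evZ /ev !liftU !scale1r scaleN1r subrr.
move=> [s [w [Ss ws w0]]]; exists s => //.
have {ws} ws : w = s *: << m >>.
  apply/eqP/freeg_eqP => k; apply: phi_inj.
  by rewrite ws !coeffZ !coeffU !rmorphM rmorph_nat rmorph1 !mul1r.
by move: w0; rewrite ws evZ /ev liftU scale1r.
Qed.

Lemma tensor_eq0 M : (forall t : tensor phi M, t = 0) <->
  forall m : M, exists2 s, S s & s *: m = 0.
Proof.
split=> [M0 m|M0 t]; first exact/tensor_pure_eq0.
have [s [m [Ss sm]]] := tensor_frac t; apply: (tensor_scale_eq0 Ss).
by rewrite sm; apply/tensor_pure_eq0.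
Qed.

(** Flatness of localisation, obtained by clearing denominators in cycles and in their preimages. *)
Lemma tensor_map_exact M N P (f : {linear M -> N}) (g : {linear N -> P}) :
  (forall x, g (f x) = 0) -> (forall y, g y = 0 -> exists x, f x = y) ->
  im_pred (tensor_map phi f) =i ker_pred (tensor_map phi g).
Proof.
move=> gf fg t; apply/asboolP/idP => [[u <-]|].
  rewrite unfold_in; apply/eqP; have [s [m [Ss sm]]] := tensor_frac u.
  apply: (tensor_scale_eq0 Ss).
  transitivity (tensor_map phi g (tensor_map phi f (phi s *: u))); first by rewrite !linearZ.
  rewrite sm !tensor_mapE gf.
  exact: tensor_pure0.
rewrite unfold_in => /eqP gt; have [s [n [Ss sn]]] := tensor_frac t.
have : tensor_pure phi 1 (g n) = 0 by rewrite -tensor_mapE -sn linearZ gt /= scaler0.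
move=> /tensor_pure_eq0[s' Ss' s'gn].
have [m fm] : exists m, f m = s' *: n by apply: fg; rewrite linearZ.
have [u us] := S_unit (SM Ss' Ss).
exists (u *: tensor_pure phi 1 m).
by rewrite linearZ /= tensor_mapE fm tensor_pure1Z -sn !scalerA -rmorphM us scale1r.
Qed.

Lemma tensor_map_inj M N (f : {linear M -> N}) : injective f -> injective (tensor_map phi f).
Proof.
move=> f_inj; apply: raddf_inj => t ft; have [s [m [Ss sm]]] := tensor_frac t.
apply: (tensor_scale_eq0 Ss); rewrite sm; apply/tensor_pure_eq0.
have : tensor_pure phi 1 (f m) = 0 by rewrite -tensor_mapE -sm linearZ /= ft scaler0.
move=> /tensor_pure_eq0[s' Ss' s'f]; exists s' => //.
by apply: f_inj; rewrite linearZ linear0.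
Qed.

Lemma tensor_map_surj M N (f : {linear M -> N}) : (forall y, exists x, f x = y) ->
  forall y, exists x, tensor_map phi f x = y.
Proof.
move=> f_surj y; have [s [n [Ss sn]]] := tensor_frac y.
have [m fm] := f_surj n; have [u us] := S_unit Ss.
by exists (u *: tensor_pure phi 1 m); rewrite linearZ /= tensor_mapE fm -sn scalerA us scale1r.
Qed.
End Localise.

(** * The long exact sequence and Euler characteristics *)

Section HomologyTheory.
Variable A : comNzRingType.
Implicit Types X Y : complex A.

Definition hclass X i (z : cycle X i) : homology X i := quotmod_pi (@boundary_submod A X i) z.

Lemma hclass_surj X i (c : homology X i) : exists z, hclass z = c.
Proof. by exists (repr c); exact: quotmod_reprK. Qed.

Lemma hclass_eq0 X i (z : cycle X i) : hclass z = 0 <-> is_boundary (cycle_val z).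
Proof.
have -> : 0 = hclass (0 : cycle X i) by rewrite /hclass linear0.
split=> [/eqP|zb].
  by rewrite /hclass quotmod_piE subr0 => /asboolP.
by apply: quotmod_piP; rewrite subr0; apply/asboolP.
Qed.

(** In a degree of the form $i-1$ the witness carries no cast. Proofs about a general degree begin
    by writing it as $k-1$ for this reason. *)
Lemma is_boundary_pred X i (x : X (i - 1)) : is_boundary x <-> exists z, x = cdiff X i z.
Proof.
split=> [/is_boundaryP[j [e [z ->]]]|[z ->]]; last by constructor.
have ji : j = i by apply: (addIr (-1)).
by subst j; exists z; rewrite (eq_irrelevance e erefl).
Qed.

Lemma cycleP X i (z : cycle X i) : cdiff X i (cycle_val z) = 0.
Proof. by case: z => z /= /eqP. Qed.

Definition mk_cycle X i (x : X i) (dx : cdiff X i x = 0) : cycle X i :=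
  Cycle (introT eqP dx).

Lemma hclassB X i (z z' : cycle X i) :
  hclass z = hclass z' <-> is_boundary (cycle_val z - cycle_val z').
Proof.
rewrite -[_ - _]/(cycle_val (z - z')) -hclass_eq0 {3}/hclass linearB.
by split=> [zz|/eqP]; [apply/eqP; rewrite subr_eq0; apply/eqP | rewrite subr_eq0 => /eqP].
Qed.

Section Lift.
Variables (X : complex A) (i : int) (W : lmodType A) (F : {linear cycle X i -> W}).
Hypothesis F0 : forall z, is_boundary (cycle_val z) -> F z = 0.

Lemma hlift_pi z : F (repr (hclass z)) = F z.
Proof.
apply/eqP; rewrite -subr_eq0 -linearB; apply/eqP/F0.
by rewrite [cycle_val _]/= -hclassB; exact: quotmod_reprK.
Qed.

Lemma hlift_linear : linear (fun c : homology X i => F (repr c)).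
Proof.
move=> a u v; have [z <-] := hclass_surj u; have [z' <-] := hclass_surj v.
have -> : a *: hclass z + hclass z' = hclass (a *: z + z') by rewrite /hclass linearP.
by rewrite !hlift_pi linearP.
Qed.
Definition hlift := lin hlift_linear.
Lemma hliftE z : hlift (hclass z) = F z.
Proof. exact: hlift_pi. Qed.
End Lift.

Section Functor.
Variables (X Y : complex A) (f : chain_map X Y).

Lemma hmap_cycle_subproof i (z : cycle X i) : cdiff Y i (f i (cycle_val z)) = 0.
Proof. by rewrite -cmapP cycleP linear0. Qed.

Lemma hmap_linear i : linear (fun z : cycle X i => hclass (mk_cycle (hmap_cycle_subproof z))).
Proof.
move=> a z z'; rewrite /hclass -linearP; congr (quotmod_pi _ _).
by apply: val_inj; rewrite /= linearP.
Qed.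

Lemma hmap0 i (z : cycle X i) : is_boundary (cycle_val z) -> lin (@hmap_linear i) z = 0.
Proof.
have [k ik] : exists k, i = k - 1 by exists (i + 1); rewrite addrK.
move: z; rewrite ik => z /is_boundary_pred[u zu]; apply/hclass_eq0/is_boundary_pred.
by exists (f k u); rewrite /= zu cmapP.
Qed.

Definition hmap i : {linear homology X i -> homology Y i} := hlift (@hmap0 i).

Lemma hmapE i x (dx : cdiff X i x = 0) (dfx : cdiff Y i (f i x) = 0) :
  hmap i (hclass (mk_cycle dx)) = hclass (mk_cycle dfx).
Proof. by rewrite /hmap hliftE /=; congr hclass; apply: val_inj. Qed.
End Functor.

Lemma hmap_homotopic X (f : chain_map X X) i :
  homotopic_maps (fun i x => f i x) (fun i x => x) -> forall c, hmap f i c = c.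
Proof.
move=> [h hP] c; have [[x dx0] <-] := hclass_surj c; have /eqP dx := dx0.
have dfx : cdiff X i (f i x) = 0 by rewrite -cmapP dx linear0.
rewrite (_ : Cycle dx0 = mk_cycle dx); last exact: val_inj.
rewrite (hmapE dx dfx); apply/hclassB => /=.
have [k ik] : exists k, i = k - 1 by exists (i + 1); rewrite addrK.
move: x dx0 dx dfx {c}; rewrite ik => x _ dx _; apply/is_boundary_pred.
by exists (h k x); rewrite hP dx linear0 addr0.
Qed.

Section Shift.
Variable X : complex A.

Lemma shift_cycle_subproof i (z : cycle (shift_complex X) i) :
  cdiff X (i - 1) (cycle_val z) = 0.
Proof. by have /= /eqP := cycleP z; rewrite oppr_eq0 => /eqP. Qed.

Lemma hshift_linear i : linear (fun z : cycle (shift_complex X) i =>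
  hclass (mk_cycle (shift_cycle_subproof z))).
Proof.
by move=> a z z'; rewrite /hclass -linearP; congr (quotmod_pi _ _); apply: val_inj.
Qed.

Lemma hshift0 i (z : cycle (shift_complex X) i) :
  is_boundary (cycle_val z) -> lin (@hshift_linear i) z = 0.
Proof.
have [k ik] : exists k, i = k - 1 by exists (i + 1); rewrite addrK.
move: z; rewrite ik => z /is_boundary_pred[u zu]; apply/hclass_eq0/is_boundary_pred.
by exists (- u); rewrite /= zu linearN.
Qed.

Definition hshift i : {linear homology (shift_complex X) i -> homology X (i - 1)} :=
  hlift (@hshift0 i).

Lemma hshiftE i z : hshift i (hclass z) = hclass (mk_cycle (shift_cycle_subproof z)).
Proof. exact: hliftE. Qed.

Lemma hshift_inj i : injective (hshift i).
Proof.
apply: raddf_inj => c; have [z <-] := hclass_surj c => hz.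
have : hshift i (hclass z) = 0 := hz; rewrite hshiftE {hz}.
have [k ik] : exists k, i = k - 1 by exists (i + 1); rewrite addrK.
move: z {c}; rewrite ik => z /hclass_eq0/is_boundary_pred[u zu].
apply/hclass_eq0/is_boundary_pred; exists (- u).
by rewrite [LHS]zu /= linearN opprK.
Qed.

Lemma hshift_surj i c : exists z, hshift i z = c.
Proof.
have [z <-] := hclass_surj c.
have dz : cdiff (shift_complex X) i (cycle_val z) = 0 by rewrite /= cycleP oppr0.
exists (hclass (mk_cycle dz)); rewrite hshiftE; congr hclass; exact: val_inj.
Qed.
End Shift.

Section LongExactSequence.
Variables (X Y : complex A) (f : chain_map X Y).
Local Notation C := (cone_complex f).

Lemma connecting_subproof i (z : cycle C i) : cdiff X (i - 1) (cycle_val z).1 = 0.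
Proof. by have /(congr1 fst)/= /eqP := cycleP z; rewrite oppr_eq0 => /eqP. Qed.

Lemma connecting_linear i : linear (fun z : cycle C i =>
  hclass (mk_cycle (connecting_subproof z))).
Proof.
by move=> a z z'; rewrite /hclass -linearP; congr (quotmod_pi _ _); apply: val_inj.
Qed.

Lemma connecting0 i (z : cycle C i) :
  is_boundary (cycle_val z) -> lin (@connecting_linear i) z = 0.
Proof.
have [k ik] : exists k, i = k - 1 by exists (i + 1); rewrite addrK.
move: z; rewrite ik => z /is_boundary_pred[u zu]; apply/hclass_eq0/is_boundary_pred.
by exists (- u.1); rewrite /= zu linearN.
Qed.

(** The projection to $X$, that is, the effect of [cone_out] on homology with the shift already
    undone. *)
Definition connecting i : {linear homology C i -> homology X (i - 1)} :=
  hlift (@connecting0 i).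

Lemma connectingE i z : connecting i (hclass z) = hclass (mk_cycle (connecting_subproof z)).
Proof. exact: hliftE. Qed.

Lemma exact_target i c : hmap (cone_in f) i (hmap f i c) = 0.
Proof.
have [z <-] := hclass_surj c; have dz := cycleP z.
have dfz : cdiff Y i (f i (cycle_val z)) = 0 by rewrite -cmapP dz linear0.
rewrite (_ : z = mk_cycle dz) ?(hmapE dz dfz); last exact: val_inj.
have dcz : cdiff C i (cone_in f i (f i (cycle_val z))) = 0 by rewrite -cmapP dfz linear0.
rewrite (hmapE dfz dcz).
have [k ik] : exists k, i = k - 1 by exists (i + 1); rewrite addrK.
move: z dz dfz dcz {c}; rewrite ik => z dz _ dcz.
apply/hclass_eq0/is_boundary_pred; exists (cycle_val z, 0).
by congr pair; rewrite /= ?dz ?oppr0 // linear0 addr0.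
Qed.

Lemma exact_targetP i c : hmap (cone_in f) i c = 0 -> exists b, hmap f i b = c.
Proof.
have [z <-] := hclass_surj c; have dz := cycleP z.
have dcz : cdiff C i (cone_in f i (cycle_val z)) = 0 by rewrite -cmapP dz linear0.
rewrite (_ : z = mk_cycle dz) ?(hmapE dz dcz); last exact: val_inj.
have [k ik] : exists k, i = k - 1 by exists (i + 1); rewrite addrK.
move: z dz dcz {c}; rewrite ik => z dz dcz /hclass_eq0/is_boundary_pred[[x y] /= xy].
have dx : cdiff X (k - 1) x = 0 by move/(congr1 fst): xy => /= /esym/eqP; rewrite oppr_eq0 => /eqP.
have dfx : cdiff Y (k - 1) (f (k - 1) x) = 0 by rewrite -cmapP dx linear0.
exists (hclass (mk_cycle dx)); apply: etrans (@hmapE _ _ f _ _ dx dfx) _; apply/hclassB/is_boundary_pred => /=.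
by exists (- y); move/(congr1 snd): xy => /= ->; rewrite opprD addrA subrr add0r linearN.
Qed.

Lemma exact_cone i c : connecting i (hmap (cone_in f) i c) = 0.
Proof.
have [z <-] := hclass_surj c; have dz := cycleP z.
have dcz : cdiff C i (cone_in f i (cycle_val z)) = 0 by rewrite -cmapP dz linear0.
rewrite (_ : z = mk_cycle dz) ?(hmapE dz dcz); last exact: val_inj.
rewrite connectingE; apply/hclass_eq0/is_boundary_pred.
by exists 0; rewrite linear0.
Qed.

Lemma exact_coneP i c : connecting i c = 0 -> exists b, hmap (cone_in f) i b = c.
Proof.
have [z <-] := hclass_surj c; rewrite connectingE.
have [k ik] : exists k, i = k - 1 by exists (i + 1); rewrite addrK.
move: z {c}; rewrite ik => z /hclass_eq0/is_boundary_pred[x /= zx].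
have /(congr1 snd)/= dz := cycleP z.
have dy : cdiff Y (k - 1) (f (k - 1) x + (cycle_val z).2) = 0.
  by rewrite linearD -cmapP -zx.
have dcy := etrans (esym (cmapP (cone_in f) (f (k - 1) x + (cycle_val z).2)))
  (etrans (congr1 _ dy) (linear0 _)).
exists (hclass (mk_cycle dy)); apply: etrans (@hmapE _ _ (cone_in f) _ _ dy dcy) _.
apply/hclassB/is_boundary_pred; exists (x, 0).
apply: pair_ext; rewrite /= ?sub0r ?zx //.
by rewrite linear0 addr0 addrK.
Qed.

Lemma exact_source i c : hmap f (i - 1) (connecting i c) = 0.
Proof.
have [z <-] := hclass_surj c; rewrite connectingE.
have dfx : cdiff Y (i - 1) (f (i - 1) (cycle_val z).1) = 0.
  by rewrite -cmapP connecting_subproof linear0.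
rewrite (hmapE _ dfx); apply/hclass_eq0/is_boundary_pred.
exists (- (cycle_val z).2); have /(congr1 snd)/= /eqP := cycleP z.
by rewrite linearN addr_eq0 => /eqP.
Qed.

Lemma exact_sourceP i c : hmap f (i - 1) c = 0 -> exists b, connecting i b = c.
Proof.
have [z <-] := hclass_surj c; have dz := cycleP z.
have dfz : cdiff Y (i - 1) (f (i - 1) (cycle_val z)) = 0 by rewrite -cmapP dz linear0.
rewrite (_ : z = mk_cycle dz) ?(hmapE dz dfz); last exact: val_inj.
move=> /hclass_eq0/is_boundary_pred[y /= fzy].
have dc : cdiff C i (cycle_val z, - y) = 0.
  by congr pair; rewrite /= ?dz ?oppr0 // linearN fzy subrr.
exists (hclass (mk_cycle dc)); apply: etrans (@connectingE _ (mk_cycle dc)) _.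
by congr hclass; apply: val_inj.
Qed.
End LongExactSequence.
End HomologyTheory.

Section AlternatingSum.
Implicit Types F G : int -> int.

Definition alt F : int := \sum_(i \in [set: int]) (-1) ^ i * F i.
Definition bounded_support F := exists n : nat, forall i, n%:Z < `|i| -> F i = 0.

Definition int_ball (n : nat) : {fset int} :=
  seq_fset tt [seq k%:Z - n%:Z | k <- iota 0 (n + n).+1].

Lemma int_ballP n (i : int) : (i \in int_ball n) = (`|i| <= n%:Z).
Proof.
rewrite seq_fsetE; apply/mapP/idP => [[k]|ni].
  by rewrite mem_iota => kn ->; lia.
by exists (absz (i + n%:Z)); [rewrite mem_iota; lia|lia].
Qed.

Lemma altE F n : (forall i, n%:Z < `|i| -> F i = 0) ->
  alt F = \sum_(i <- int_ball n) (-1) ^ i * F i.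
Proof.
move=> Fn; rewrite /alt (@fsbigTE _ _ _ _ (int_ball n)) // => i.
by rewrite int_ballP -ltNge => /Fn ->; rewrite mulr0.
Qed.

Lemma altD F G : bounded_support F -> bounded_support G ->
  alt (fun i => F i + G i) = alt F + alt G.
Proof.
move=> [n Fn] [m Gm].
rewrite (@altE F (n + m)) ?(@altE G (n + m)) ?(@altE _ (n + m)).
- by rewrite -big_split; apply: eq_bigr => i _; rewrite mulrDr.
- by move=> i ni; rewrite Fn ?Gm ?addr0 //; lia.
- by move=> i ni; apply: Gm; lia.
- by move=> i ni; apply: Fn; lia.
Qed.

Lemma altN F : bounded_support F -> alt (fun i => - F i) = - alt F.
Proof.
move=> [n Fn]; rewrite (@altE F n) // (@altE _ n).
  by rewrite -sumrN; apply: eq_bigr => i _; rewrite mulrN.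
by move=> i /Fn ->; rewrite oppr0.
Qed.

Lemma bounded_supportD F G : bounded_support F -> bounded_support G ->
  bounded_support (fun i => F i + G i).
Proof. by move=> [n Fn] [m Gm]; exists (n + m)%N => i ni; rewrite Fn ?Gm ?addr0 //; lia. Qed.

Lemma bounded_supportN F : bounded_support F -> bounded_support (fun i => - F i).
Proof. by move=> [n Fn]; exists n => i /Fn ->; rewrite oppr0. Qed.

Lemma bounded_support_shift F : bounded_support F -> bounded_support (fun i => F (i - 1)).
Proof. by move=> [n Fn]; exists n.+1 => i ni; apply: Fn; lia. Qed.

Lemma alt_shift F : alt (fun i => F (i - 1)) = - alt F.
Proof.
rewrite /alt [in RHS](reindex_fsbigT (fun i : int => i - 1)) /=; last first.
  by exists (fun i => i + 1) => i; rewrite ?addrK ?subrK.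
rewrite -[RHS]mulN1r mulr_fsumr /=; apply: eq_fsbigr => i _.
rewrite mulrA; congr (_ * _); rewrite -[in LHS](subrK 1 i).
by rewrite [LHS]exprzDr // expr1z mulrC.
Qed.
End AlternatingSum.

Section EulerCharacteristic.
Variables (R A : comNzRingType) (phi : {rmorphism R -> A}) (S : R -> Prop).
Hypothesis loc : localising phi S.
Implicit Types X Y Z : complex R.

Definition hlen X i : nat := module_length (tensor phi (homology X i)).
Definition finite_homology X := forall i, has_length (tensor phi (homology X i)) (hlen X i).
Definition euler X := alt (fun i => (hlen X i)%:Z).

Lemma finite_homologyI X : (forall i, exists n, has_length (tensor phi (homology X i)) n) ->
  finite_homology X.
Proof. by move=> Xf i; have [n Xn] := Xf i; rewrite /hlen (module_lengthE Xn). Qed.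

Lemma iso_has_length X Y i j (f : {linear homology X i -> homology Y j}) n :
  injective f -> (forall y, exists x, f x = y) ->
  has_length (tensor phi (homology X i)) n -> has_length (tensor phi (homology Y j)) n.
Proof.
move=> f_inj f_surj; apply: (has_length_iso (f := tensor_map phi f)).
  exact: (tensor_map_inj loc).
exact: (tensor_map_surj loc).
Qed.

Lemma heq_hmap X Y i : homotopy_equivalent X Y ->
  exists f : {linear homology X i -> homology Y i}, injective f /\ forall y, exists x, f x = y.
Proof.
have hmap_comp X' Y' Z' (f : chain_map X' Y') (g : chain_map Y' Z') c :
    hmap g i (hmap f i c) = hmap (comp_map g f) i c.
  have [z <-] := hclass_surj c; have dz := cycleP z.
  have dfz : cdiff Y' i (f i (cycle_val z)) = 0 by rewrite -cmapP dz linear0.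
  have dgz : cdiff Z' i (g i (f i (cycle_val z))) = 0 by rewrite -cmapP dfz linear0.
  have -> : z = mk_cycle dz by exact: val_inj.
  by rewrite (hmapE dz dfz) (hmapE dfz dgz) (@hmapE _ _ _ (comp_map g f) _ _ dz dgz).
move=> [f [g [gf fg]]]; exists (hmap f i); split.
  apply: (can_inj (g := hmap g i)) => c.
  by rewrite hmap_comp; apply: hmap_homotopic; exact: gf.
by move=> c; exists (hmap g i c); rewrite hmap_comp; apply: hmap_homotopic; exact: fg.
Qed.

Lemma homotopy_has_length X Y i n : homotopy_equivalent X Y ->
  has_length (tensor phi (homology X i)) n -> has_length (tensor phi (homology Y i)) n.
Proof. by move=> /(heq_hmap i)[f [f_inj f_surj]]; exact: iso_has_length f_inj f_surj. Qed.

Lemma finite_homology_iso X Y : homotopy_equivalent X Y -> finite_homology X -> finite_homology Y.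
Proof. by move=> XY Xf; apply: finite_homologyI => i; exists (hlen X i); exact: homotopy_has_length XY (Xf i). Qed.

Lemma hlen_iso X Y i : homotopy_equivalent X Y -> finite_homology X -> hlen Y i = hlen X i.
Proof. by move=> XY Xf; apply: module_lengthE; exact: homotopy_has_length XY (Xf i). Qed.

Lemma euler_iso X Y : homotopy_equivalent X Y -> finite_homology X -> euler Y = euler X.
Proof.
by move=> XY Xf; congr alt; apply/funext => i; rewrite (hlen_iso i XY Xf).
Qed.

Lemma shift_has_length X i n : has_length (tensor phi (homology (shift_complex X) i)) n <->
  has_length (tensor phi (homology X (i - 1))) n.
Proof.
split; first by apply: iso_has_length; [exact: hshift_inj|exact: hshift_surj].
move=> Xn.
have [g gP] := choice (@hshift_surj _ X i).
have gL : linear g.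
  by move=> a x y; apply: (@hshift_inj _ X i); rewrite linearP !gP.
apply: (@iso_has_length _ _ _ _ (lin gL)) Xn.
  by move=> x y /= gxy; rewrite -(gP x) gxy gP.
by move=> y; exists (hshift X i y); apply: (@hshift_inj _ X i); rewrite gP.
Qed.

Lemma hlen_shift X i : hlen (shift_complex X) i = hlen X (i - 1).
Proof.
rewrite /hlen /module_length; congr xget; apply/funext => n; apply/propext.
exact: shift_has_length.
Qed.

Lemma finite_homology_shift X : finite_homology (shift_complex X) <-> finite_homology X.
Proof.
split=> Xf i; last by rewrite hlen_shift; apply/shift_has_length; exact: Xf.
have := Xf (i + 1); rewrite hlen_shift => /shift_has_length.
by rewrite addrK.
Qed.

Lemma euler_shift X : euler (shift_complex X) = - euler X.
Proof. by rewrite -alt_shift; congr alt; apply/funext => i; rewrite hlen_shift. Qed.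

Lemma zero_homology X i : (forall x : X i, cdiff X i x = 0 -> x = 0) -> has_length (tensor phi (homology X i)) 0.
Proof.
move=> X0; apply/has_length0; apply/(tensor_eq0 loc) => c; exists 1; first exact: loc_one loc.
have [z <-] := hclass_surj c; rewrite scale1r (_ : z = 0); first by rewrite /hclass linear0.
by apply: val_inj; exact: X0 (cycleP z).
Qed.

(** Here $r_i$ is the rank of $H_i(f)$. It enters in the degrees $i$ and $i+1$, hence with opposite
    signs in the Euler characteristic; the bound by [hlen X] gives $r$ bounded support when $X$ is
    perfect. *)
Lemma cone_hlen X Y (f : chain_map X Y) : finite_homology X -> finite_homology Y ->
  exists2 r : int -> nat, (forall i, (r i <= hlen X i)%N) &
  forall i, exists2 c, has_length (tensor phi (homology (cone_complex f) i)) c &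
    (c + (r i + r (i - 1)%R) = hlen Y i + hlen X (i - 1)%R)%N.
Proof.
move=> Xf Yf.
have /choice[r rP] i : exists r, slen (im_pred (tensor_map phi (hmap f i))) r /\ (r <= hlen X i)%N.
  have [k [r [_ rP ->]]] := rank_nullity_inv (tensor_map phi (hmap f i)) (Xf i).
  by exists r; rewrite leq_addl.
exists r => i; first by case: (rP i).
have ex := tensor_map_exact loc.
have [r1 [r2 [c [r1P r2P cP cE]]]] := has_length_exact
  (ex _ _ _ _ _ (@exact_target _ _ _ f i) (@exact_targetP _ _ _ f i))
  (ex _ _ _ _ _ (@exact_cone _ _ _ f i) (@exact_coneP _ _ _ f i))
  (ex _ _ _ _ _ (@exact_source _ _ _ f i) (@exact_sourceP _ _ _ f i))
  (Xf i) (Yf i) (Xf (i - 1)).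
exists c => //.
by rewrite (slen_uniq (rP i).1 r1P) (slen_uniq (rP (i - 1)).1 r2P).
Qed.

Lemma finite_homology_cone X Y (f : chain_map X Y) :
  finite_homology X -> finite_homology Y -> finite_homology (cone_complex f).
Proof.
move=> Xf Yf; apply: finite_homologyI => i.
by have [r _ /(_ i)[c cP _]] := cone_hlen f Xf Yf; exists c.
Qed.

Lemma hlen_bounded (X : perf R) : bounded_support (fun i => (hlen X i)%:Z).
Proof.
have [[n Xn] _] := perfP X; exists n => i ni.
by rewrite /hlen (module_lengthE (zero_homology (fun x _ => Xn i ni x))).
Qed.

Lemma euler_cone (X Y : perf R) (f : chain_map X Y) :
  finite_homology X -> finite_homology Y -> euler (cone_complex f) = euler Y - euler X.
Proof.
move=> Xf Yf; have [r rX rP] := cone_hlen f Xf Yf.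
have [n Xn] := hlen_bounded X; have [m Ym] := hlen_bounded Y.
have rb : bounded_support (fun i => (r i)%:Z).
  by exists n => i /Xn Xi0; have := rX i; lia.
have Xb := hlen_bounded X; have Yb := hlen_bounded Y.
have E i : (hlen (cone_complex f) i)%:Z =
    (((hlen Y i)%:Z + (hlen X (i - 1))%:Z) + - (r i)%:Z) + - (r (i - 1))%:Z.
  have [c cP cE] := rP i; rewrite /hlen (module_lengthE cP) -!/(hlen _ _); lia.
rewrite [LHS](congr1 alt (funext E)).
have Xb' := bounded_support_shift Xb; have rb' := bounded_support_shift rb.
have nb := bounded_supportN rb; have nb' := bounded_supportN rb'.
have b1 := bounded_supportD Yb Xb'.
rewrite (altD (bounded_supportD b1 nb) nb') (altD b1 nb) (altD Yb Xb') !altN //.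
by rewrite (alt_shift (fun i => (hlen X i)%:Z)) (alt_shift (fun i => (r i)%:Z)) opprK subrK.
Qed.

Lemma finite_homology_triangulated :
  triangulated_subcategory (fun X : perf R => finite_homology X).
Proof.
split=> [X Y| |X|X Y f].
- exact: finite_homology_iso.
- apply: finite_homologyI => i; exists 0%N; apply: zero_homology => x _.
  by apply/rowP => -[].
- exact: finite_homology_shift.
- exact: finite_homology_cone.
Qed.

Definition acyclic X := forall i, has_length (tensor phi (homology X i)) 0.

Lemma acyclic_finite X : acyclic X -> finite_homology X.
Proof. by move=> X0; apply: finite_homologyI => i; exists 0%N. Qed.

Lemma acyclicE X : acyclic X <->
  forall i (x : X i), cdiff X i x = 0 -> exists2 s, S s & is_boundary (s *: x).
Proof.
have eq0 i := tensor_eq0 loc (homology X i).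
split=> [X0 i x dx|X0 i].
  have /has_length0/eq0/(_ (hclass (mk_cycle dx)))[s Ss sx] := X0 i.
  exists s => //; have /hclass_eq0 : hclass (s *: mk_cycle dx) = 0 by rewrite /hclass linearZ.
  by [].
apply/has_length0/eq0 => c; have [z <-] := hclass_surj c.
have [s Ss sz] := X0 i (cycle_val z) (cycleP z); exists s => //.
by rewrite /hclass -linearZ; apply/hclass_eq0.
Qed.

Lemma acyclic_triangulated : triangulated_subcategory (fun X : perf R => acyclic X).
Proof.
split=> [X Y XY X0 i| |X|X Y f X0 Y0 i].
- exact: homotopy_has_length XY (X0 i).
- by move=> i; apply: zero_homology => x _; apply/rowP => -[].
- split=> X0 i; last by apply/shift_has_length; exact: X0.
  by have /shift_has_length := X0 (i + 1); rewrite addrK.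
have [r _ /(_ i)[c cP cE]] := cone_hlen f (acyclic_finite X0) (acyclic_finite Y0).
have XE := module_lengthE (X0 (i - 1)); have YE := module_lengthE (Y0 i).
have -> : 0%N = c by move: cE; rewrite /hlen XE YE; lia.
exact: cP.
Qed.

End EulerCharacteristic.

(** * Objects modulo a triangulated subcategory *)

Section Similarity.
Variables (R : comNzRingType) (C : subcategory R) (Ctri : triangulated_subcategory C).
Implicit Types X Y Z : perf R.

(* Equality in the quotient of the monoid of objects under (+) by the objects of C;
   the class of X is trivial iff X is in C. *)
Definition sim X Y := forall Z, C (perf_dsum X Z) <-> C (perf_dsum Y Z).

Lemma sim_refl X : sim X X. Proof. by []. Qed.
Lemma sim_sym X Y : sim X Y -> sim Y X. Proof. by move=> XY Z; rewrite XY. Qed.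
Lemma sim_trans X Y Z : sim X Y -> sim Y Z -> sim X Z.
Proof. by move=> XY YZ W; rewrite XY. Qed.

Lemma heq_sim X Y : homotopy_equivalent X Y -> sim X Y.
Proof.
move=> XY Z; apply: (tri_iff Ctri); apply: dsum_cong => //.
exact: homotopy_equivalent_refl.
Qed.

Lemma sim_dsumC X Y : sim (perf_dsum X Y) (perf_dsum Y X).
Proof. by apply: heq_sim; exact: dsumC. Qed.

Lemma sim_dsumA X Y Z : sim (perf_dsum (perf_dsum X Y) Z) (perf_dsum X (perf_dsum Y Z)).
Proof. by apply: heq_sim; exact: dsumA. Qed.

Lemma sim_dsuml X X' Y : sim X X' -> sim (perf_dsum X Y) (perf_dsum X' Y).
Proof. by move=> XX Z; rewrite !(tri_dsumA Ctri). Qed.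

Lemma sim_dsum X X' Y Y' : sim X X' -> sim Y Y' -> sim (perf_dsum X Y) (perf_dsum X' Y').
Proof.
move=> XX YY; apply: sim_trans (sim_dsuml _ XX) _.
apply: sim_trans (sim_dsumC _ _) _; apply: sim_trans (sim_dsumC _ _); exact: sim_dsuml.
Qed.

Lemma sim_0dsum X Y : C X -> sim (perf_dsum X Y) Y.
Proof. by move=> CX Z; rewrite (tri_dsumA Ctri) (tri_dsum_iffr Ctri). Qed.

Lemma sim_mem X Y : sim X Y -> C X <-> C Y.
Proof.
have C0 W : C W <-> C (perf_dsum W (perf0 R)).
  by rewrite (tri_dsumC Ctri) (tri_dsum_iffr Ctri) //; exact: (tri_zero Ctri).
by move=> XY; rewrite C0 XY -C0.
Qed.

(** Inverses modulo $C$ are unique, as in any commutative monoid. *)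
Lemma sim_inv_uniq X X' Y : C (perf_dsum X Y) -> C (perf_dsum X' Y) -> sim X X'.
Proof.
move=> XY X'Y; apply: sim_trans (sim_sym (sim_0dsum X X'Y)) _.
apply: sim_trans (sim_dsumA _ _ _) _.
apply: sim_trans (sim_dsumC _ _) _; apply: sim_0dsum.
by rewrite (tri_dsumC Ctri).
Qed.

Lemma mem_shift_dsum X Y : C (perf_dsum (perf_shift X) (perf_shift Y)) <-> C (perf_dsum X Y).
Proof.
rewrite -(tri_shift Ctri (perf_dsum X Y)).
apply: (iff_trans (B := C (perf_cone (zero_map X (perf_shift Y))))).
  by apply: iff_sym; apply: (tri_iff Ctri); exact: cone_zero_map.
by apply: (tri_iff Ctri); exact: shift_dsum_cone.
Qed.

(** * Generators with a dual family of Euler characteristics *)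

Section Generators.
Variables (I : eqType) (G : I -> perf R) (e : I -> perf R -> int) (T : subcategory R).
Hypothesis Ttri : triangulated_subcategory T.
Hypothesis e_iso : forall i X Y, homotopy_equivalent X Y -> T X -> e i Y = e i X.
Hypothesis e_shift : forall i X, T X -> e i (perf_shift X) = - e i X.
Hypothesis e_cone : forall i X Y (f : chain_map X Y), T X -> T Y ->
  e i (perf_cone f) = e i Y - e i X.
Hypothesis T_gen : forall K : subcategory R, triangulated_subcategory K ->
  (forall i, K (G i)) -> forall X, T X -> K X.
Hypothesis G_mem : forall i, T (G i).
Hypothesis e_gen : forall i j, e i (G j) = (i == j)%:Z.
Hypothesis C_gen : forall i, C (perf_dsum (perf_shift (G i)) (G i)).

(** The boolean is a sign, since modulo $C$ the shift is the inverse. A list of signed generators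
    stands for an integral combination with coefficients [degree]. *)
Definition gen (x : I * bool) := if x.2 then perf_shift (G x.1) else G x.1.
Definition gens (l : seq (I * bool)) := foldr (fun x => perf_dsum (gen x)) (perf0 R) l.
Definition flip (x : I * bool) := (x.1, ~~ x.2).
Definition degree i (l : seq (I * bool)) : int :=
  (count_mem (i, false) l)%:Z - (count_mem (i, true) l)%:Z.

Lemma gens_cat l m : sim (gens (l ++ m)) (perf_dsum (gens l) (gens m)).
Proof.
elim: l => [|x l IHl] /=.
  by apply: sim_sym; apply: sim_0dsum; exact: (tri_zero Ctri).
apply: sim_trans (sim_dsum (sim_refl _) IHl) _.
by apply: sim_sym; exact: sim_dsumA.
Qed.

Lemma gen_flip x : C (perf_dsum (gen x) (gen (flip x))).
Proof. by case: x => i [] /=; rewrite /gen /= ?(tri_dsumC Ctri (G i)); exact: C_gen. Qed.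

Lemma sim_dsumACA X Y Z W : sim (perf_dsum (perf_dsum X Y) (perf_dsum Z W))
  (perf_dsum (perf_dsum X Z) (perf_dsum Y W)).
Proof.
apply: sim_trans (sim_dsumA _ _ _) _; apply: sim_trans _ (sim_sym (sim_dsumA _ _ _)).
apply: sim_dsum => //; apply: sim_trans (sim_sym (sim_dsumA _ _ _)) _.
apply: sim_trans (sim_dsumA _ _ _); apply: sim_dsuml; exact: sim_dsumC.
Qed.

Lemma gens_flip l : C (perf_dsum (gens l) (gens (map flip l))).
Proof.
elim: l => [|x l IHl] /=; first by apply: (tri_dsum Ctri); exact: (tri_zero Ctri).
apply/(sim_mem (sim_dsumACA _ _ _ _)); apply: (tri_dsum Ctri) => //; exact: gen_flip.
Qed.

Lemma shift_gens l : C (perf_dsum (perf_shift (gens l)) (gens l)).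
Proof.
elim: l => [|x l IHl] /=.
  by apply: (tri_dsum Ctri); [apply/(tri_shift Ctri)|]; exact: (tri_zero Ctri).
have gx : C (perf_dsum (perf_shift (gen x)) (gen x)).
  case: x => i []; last exact: C_gen.
  by apply/mem_shift_dsum; exact: C_gen.
apply/(sim_mem (_ : sim _ (perf_dsum (perf_dsum (perf_shift (gen x)) (perf_shift (gens l)))
    (perf_dsum (gen x) (gens l))))).
  apply: sim_dsuml.
  apply: (sim_trans (Y := perf_cone (zero_map (gen x) (perf_shift (gens l))))).
    by apply: sim_sym; apply: heq_sim; exact: shift_dsum_cone.
  by apply: heq_sim; exact: cone_zero_map.
apply/(sim_mem (sim_dsumACA _ _ _ _)); exact: (tri_dsum Ctri).
Qed.

(** Both sides are inverse to [gens l]. *)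
Lemma sim_shift_gens l : sim (perf_shift (gens l)) (gens (map flip l)).
Proof.
apply: (sim_inv_uniq (Y := gens l)); first exact: shift_gens.
by rewrite (tri_dsumC Ctri); exact: gens_flip.
Qed.

Lemma flipK : involutive flip.
Proof. by move=> [i b]; rewrite /flip /= negbK. Qed.

Lemma degree_flip i l : degree i (map flip l) = - degree i l.
Proof.
rewrite /degree !count_map opprB; congr (_%:Z - _%:Z); apply: eq_count => -[j []] /=;
by rewrite !xpair_eqE.
Qed.

Lemma degree_cat i l m : degree i (l ++ m) = degree i l + degree i m.
Proof. by rewrite /degree !count_cat !PoszD; lia. Qed.

(** The opposite of the first generator occurs in the rest of the list. Their sum is in $C$, and the
    pair can be removed. *)
Lemma gens_degree0 l : (forall i, degree i l = 0) -> C (gens l).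
Proof.
have [n ln] := ubnP (size l); elim: n l ln => // n IHn [|[i b] l] /= ln l0.
  exact: (tri_zero Ctri).
have il : (i, ~~ b) \in l.
  rewrite -has_pred1 has_count; have := l0 i; rewrite /degree /=.
  by case: b {l0}; rewrite !xpair_eqE /= !eqxx /=; lia.
case/splitPr: il ln l0 => l1 l2; rewrite size_cat /= => ln l0.
have l12 : C (gens (l1 ++ l2)).
  apply: IHn => [|j]; first by rewrite size_cat; lia.
  have := l0 j; rewrite -cat1s !degree_cat -[_ :: l2]cat1s degree_cat.
  have -> : degree j [:: (i, ~~ b)] = - degree j [:: (i, b)].
    by rewrite -degree_flip.
  by move=> <-; lia.
have s1 : sim (gens (l1 ++ (i, ~~ b) :: l2)) (perf_dsum (gen (i, ~~ b)) (gens (l1 ++ l2))).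
  apply: sim_trans (gens_cat _ _) _ => /=.
  apply: sim_trans (sim_dsumC _ _) _; apply: sim_trans (sim_dsumA _ _ _) _.
  apply: sim_dsum => //; apply: sim_trans (sim_dsumC _ _) _.
  by apply: sim_sym; exact: gens_cat.
apply/(sim_mem (sim_dsum (sim_refl _) s1)).
apply/(sim_mem (sim_sym (sim_dsumA _ _ _))).
by apply: (tri_dsum Ctri) => //; exact: gen_flip.
Qed.

(** Says that [gens l] is an inverse of $X$ modulo $C$ with the coefficients predicted by the Euler
    characteristics. Using the inverse turns the claim into plain membership in $C$. *)
Definition spanned X := T X /\
  exists2 l, C (perf_dsum X (gens l)) & forall i, e i X + degree i l = 0.

Lemma spanned_triangulated : triangulated_subcategory spanned.
Proof.
split=> [X Y XY [TX [l Cl el]]| |X|X Y f [TX [l Cl el]] [TY [m Cm em]]].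
- split; first exact: (tri_iso Ttri XY TX).
  by exists l => [|i]; [apply/(heq_sim XY)|rewrite (e_iso i XY TX)].
- have T0 := tri_zero Ttri; split=> //; exists [::] => [|i].
    by apply: (tri_dsum Ctri); exact: (tri_zero Ctri).
  have := @e_iso i (perf_shift (perf0 R)) (perf0 R) (shift_zero R).
  by rewrite e_shift // /degree /= => /(_ (proj2 (tri_shift Ttri _) T0)); lia.
- split=> [[/(tri_shift Ttri) TX [l Cl el]]|[TX [l Cl el]]].
    split=> //; exists (map flip l) => [|i]; last first.
      by have := el i; rewrite e_shift // degree_flip; lia.
    apply/mem_shift_dsum; apply/(sim_mem (_ : sim _ (perf_dsum (perf_shift X) (gens l)))) => //.
    apply: sim_dsum => //; apply: sim_trans (sim_shift_gens _) _.
    by rewrite (mapK flipK).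
  split; first exact/(tri_shift Ttri).
  exists (map flip l) => [|i]; last first.
    by have := el i; rewrite e_shift // degree_flip; lia.
  apply/(sim_mem (sim_dsum (sim_refl _) (sim_shift_gens _))); exact/mem_shift_dsum.
- split; first exact: (tri_cone Ttri).
  exists (map flip l ++ m) => [|i]; last first.
    by have := el i; have := em i; rewrite degree_cat degree_flip e_cone //; lia.
  (* The map $f\oplus0$ joins two objects of $C$. Its cone is the cone of $f$ plus the shift of
     [gens l] plus [gens m]. *)
  pose g : chain_map (perf_dsum X (gens l)) (perf_dsum Y (gens m)) :=
    dsum_map f (zero_map (gens l) (gens m)).
  have Cg := tri_cone Ctri g Cl Cm.
  have gE : sim (perf_cone g) (perf_dsum (perf_cone f) (gens (map flip l ++ m))).
    apply: (sim_trans (Y := perf_dsum (perf_cone f) (perf_cone (zero_map (gens l) (gens m))))).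
      by apply: heq_sim; exact: cone_dsum.
    apply: sim_dsum => //.
    apply: (sim_trans (Y := perf_dsum (perf_shift (gens l)) (gens m))).
      by apply: heq_sim; exact: cone_zero_map.
    apply: sim_trans (sim_sym (gens_cat _ _)); apply: sim_dsuml; exact: sim_shift_gens.
  by apply/(sim_mem gE).
Qed.

(** All of $T$ is spanned; here the list has degree 0, so it is in $C$ and cancels. *)
Lemma mem_euler0 X : T X -> (forall i, e i X = 0) -> C X.
Proof.
move=> TX X0; have [i|_ [l Cl el]] := T_gen spanned_triangulated _ TX.
  split=> //; exists [:: (i, true)] => [|j]; last first.
    by rewrite e_gen /degree /= !xpair_eqE /= andbT andbF; case: (i =P j) => [->|/eqP];
      rewrite ?eqxx // eq_sym => /negPf->.
  apply/(sim_mem (sim_sym (sim_dsumA _ _ _))); rewrite (tri_dsumC Ctri).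
  apply: (tri_dsum Ctri); first exact: (tri_zero Ctri).
  by rewrite (tri_dsumC Ctri); exact: C_gen.
have /gens_degree0 Cgl i : degree i l = 0 by have := el i; rewrite X0 add0r.
by apply/(tri_dsum_iffr Ctri _ Cgl); rewrite (tri_dsumC Ctri).
Qed.

(** Additivity on sums follows from that on cones, as $(X\oplus Y)[1]$ is the cone of a zero map. *)
Lemma euler_dsum i X Y : T X -> T Y -> e i (perf_dsum X Y) = e i X + e i Y.
Proof.
move=> TX TY; have TsY := proj2 (tri_shift Ttri Y) TY.
have := @e_iso i (perf_cone (zero_map X (perf_shift Y))) (perf_shift (perf_dsum X Y))
  (shift_dsum_cone X Y) (tri_cone Ttri _ TX TsY).
rewrite e_cone // !e_shift //; last exact: (tri_dsum Ttri).
by lia.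
Qed.

(** $X\oplus Z[1]$ has vanishing Euler characteristics, and $Z[1]$ cancels. *)
Lemma mem_euler_eq X Z : (forall Z, C Z -> T Z) -> T X -> C Z ->
  (forall i, e i X = e i Z) -> C X.
Proof.
move=> CT TX CZ XZ; have TZ := CT _ CZ; have TsZ := proj2 (tri_shift Ttri Z) TZ.
have CsZ := proj2 (tri_shift Ctri Z) CZ.
have : C (perf_dsum X (perf_shift Z)).
  apply: mem_euler0 => [|i]; first exact: (tri_dsum Ttri).
  by rewrite euler_dsum // e_shift // XZ subrr.
by rewrite (tri_dsumC Ctri) (tri_dsum_iffr Ctri).
Qed.
End Generators.
End Similarity.

Lemma fraction_denominator (R : idomainType) (x : {fraction R}) :
  exists s b : R, s != 0 /\ tofrac s * x = tofrac b.
Proof.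
move: x; elim/quotW => r; exists (frac r).2, (frac r).1; split.
  exact: denom_ratioP.
unlock tofrac; rewrite !piE; apply/eqmodP; rewrite /= FracField.equivfE.
by rewrite !numden_Ratio ?(oner_eq0, mulf_neq0, denom_ratioP) // !mulr1 mul1r mulrC.
Qed.

Lemma localising_fraction (R : idomainType) :
  localising (@tofrac R) (fun s => s != 0).
Proof.
split=> [|s t s0 t0|s s0|x|x y /eqP]; rewrite ?oner_eq0 ?mulf_neq0 //.
- by exists (tofrac s)^-1; rewrite mulVf // tofrac_eq0.
- exact: fraction_denominator.
- by rewrite tofrac_eq => /eqP.
Qed.

Lemma localising_prime (R : idomainType) (p : Spec R) :
  localising (@localisation_of R p) (fun s => s \notin p).
Proof.
have sne0 s : s \notin p -> tofrac s != 0.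
  by apply: contraNneq => /eqP; rewrite tofrac_eq0 => /eqP->; exact: idealr0.
split=> [|s t sp tp|s sp|x|x y /(congr1 val) /= /eqP].
- by rewrite idealr1.
- by rewrite prime_idealrM negb_or sp.
- have sV : (tofrac s)^-1 \in localisation_pred p.
    by apply/asboolP; exists 1, s; rewrite tofrac1 div1r.
  by exists (Localisation sV); apply: val_inj; rewrite /= mulVf // sne0.
- case: x => x xp; have /asboolP[a [s [sp xE]]] := xp.
  exists s, a; split=> //; apply: val_inj; rewrite /= xE mulrCA divff ?mulr1 //.
  exact: sne0.
- by rewrite tofrac_eq => /eqP.
Qed.

(** * Vanishing in the derived category and acyclicity *)

Section DerivedAcyclic.
Variables (R A : comNzRingType) (phi : {rmorphism R -> A}) (S : R -> Prop).
Hypothesis loc : localising phi S.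
Variable X : complex R.
Local Notation T := (tensor_complex phi X).

Lemma tensor_boundary k (x : X (k - 1)) : is_boundary (tensor_pure phi 1 x : T (k - 1)) ->
  exists2 s, S s & is_boundary (s *: x).
Proof.
move=> /is_boundary_pred[t xt]; have [s [y [Ss sy]]] := tensor_frac loc t.
have : tensor_pure phi 1 (s *: x - cdiff X k y) = 0.
  rewrite tensor_pure1D -[- cdiff X k y]scaleN1r !tensor_pure1Z rmorphN1 scaleN1r.
  rewrite -(tensor_mapE phi (cdiff X k)) -sy linearZ /= xt subrr //.
move=> /(tensor_pure_eq0 loc)[s' Ss'] /eqP; rewrite scalerBr subr_eq0 scalerA => /eqP E.
exists (s' * s); first exact: loc_mul loc _ _ Ss' Ss.
by apply/is_boundary_pred; exists (s' *: y); rewrite E linearZ.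
Qed.

Lemma boundary_tensor k (x : X (k - 1)) (t : T (k - 1)) s : S s ->
  phi s *: t = tensor_pure phi 1 x -> is_boundary x -> is_boundary t.
Proof.
move=> Ss st /is_boundary_pred[y xy]; have [u us] := loc_unit loc Ss.
apply/is_boundary_pred; exists (u *: tensor_pure phi 1 y).
by rewrite linearZ /= tensor_mapE -xy -st scalerA us scale1r.
Qed.

(** [acyclic] localises the homology, whereas the support refers to the localised complex. Clearing
    denominators compares the two as far as vanishing is concerned. *)
Lemma acyclic_tensor : acyclic phi X <->
  forall i (t : T i), cdiff T i t = 0 -> is_boundary t.
Proof.
rewrite (acyclicE loc); split=> [X0 i t dt|T0 i x dx]; last first.
  have [k ik] : exists k, i = k - 1 by exists (i + 1); rewrite addrK.
  move: x dx; rewrite ik => x dx; apply: tensor_boundary; apply: T0.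
  by rewrite /= tensor_mapE dx tensor_pure0.
have [k ik] : exists k, i = k - 1 by exists (i + 1); rewrite addrK.
move: t dt; rewrite {i}ik => t dt; have [s [x [Ss sx]]] := tensor_frac loc t.
have : tensor_pure phi 1 (cdiff X (k - 1) x) = 0.
  have dt' : tensor_map phi (cdiff X (k - 1)) t = 0 := dt.
  by rewrite -(tensor_mapE phi (cdiff X (k - 1))) -sx linearZ /= dt' scaler0.
move=> /(tensor_pure_eq0 loc)[s' Ss' s'dx].
have [|s2 Ss2 s2x] := X0 (k - 1) (s' *: x); first by rewrite linearZ.
apply: (boundary_tensor (loc_mul loc Ss2 (loc_mul loc Ss' Ss))) s2x.
by rewrite !tensor_pure1Z -sx !scalerA -!rmorphM -mulrA.
Qed.

(** A roof makes the homology of [T] trivial; conversely, the identity and the zero map form a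
    roof. *)
Lemma derived_zero_acyclic :
  derived_isomorphic T (zero_complex A) <-> acyclic phi X.
Proof.
have triv (Y : complex A) i : (forall y : Y i, cdiff Y i y = 0 -> is_boundary y) ->
    forall c : homology Y i, c = 0.
  move=> Y0 c; have [z <-] := hclass_surj c; apply/hclass_eq0/Y0; exact: cycleP.
have zero_triv i (c : homology (zero_complex A) i) : c = 0.
  have [z <-] := hclass_surj c; rewrite (_ : z = 0); first by rewrite /hclass linear0.
  by apply: val_inj; apply/rowP => -[].
rewrite acyclic_tensor; split=> [[Z [f [g [fq gq]]]] i t dt|T0]; last first.
  have Ttriv k (c c' : homology T k) : c = c'.
    by apply: etrans (triv _ _ _ c) (esym (triv _ _ _ c')); exact: T0.
  exists T, (id_map T), (zero_map T (zero_complex A)); split=> i.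
    by exists id => c; apply: Ttriv.
  by exists (fun=> 0) => c; [exact: Ttriv | exact: etrans (zero_triv _ _) (esym (zero_triv _ _))].
have [g' gK _] := gq i; have [f' _ fK] := fq i.
have Z0 (c c' : homology Z i) : c = c'.
  by rewrite -[c]gK -[c']gK; congr g'; exact: etrans (zero_triv _ _) (esym (zero_triv _ _)).
have T0 (c c' : homology T i) : c = c' by rewrite -[c]fK -[c']fK (Z0 (f' c) (f' c')).
by have /hclass_eq0 := T0 (hclass (mk_cycle dt)) 0.
Qed.
End DerivedAcyclic.

(** * Prime ideals and elementary complexes *)

Section PrincipalSpec.
Variable R : idomainType.

Definition multiples (g : R) : {pred R} := fun x => `[< divides g x >].

Lemma multiples_ideal g : ~ divides g 1 -> idealr_closed (multiples g).
Proof.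
move=> g1; split; first by apply/asboolP; exists 0; rewrite mul0r.
  by apply/asboolP.
move=> a x y /asboolP[c ->] /asboolP[d ->]; apply/asboolP.
by exists (a * c + d); rewrite mulrDl mulrA.
Qed.

Lemma multiples_prime g : (forall x y, divides g (x * y) -> divides g x \/ divides g y) ->
  prime_idealr_closed (multiples g).
Proof.
by move=> gP x y /asboolP/gP[]gx; apply/orP; [left|right]; apply/asboolP.
Qed.

Definition principal_spec g (g1 : ~ divides g 1)
    (gP : forall x y, divides g (x * y) -> divides g x \/ divides g y) : Spec R :=
  HB.pack (multiples g) (isIdealr.Build R (multiples g) (multiples_ideal g1))
    (isPrimeIdealrClosed.Build R (multiples g) (multiples_prime gP)).

Lemma principal_specP g g1 gP x : (x \in @principal_spec g g1 gP) <-> divides g x.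
Proof. by split=> /asboolP. Qed.

Lemma divides0 x : divides (0 : R) x <-> x = 0.
Proof. by split=> [[c ->]|->]; [rewrite mulr0|exists 0; rewrite mul0r]. Qed.

Lemma zero_nonunit : ~ divides (0 : R) 1.
Proof. by move/divides0/eqP; rewrite oner_eq0. Qed.

Lemma zero_prime (x y : R) : divides 0 (x * y) -> divides 0 x \/ divides 0 y.
Proof.
by move/divides0/eqP; rewrite mulf_eq0 => /orP[]/eqP->; [left|right]; apply/divides0.
Qed.

Definition zero_spec : Spec R := principal_spec zero_nonunit zero_prime.

Lemma zero_specP x : (x \in zero_spec) = (x == 0).
Proof. by apply/idP/eqP => [/principal_specP/divides0|->] //; exact: idealr0. Qed.

Hypothesis R_pid : all_ideals_principal R.

Lemma spec_generator (p : Spec R) : exists g, forall x, x \in p <-> divides g x.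
Proof.
have [||g gP] := R_pid (I := [set x | x \in p]) .
- exact: idealr0.
- by move=> a x y xp yp /=; apply: rpredD => //; apply: idealMr.
exists g => x; split=> [xp|[c xc]].
  have : [set x | x \in p] x := xp.
  by rewrite gP => -[c _ cE]; exists c.
have : [set a * g | a in [set: R]] x by exists c.
by rewrite -gP.
Qed.

(** A non-unit divisor of $a$ that is minimal for divisibility generates a prime ideal. *)
Lemma prime_divisor a : ~ divides a 1 -> exists p : Spec R, a \in p.
Proof.
move=> a1; pose P x := ~ divides x 1 /\ divides x a.
have [|g [g1 ga] gmin] := @pid_minimal R R_pid P a; first by split=> //; exists 1; rewrite mul1r.
have gP x y : divides g (x * y) -> divides g x \/ divides g y.
  move=> [k xy]; have [gx|gx] := pselect (divides g x); [by left|right].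
  (* If $g$ does not divide $x$, their greatest common divisor is a proper divisor of $g$, hence a
     unit by minimality. *)
  have [u [v [c [d [gc xd]]]]] := pid_bezout R_pid g x.
  have [[w wE]|e1] := pselect (divides (u * g + v * x) 1).
    exists (w * (u * y + v * k)); rewrite -[LHS]mul1r wE -!mulrA; congr (w * _).
    by rewrite !mulrDl -!mulrA xy [g * y]mulrC.
  case: gx; have /gmin[|e eE] : P (u * g + v * x).
    by split=> //; case: ga => f ->; exists (f * c); rewrite -mulrA -gc.
  - by exists c.
  - by exists (d * e); rewrite xd eE mulrA.
by exists (principal_spec g1 gP); apply/principal_specP.
Qed.
End PrincipalSpec.

Section ElementaryHomology.
Variables (R : idomainType) (A : comNzRingType) (phi : {rmorphism R -> A}) (S : R -> Prop).
Hypothesis loc : localising phi S.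

(** The annihilator of $c$ is the complement of [S], as for $R$ at the zero ideal and for $R/p$ at
    $p$. Every nonzero element of the localisation is then a unit multiple of the class of $c$. *)
Lemma cyclic_length1 (M : lmodType R) (c : M) : (forall m, exists r, m = r *: c) ->
  (forall s, S s -> s *: c <> 0) -> (forall r, r *: c = 0 \/ S r) ->
  has_length (tensor phi M) 1.
Proof.
move=> cM Sc rc; apply: (@has_length1 _ _ (tensor_pure phi 1 c)).
  by apply/eqP => /(tensor_pure_eq0 loc)[s Ss]; exact: Sc.
have frac (x : tensor phi M) : exists s r, S s /\ phi s *: x = phi r *: tensor_pure phi 1 c.
  have [s [m [Ss sm]]] := tensor_frac loc x; have [r mr] := cM m.
  by exists s, r; split=> //; rewrite sm mr tensor_pure1Z.
move=> x y x0; have [s [r [Ss sr]]] := frac x; have [t [q [St tq]]] := frac y.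
have Sr : S r.
  case: (rc r) => // r0; case/eqP: x0; apply: (tensor_scale_eq0 loc Ss).
  by rewrite sr -tensor_pure1Z r0 (tensor_pure0 phi).
have [u ur] := loc_unit loc Sr; have [v vt] := loc_unit loc St.
exists (v * phi q * (u * phi s)).
by rewrite -!scalerA sr [u *: _]scalerA ur scale1r -tq scalerA vt scale1r.
Qed.

(** The length is a variable equal to 1 because it will be a truth value such as [i == i], which
    does not reduce. *)
Lemma row1_const n (x : 'rV[R]_n) : n = 1%N -> exists r, x = r *: const_mx 1.
Proof.
move=> n1; subst n; exists (x 0 0); apply/rowP => k.
by rewrite (ord1 k) !mxE mulr1.
Qed.

Lemma scale_const_eq n (r s : R) : n = 1%N ->
  r *: const_mx 1 = s *: const_mx 1 :> 'rV[R]_n -> r = s.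
Proof. by move=> n1; subst n => /rowP/(_ 0); rewrite !mxE !mulr1. Qed.

Lemma row_scale_eq0 n a (x : 'rV[R]_n) : a != 0 -> a *: x = 0 -> x = 0.
Proof.
move=> a0 /rowP ax; apply/rowP => k; have := ax k; rewrite !mxE => /eqP.
by rewrite mulf_eq0 (negPf a0) => /eqP.
Qed.

Let one0 : nat_of_bool ((0 : int) == 0) = 1%N. Proof. by rewrite eqxx. Qed.

Lemma stalk_boundary i j (x : stalk R i j) : is_boundary x -> x = 0.
Proof. by case. Qed.

Lemma stalk_has_length i : (forall r, r != 0 <-> S r) ->
  has_length (tensor phi (homology (stalk R 0) i)) (i == 0).
Proof.
move=> SE; have [->|i0] := eqVneq i 0; last first.
  by apply: (zero_homology loc) => x _; exact: stalk_zero i0.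
pose c : cycle (stalk R 0) 0 := @mk_cycle _ (stalk R 0) 0 (const_mx 1) erefl.
apply: (@cyclic_length1 _ (hclass c)) => [m|s /SE s0 sc|r].
- have [z <-] := hclass_surj m; have [r zr] := row1_const (cycle_val z) one0.
  exists r; rewrite /hclass -linearZ; congr (quotmod_pi _ _); exact: val_inj.
- have /hclass_eq0/stalk_boundary/= : hclass (s *: c) = 0 by rewrite /hclass linearZ.
  rewrite -[RHS](scale0r (const_mx 1)) => /(scale_const_eq one0) sE.
  by rewrite sE eqxx in s0.
have [->|r0] := eqVneq r 0; first by left; rewrite scale0r.
by right; apply/SE.
Qed.

Lemma cone_stalk_boundary g i j (w : cone_complex (scal g (stalk R i)) j) :
  is_boundary w -> exists r : stalk R i j, w.2 = g *: r.
Proof. by case=> k z; exists z.1; rewrite /= addr0. Qed.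

Lemma cone_stalk_boundaryP g (r : R) k (x : stalk R 0 (k - 1)) :
  is_boundary ((0, (g * r) *: x) : cone_complex (scal g (stalk R 0)) (k - 1)).
Proof.
apply/is_boundary_pred; exists (r *: x, 0); congr pair; rewrite /= ?oppr0 //.
by rewrite addr0 scalerA.
Qed.

Lemma cone_stalk_has_length g i : g != 0 -> (forall r, S r <-> ~ divides g r) ->
  has_length (tensor phi (homology (cone_complex (scal g (stalk R 0))) i)) (i == 0).
Proof.
move=> g0 SE; set C := cone_complex _; have [->|i0] := eqVneq i 0; last first.
  apply: (zero_homology loc) => -[x y] /(congr1 snd) /=; rewrite addr0.
  by move=> /(row_scale_eq0 g0) ->; congr pair; exact: stalk_zero i0.
have d0 : cdiff C 0 (0, const_mx 1) = 0.
  by congr pair; rewrite /= ?oppr0 // addr0 scaler0.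
pose c : cycle C 0 := mk_cycle d0.
have stalk1 (x : stalk R 0 (0 - 1)) : x = 0 by exact: stalk_zero.
apply: (@cyclic_length1 _ (hclass c)) => [m|s /SE sg sc|r].
- have [z <-] := hclass_surj m; have [r zr] := row1_const (cycle_val z).2 one0.
  exists r; rewrite /hclass -linearZ; congr (quotmod_pi _ _); apply: val_inj.
  by apply: pair_ext; [exact: etrans (stalk1 _) (esym (stalk1 _))|exact: zr].
- have /hclass_eq0/cone_stalk_boundary[r /=] : hclass (s *: c) = 0 by rewrite /hclass linearZ.
  have [t ->] := row1_const r one0; rewrite scalerA => /(scale_const_eq one0) sE.
  by apply: sg; exists t; rewrite mulrC.
have [[k rk]|nr] := pselect (divides g r); last by right; apply/SE.
left; rewrite /hclass -linearZ; apply/hclass_eq0.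
have -> : cycle_val (r *: c) = (0, (g * k) *: const_mx 1) :> C 0.
  by apply: pair_ext; rewrite /= ?scaler0 // rk mulrC.
exact: (@cone_stalk_boundaryP g k 1 (const_mx 1)).
Qed.

Lemma acyclic_cone_scal (X : complex R) s : S s -> acyclic phi (cone_complex (scal s X)).
Proof.
move=> Ss; apply/(acyclicE loc) => i x dx; exists s => //.
have [k ik] : exists k, i = k - 1 by exists (i + 1); rewrite addrK.
move: x dx; rewrite ik => x dx; apply/is_boundary_pred.
(* Multiplication by $s$ is null-homotopic on the cone of $s$, so it turns cycles into
   boundaries. *)
have [h hP] := scal_cone_null X s 1; exists (h k x).
have := hP k x; rewrite dx linear0 addr0 => <-.
by rewrite /= scale0r subr0 mul1r.
Qed.

Lemma stalk_not_acyclic i : ~ S 0 -> ~ acyclic phi (stalk R i).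
Proof.
move=> S0 /(acyclicE loc)/(_ i (const_mx 1) erefl)[s Ss /stalk_boundary].
have ii : nat_of_bool (i == i) = 1%N by rewrite eqxx.
rewrite -[RHS](scale0r (const_mx 1)) => /(scale_const_eq ii) sE.
by rewrite sE in Ss.
Qed.

Lemma cone_stalk_not_acyclic g i : (forall s, S s -> ~ divides g s) ->
  ~ acyclic phi (cone_complex (scal g (stalk R i))).
Proof.
move=> Sg; set C := cone_complex _.
have d0 : cdiff C i (0, const_mx 1) = 0.
  by congr pair; rewrite /= ?oppr0 // addr0 scaler0.
have ii : nat_of_bool (i == i) = 1%N by rewrite eqxx.
move=> /(acyclicE loc)/(_ i _ d0)[s Ss /cone_stalk_boundary[r /=]].
have [t ->] := row1_const r ii; rewrite scalerA => /(scale_const_eq ii) sE.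
by apply: (Sg s Ss); exists t; rewrite mulrC.
Qed.

Lemma acyclic_dsuml (X Y : complex R) : acyclic phi (dsum_complex X Y) -> acyclic phi X.
Proof.
move=> /(acyclicE loc) XY0; apply/(acyclicE loc) => i x dx.
have [|s Ss sx] := XY0 i (x, 0); first by congr pair; rewrite /= ?dx ?linear0.
exists s => //.
have [k ik] : exists k, i = k - 1 by exists (i + 1); rewrite addrK.
move: x dx sx; rewrite ik => x dx /is_boundary_pred[z sz]; apply/is_boundary_pred.
by exists z.1; move/(congr1 fst): sz.
Qed.
End ElementaryHomology.

Lemma shift_stalk (R : idomainType) i :
  homotopy_equivalent (shift_complex (stalk R i)) (stalk R (i + 1)).
Proof.
have e j : nat_of_bool (j - 1 == i) = nat_of_bool (j == i + 1).
  by rewrite subr_eq.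
have reL m n (mn : n = m) : linear (fun x : 'rV[R]_m => \row_k x 0 (cast_ord mn k)).
  by move=> a x y; apply/rowP => k; rewrite !mxE.
set X := shift_complex _; set Y := perf_val _.
unshelve epose (f := @ChainMap _ X Y (fun j => lin (reL _ _ (esym (e j)))) _).
  by move=> j x; apply/rowP => k; rewrite !mxE oppr0.
unshelve epose (g := @ChainMap _ Y X (fun j => lin (reL _ _ (e j))) _).
  by move=> j x; apply/rowP => k; rewrite !mxE oppr0.
apply: (@iso_homotopy_equivalent _ _ _ f g) => j x; apply/rowP => k; rewrite !mxE.
  by rewrite cast_ordK.
by rewrite cast_ordKV.
Qed.

Lemma tri_stalk (R : idomainType) (C : subcategory R) : triangulated_subcategory C ->
  forall i j, C (stalk R i) -> C (stalk R j).
Proof.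
move=> Ctri; have step i : C (stalk R i) <-> C (stalk R (i + 1)).
  by rewrite -(tri_shift Ctri); apply: (tri_iff Ctri); exact: shift_stalk.
have to0 i : C (stalk R i) <-> C (stalk R 0).
  elim: i => [|n IHn|n IHn] //.
    by rewrite -IHn (step n) (_ : n.+1%:Z = n%:Z + 1) //; lia.
  by rewrite -IHn (step (- n.+1%:Z)) (_ : - n.+1%:Z + 1 = - n%:Z) //; lia.
by move=> i j; rewrite to0 -(to0 j).
Qed.

(** * Classification *)

Section Classification.
Variables (R : idomainType) (R_pid : all_ideals_principal R).
Implicit Types (X Y Z : perf R) (C K : subcategory R) (p q : Spec R) (S : set (Spec R)).

Definition acyclic_at p : subcategory R := fun X => acyclic (@localisation_of R p) X.

Lemma SuppE p X : Supp X p <-> ~ acyclic_at p X.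
Proof.
have E := derived_zero_acyclic (localising_prime p) X.
by rewrite /Supp; split=> nX /E.
Qed.

Lemma SuppPn p X : ~ Supp X p <-> acyclic_at p X.
Proof. by rewrite SuppE; split=> [|? ?] //; exact: contrapT. Qed.

Lemma T_E S X : T_ S X <-> forall p, ~ S p -> acyclic_at p X.
Proof.
split=> [TX p nSp|TX p /SuppE nXp]; first by apply/SuppPn => /TX.
by apply: contrapT => /TX.
Qed.

Lemma acyclic_tri p :
  triangulated_subcategory (acyclic_at p).
Proof. exact: acyclic_triangulated (localising_prime p). Qed.

Lemma T_triangulated S : triangulated_subcategory (T_ (R := R) S).
Proof.
split=> [X Y XY /T_E TX| |X|X Y f /T_E TX /T_E TY].
- by apply/T_E => p /TX; exact: (tri_iso (acyclic_tri p) XY).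
- by apply/T_E => p _; exact: (tri_zero (acyclic_tri p)).
- by split=> /T_E TX; apply/T_E => p /TX /(tri_shift (acyclic_tri p)).
- by apply/T_E => p Sp; apply: (tri_cone (acyclic_tri p)); [exact: TX|exact: TY].
Qed.

Lemma acyclic_dsum p X Y : acyclic_at p (perf_dsum X Y) <->
  acyclic_at p X /\ acyclic_at p Y.
Proof.
have lp := localising_prime p.
split=> [XY|[X0 Y0]]; last exact: (tri_dsum (acyclic_tri p) X0 Y0).
split; first exact: (acyclic_dsuml lp XY).
apply: (acyclic_dsuml lp (Y := X)).
exact: (proj1 (tri_dsumC (acyclic_tri p) X Y) XY).
Qed.

Lemma T_dsum S X Y : T_ S (perf_dsum X Y) <-> T_ S X /\ T_ S Y.
Proof.
rewrite !T_E; split=> [TXY|[TX TY] p Sp].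
  by split=> p /TXY/acyclic_dsum[].
by apply/acyclic_dsum; split; [exact: TX|exact: TY].
Qed.

Lemma stalk_supp p i : ~ acyclic_at p (stalk R i).
Proof.
apply: (stalk_not_acyclic (localising_prime p)).
by rewrite idealr0.
Qed.

Lemma cone_supp p a i : a \in p ->
  ~ acyclic_at p (perf_cone (scal a (stalk R i))).
Proof.
move=> ap; apply: (cone_stalk_not_acyclic (localising_prime p)) => s sp [c sE].
by case/negP: sp; rewrite sE; exact: idealMr.
Qed.

Lemma cone_acyclic p a X : a \notin p ->
  acyclic_at p (perf_cone (scal a X)).
Proof. exact: (acyclic_cone_scal (localising_prime p)). Qed.

Definition generator p : R := projT1 (cid (spec_generator R_pid p)).
Lemma generatorP p x : x \in p <-> divides (generator p) x.
Proof. by rewrite /generator; case: cid => g. Qed.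

Lemma generator_in p : generator p \in p.
Proof. by apply/generatorP; exists 1; rewrite mul1r. Qed.

Lemma generator_neq0 p : p <> zero_spec R -> generator p != 0.
Proof.
move=> p0; apply/eqP => g0; apply: p0; apply: Spec_ext => x.
by rewrite zero_specP; apply/idP/eqP => [/generatorP|->]; rewrite ?idealr0 // g0 => /divides0.
Qed.

Lemma all_generated K : triangulated_subcategory K -> K (stalk R 0) -> forall X, K X.
Proof.
move=> Ktri K0; apply: (perf_decomposition R_pid); first exact: (tri_iso Ktri).
- exact: (tri_zero Ktri).
- by move=> i X KX; apply: (tri_dsum Ktri) => //; exact: tri_stalk K0.
move=> a i X _ KX; apply: (tri_dsum Ktri) => //.
by apply: (tri_cone Ktri); exact: tri_stalk K0.
Qed.

(* Divide a by the generator of a prime ideal containing it, as long as it is not a unit. *)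
Lemma cone_scal_generated K (U : perf R) S : triangulated_subcategory K ->
  (forall p, S p -> K (perf_cone (scal (generator p) U))) ->
  forall a, a != 0 -> (forall p, a \in p -> S p) -> K (perf_cone (scal a U)).
Proof.
move=> Ktri KS a a0 aS; apply: contrapT => nKa.
pose P x := [/\ x != 0, forall p, x \in p -> S p & ~ K (perf_cone (scal x U))].
have [//|d [d0 dS nKd] dmin] := @pid_minimal R R_pid P a.
have [[u du]|du] := pselect (divides d 1).
  by apply: nKd; exact: (tri_cone_unit Ktri U (esym du)).
have [p dp] := prime_divisor R_pid du.
have /generatorP[b db] := dp.
have [Kb|nKb] := pselect (K (perf_cone (scal b U))).
  by apply: nKd; rewrite db; apply: (tri_scalM Ktri) => //; apply: KS; exact: dS.
have [||c bc] := dmin b.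
- split=> //; first by apply: contra_neq d0 => b0; rewrite db b0 mul0r.
  by move=> q bq; apply: dS; rewrite db mulrC; exact: idealMr.
- by exists (generator p); rewrite mulrC.
have b0 : b != 0 by apply: contra_neq d0 => b0; rewrite db b0 mul0r.
have : generator p \in p := generator_in p.
have : 1 = generator p * c by apply: (mulfI b0); rewrite mulr1 {1}bc db mulrCA [c * _]mulrC.
move=> E gp; have : 1 \in p by rewrite E mulrC; exact: idealMr.
by rewrite idealr1.
Qed.

(** No shift of $R$ occurs as a summand, its support being everything. If the cone of $a$ occurs,
    then the primes that contain $a$ belong to $S$, and $a$ can be factored. *)
Lemma T_generated S K : ~ S (zero_spec R) -> triangulated_subcategory K ->
  (forall p, S p -> K (perf_cone (scal (generator p) (stalk R 0)))) ->
  forall X, T_ S X -> K X.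
Proof.
move=> S0 Ktri KS; apply: (perf_decomposition R_pid).
- move=> X Y XY IH TY; apply: (tri_iso Ktri XY); apply: IH.
  exact: (tri_iso (T_triangulated S) (homotopy_equivalent_sym XY)).
- by move=> _; exact: (tri_zero Ktri).
- by move=> i X _ /T_dsum[/T_E/(_ _ S0) /stalk_supp].
move=> a i X a0 IH /T_dsum[Ta /IH KX]; apply: (tri_dsum Ktri) => //.
(* The objects on which the cone of $a$ is in $K$ form a triangulated subcategory, which allows
   passing to degree 0. *)
apply: (tri_stalk (tri_scal Ktri a) (i := 0)).
apply: (cone_scal_generated Ktri KS) => // p ap; apply: contrapT => nSp.
by move/T_E: Ta => /(_ p nSp) /(cone_supp ap).
Qed.

(** Cones of nonzero $a$ are acyclic at the zero ideal, so a decomposition of $X$ must contain a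
    stalk. *)
Lemma half_stalk C X : triangulated_subcategory C -> C X ->
  ~ acyclic_at (zero_spec R) X -> C (perf_cone (scal 0 (stalk R 0))).
Proof.
move=> Ctri CX X0.
(* [W] is the part of $X$ still to be decomposed, and [Y] collects the summands already passed. *)
suff H : forall W Y, C (perf_dsum W Y) -> ~ acyclic_at (zero_spec R) W ->
    C (perf_cone (scal 0 (stalk R 0))).
  apply: (H X (perf0 R)) => //; apply: (tri_dsum Ctri) => //; exact: (tri_zero Ctri).
move=> W; move: W; apply: (perf_decomposition R_pid).
- move=> W W' WW IH Y CW W0; apply: (IH Y).
    exact/(heq_sim Ctri WW).
  by move=> Wa; apply: W0; exact: (tri_iso (acyclic_tri _) WW).
- by move=> Y _ []; exact: (tri_zero (acyclic_tri _)).
- move=> i W _ Y /(tri_dsumA Ctri) /(tri_summand_scal Ctri 0) H _.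
  apply: (tri_stalk (tri_scal Ctri 0) (i := i)); exact: H.
move=> a i W a0 IH Y CW W0; apply: (IH (perf_dsum (perf_cone (scal a (stalk R i))) Y)).
  apply/(tri_dsumA Ctri); apply/(sim_mem Ctri (sim_dsuml Ctri _ (sim_dsumC Ctri _ _))).
  exact: CW.
move=> Wa; apply: W0; apply: (proj2 (acyclic_dsum _ _ _)); split; last exact: Wa.
by apply: cone_acyclic; rewrite zero_specP.
Qed.

(** Cones of $a\notin p$ are acyclic at $p$ and are passed over. A cone of $a\in p$ has the
    generator of $p$ as a factor of $a$; a stalk is also good enough, as $R/p$ is a cone of an
    endomorphism of $R$. *)
Lemma half_cone C X p : triangulated_subcategory C -> C X ->
  ~ acyclic_at p X ->
  C (perf_cone (scal 0 (perf_cone (scal (generator p) (stalk R 0))))).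
Proof.
move=> Ctri CX X0; set g := generator p.
have Htri := tri_scal (tri_scal Ctri 0) g.
suff H : forall W Y, C (perf_dsum W Y) -> ~ acyclic_at p W ->
    C (perf_cone (scal 0 (perf_cone (scal g (stalk R 0))))).
  apply: (H X (perf0 R)) => //; apply: (tri_dsum Ctri) => //; exact: (tri_zero Ctri).
move=> W; move: W; apply: (perf_decomposition R_pid).
- move=> W W' WW IH Y CW W0; apply: (IH Y).
    exact/(heq_sim Ctri WW).
  by move=> Wa; apply: W0; exact: (tri_iso (acyclic_tri _) WW).
- by move=> Y _ []; exact: (tri_zero (acyclic_tri _)).
- move=> i W _ Y /(tri_dsumA Ctri) /(tri_summand_scal Ctri 0) H _.
  apply: (tri_stalk Htri (i := i)); apply: (tri_cone (tri_scal Ctri 0)); exact: H.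
move=> a i W a0 IH Y CW W0.
have [ap|ap] := boolP (a \in p).
  have /generatorP[b aE] := ap; apply: (tri_stalk Htri (i := i)).
  move/(tri_dsumA Ctri): CW; rewrite aE; exact: (tri_summand_cone_scal Ctri).
apply: (IH (perf_dsum (perf_cone (scal a (stalk R i))) Y)).
  apply/(tri_dsumA Ctri); apply/(sim_mem Ctri (sim_dsuml Ctri _ (sim_dsumC Ctri _ _))).
  exact: CW.
move=> Wa; apply: W0; apply: (proj2 (acyclic_dsum _ _ _)); split; last exact: Wa.
exact: cone_acyclic.
Qed.
End Classification.

Lemma alt_single F : (forall i, i != 0 -> F i = 0) -> alt F = F 0.
Proof.
move=> F0; rewrite /alt (@fsbigTE _ _ _ _ (seq_fset tt [:: 0])); last first.
  by move=> i; rewrite seq_fsetE inE => /F0 ->; rewrite mulr0.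
have -> : seq_fset tt [:: 0 : int] = [fset 0]%fset by apply/fsetP => i; rewrite seq_fsetE !inE.
by rewrite big_seq_fset1 expr0z mul1r.
Qed.

Lemma int_subgroup_principal (H : int -> Prop) : H 0 -> (forall x y, H x -> H y -> H (x - y)) ->
  exists k : int, forall x, H x <-> (k %| x)%Z.
Proof.
move=> H0 HB.
have HN x : H x -> H (- x) by move=> Hx; rewrite -[- x]sub0r; exact: HB.
have HD x y : H x -> H y -> H (x + y) by move=> Hx Hy; rewrite -[y]opprK; apply: HB => //; exact: HN.
have HM x (n : int) : H x -> H (n * x).
  move=> Hx; have Hn (m : nat) : H (m%:Z * x).
    by elim: m => [|m IHm]; rewrite ?mul0r // -addn1 PoszD mulrDl mul1r; exact: HD.
  by case: n => m; [exact: Hn | rewrite NegzE mulNr; apply: HN; exact: Hn].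
have [[x [Hx x0]]|none] := pselect (exists x, H x /\ x != 0); last first.
  exists 0 => x; rewrite dvd0z; split=> [Hx|/eqP->//].
  by apply: contrapT => /negP x0; apply: none; exists x.
pose P n := (0 < n)%N && `[< H n%:Z >].
have Habs y : H y -> H (`|y|%N%:Z).
  by move=> Hy; case: (intP y) Hy => [|m|m] //= /HN; rewrite opprK.
have exP : exists n, P n.
  by exists `|x|%N; rewrite /P absz_gt0 x0; apply/asboolP; exact: Habs.
case: (ex_minnP exP) => k /andP[k0 /asboolP Hk] kmin.
exists k%:Z => y; split=> [Hy|/dvdzP[q ->]]; last exact: HM.
have k0' : k%:Z != 0 by rewrite eqz_nat -lt0n.
have Hm : H (y %% k)%Z.
  by rewrite (_ : (y %% k)%Z = y - (y %/ k)%Z * k); [apply: HB => //; exact: HM | rewrite {2}(divz_eq y k) addrC addKr].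
have m0 := modz_ge0 y k0'; have mk := ltz_mod y k0'.
apply/dvdz_mod0P; apply: contrapT => /eqP mn0.
have : P `|(y %% k)%Z|%N by rewrite /P absz_gt0 mn0; apply/asboolP; exact: Habs.
by move/kmin; lia.
Qed.

Section Classification.
Variables (R : idomainType) (R_pid : all_ideals_principal R).
Implicit Types (X Y Z : perf R) (C K : subcategory R) (p q : Spec R) (S : set (Spec R)).

Lemma fraction_stalk i :
  has_length (tensor (@tofrac R) (homology (stalk R 0) i)) (i == 0).
Proof. exact: (stalk_has_length (localising_fraction R)). Qed.

(** Guards against the default value 0 of [module_length]: finiteness holds for $R$ and passes to
    all that it generates. *)
Lemma fraction_finite X : finite_homology (@tofrac R) X.
Proof.
apply: (all_generated R_pid (K := fun X => finite_homology (@tofrac R) X)).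
  exact: finite_homology_triangulated (localising_fraction R).
by apply: finite_homologyI => i; exists (i == 0); exact: fraction_stalk.
Qed.

Lemma chiE X : chi X = euler (@tofrac R) X.
Proof.
rewrite /chi /euler /alt; apply: eq_fsbigr => i _; congr (_ * _%:Z).
exact: dimensionE (fraction_finite X i).
Qed.

Lemma chi_stalk : chi (stalk R 0) = 1.
Proof.
rewrite chiE /euler alt_single => [|i i0].
  by rewrite /hlen (module_lengthE (fraction_stalk 0)) eqxx.
by rewrite /hlen (module_lengthE (fraction_stalk i)) (negPf i0).
Qed.

Lemma chi_iso X Y : homotopy_equivalent X Y -> chi Y = chi X.
Proof.
by move=> XY; rewrite !chiE; exact: (euler_iso (localising_fraction R) XY (fraction_finite X)).
Qed.

Lemma chi_shift X : chi (perf_shift X) = - chi X.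
Proof. by rewrite !chiE; exact: (euler_shift (localising_fraction R)). Qed.

Lemma chi_cone X Y (f : chain_map X Y) : chi (perf_cone f) = chi Y - chi X.
Proof.
rewrite !chiE; exact: (euler_cone (localising_fraction R) f (fraction_finite X) (fraction_finite Y)).
Qed.

Lemma full_triangulated : triangulated_subcategory (fun _ : perf R => True).
Proof. by split. Qed.

Lemma chi_dsum X Y : chi (perf_dsum X Y) = chi X + chi Y.
Proof.
exact: (@euler_dsum R (unit : eqType) (fun=> @chi R) (fun=> True) full_triangulated
  (fun _ _ _ XY _ => chi_iso XY) (fun _ _ _ => chi_shift _)
  (fun _ _ _ f _ _ => chi_cone f) tt X Y I I).
Qed.

Lemma chi_zero : chi (perf0 R) = 0.
Proof.
by have := chi_iso (shift_zero R : homotopy_equivalent (perf_shift (perf0 R)) (perf0 R));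
  rewrite chi_shift; lia.
Qed.

(** With $R$ as the only generator, $C$ is determined by its set of Euler characteristics, a
    subgroup of the integers; $k$ generates it. *)
Lemma classification_full C Z : triangulated_subcategory C -> C Z ->
  ~ acyclic_at (zero_spec R) Z -> exists k : int, same_objects C (@D_ R k).
Proof.
move=> Ctri CZ Z0; have half := half_stalk R_pid Ctri CZ Z0.
have Ceq X Y : C Y -> chi X = chi Y -> C X.
  move=> CY XY.
  have C_gen (_ : unit) : C (perf_dsum (perf_shift (stalk R 0)) (stalk R 0)).
    exact/(tri_cone_scal0 Ctri).
  apply: (@mem_euler_eq R C Ctri (unit : eqType) (fun=> stalk R 0) (fun=> @chi R) (fun=> True)
    full_triangulated (fun _ _ _ XY _ => chi_iso XY) (fun _ _ _ => chi_shift _)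
    (fun _ _ _ f _ _ => chi_cone f) _ (fun=> I) _ C_gen X Y (fun _ _ => I) I CY (fun=> XY)).
  - by move=> K Ktri KG W _; apply: (all_generated R_pid Ktri (KG tt)).
  - by move=> [] []; rewrite chi_stalk.
have [||k kP] := @int_subgroup_principal (fun n => exists2 X, C X & chi X = n).
- by exists (perf0 R); [exact: (tri_zero Ctri) | exact: chi_zero].
- move=> _ _ [X CX <-] [Y CY <-]; exists (perf_cone (zero_map Y X)).
    exact: (tri_cone Ctri).
  exact: chi_cone.
exists k => X; rewrite /D_; split=> [CX|/eqP].
  by apply/eqP; rewrite eqz_mod_dvd subr0; apply/kP; exists X.
by rewrite eqz_mod_dvd subr0 => /kP[Y CY] YX; exact: Ceq CY (esym YX).
Qed.

Lemma D_triangulated k : triangulated_subcategory (@D_ R k).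
Proof.
have DE X : D_ k X <-> (k %| chi X)%Z.
  by rewrite /D_; split=> [/eqP|H]; [rewrite eqz_mod_dvd subr0|apply/eqP; rewrite eqz_mod_dvd subr0].
split=> [X Y XY /DE DX| |X|X Y f /DE DX /DE DY].
- by apply/DE; rewrite (chi_iso XY).
- by apply/DE; rewrite chi_zero dvdz0.
- by rewrite !DE chi_shift rpredN.
- move: DX DY => /dvdzP[a aE] /dvdzP[b bE]; apply/DE.
  by rewrite (chi_cone f) aE bE -mulrBl; exact: dvdz_mull.
Qed.

(** The complement $X[1]$ brings the Euler characteristic to 0, which is congruent to 0 for every
    $k$. *)
Lemma D_dense k : dense_in (fun _ => True) (@D_ R k).
Proof.
split=> // X _; exists (perf_shift X), (perf_dsum X (perf_shift X)); split=> //.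
  by rewrite /D_ chi_dsum chi_shift subrr.
exact: homotopy_equivalent_refl.
Qed.
End Classification.

(** * Subcategories with support away from the zero ideal *)

Section Torsion.
Variables (R : idomainType) (R_pid : all_ideals_principal R).
Implicit Types (X Y Z : perf R) (C K : subcategory R) (p q : Spec R).
Local Notation gen p := (generator R_pid p).
Local Notation E p := (perf_cone (scal (generator R_pid p) (stalk R 0))).

(** Nonzero primes are maximal: if the generator of $q$ is $d$ times that of $p$, then $d\in q$
    would make the generator of $p$ a unit. *)
Lemma generator_mem_eq p q : q <> zero_spec R -> gen q \in p -> p = q.
Proof.
move=> /(generator_neq0 R_pid) g0 gp; have qp x : x \in q -> x \in p.
  by move=> /(generatorP R_pid)[c ->]; exact: idealMr.
apply: Spec_ext => x; apply/idP/idP => [|/qp//].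
move=> /(generatorP R_pid)[c ->]; apply: idealMr.
have /(generatorP R_pid)[d dE] := gp; have := generator_in R_pid q.
rewrite {1}dE prime_idealrM => /orP[dq|//]; exfalso.
have /(generatorP R_pid)[k kE] := dq.
have E1 : 1 = k * gen p by apply: (mulIf g0); rewrite mul1r {1}dE {1}kE -!mulrA [gen q * _]mulrC.
have : 1 \in p by rewrite E1; apply: idealMr; exact: generator_in.
by rewrite idealr1.
Qed.

Lemma generator_cone_length p i : p <> zero_spec R ->
  has_length (tensor (@localisation_of R p) (homology (E p) i)) (i == 0).
Proof.
move=> p0; apply: (cone_stalk_has_length (localising_prime p)).
  exact: generator_neq0.
move=> r; split=> [rp /(generatorP R_pid)|nr]; first exact/negP.
by apply/negP => /(generatorP R_pid).
Qed.

Lemma generator_cone_acyclic p q : q <> zero_spec R -> p <> q -> acyclic_at p (E q).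
Proof.
by move=> q0 pq; apply: cone_acyclic; apply/negP => /(generator_mem_eq q0).
Qed.

Lemma lambda_generator p q : q <> zero_spec R -> lambda p (E q) = `[< p = q >]%:Z.
Proof.
move=> q0; case: asboolP => [->|pq].
  rewrite [LHS](alt_single (F := fun i => (hlen (@localisation_of R q) (E q) i)%:Z)).
    by rewrite /hlen (module_lengthE (generator_cone_length 0 q0)).
  by move=> i i0; rewrite /hlen (module_lengthE (generator_cone_length i q0)) (negPf i0).
have Eq0 i := module_lengthE (generator_cone_acyclic q0 pq i).
rewrite [LHS](alt_single (F := fun i => (hlen (@localisation_of R p) (E q) i)%:Z)).
  by rewrite /hlen Eq0.
by move=> i _; rewrite /hlen Eq0.
Qed.

Section Support.
Variables (S : set (Spec R)) (S0 : ~ S (zero_spec R)).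
Hypothesis S_closed : specialisation_closed S.

Lemma not_zero_spec p : S p -> p <> zero_spec R.
Proof. by move=> Sp p0; apply: S0; rewrite -p0. Qed.

Lemma generator_cone_T p : S p -> T_ S (E p).
Proof.
move=> Sp; apply/T_E => q nSq; apply: cone_acyclic; apply/negP => gq; apply: nSq.
by apply: S_closed Sp _ => x /(generatorP R_pid)[c ->]; exact: idealMr.
Qed.

Lemma torsion_finite p X : S p -> T_ S X -> finite_homology (@localisation_of R p) X.
Proof.
move=> Sp.
refine (@T_generated R R_pid S (fun Y => finite_homology (@localisation_of R p) Y) S0 _ _ X).
  exact: finite_homology_triangulated (localising_prime p).
move=> q Sq; have q0 := not_zero_spec Sq; apply: finite_homologyI => i.
have [->|pq] := pselect (p = q); first by exists (i == 0); exact: generator_cone_length.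
by exists 0%N; exact: generator_cone_acyclic.
Qed.

Lemma lambda_iso p X Y : S p -> homotopy_equivalent X Y -> T_ S X -> lambda p Y = lambda p X.
Proof.
by move=> Sp XY TX; exact: (euler_iso (localising_prime p) XY (torsion_finite Sp TX)).
Qed.

Lemma lambda_shift p X : lambda p (perf_shift X) = - lambda p X.
Proof. exact: (euler_shift (localising_prime p)). Qed.

Lemma lambda_cone p X Y (f : chain_map X Y) : S p -> T_ S X -> T_ S Y ->
  lambda p (perf_cone f) = lambda p Y - lambda p X.
Proof.
move=> Sp TX TY.
exact: (euler_cone (localising_prime p) f (torsion_finite Sp TX) (torsion_finite Sp TY)).
Qed.

Lemma lambda_dsum p X Y : S p -> T_ S X -> T_ S Y ->
  lambda p (perf_dsum X Y) = lambda p X + lambda p Y.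
Proof.
move=> Sp TX TY.
exact: (@euler_dsum R (unit : eqType) (fun=> @lambda R p) (T_ S) (T_triangulated S)
  (fun _ _ _ XY TX => lambda_iso Sp XY TX) (fun _ _ _ => lambda_shift p _)
  (fun _ _ _ f TX TY => lambda_cone f Sp TX TY) tt X Y TX TY).
Qed.

Lemma lambda_zero p : S p -> lambda p (perf0 R) = 0.
Proof.
move=> Sp; have T0 := tri_zero (T_triangulated S).
have := lambda_iso Sp (shift_zero R : homotopy_equivalent (perf_shift (perf0 R)) (perf0 R))
  (proj2 (tri_shift (T_triangulated S) _) T0).
by rewrite lambda_shift; lia.
Qed.

(** The vector has one nonzero entry on each generator, and additivity carries finite support to
    cones. *)
Lemma lambda_support X : T_ S X -> int_dsum (fun p : {p | S p} => lambda (sval p) X).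
Proof.
have Ttri := T_triangulated S.
pose K X := T_ S X /\ int_dsum (fun p : {p | S p} => lambda (sval p) X).
suff H : T_ S X -> K X by move=> /H[].
apply: (T_generated (R_pid := R_pid) S0).
  split=> [Y Z YZ [TY Yf]| |Y|Y Z f [TY Yf] [TZ Zf]].
  - split; first exact: (tri_iso Ttri YZ).
    apply: sub_finite_set Yf => p /=.
    by rewrite (lambda_iso (svalP p) YZ TY).
  - split; first exact: (tri_zero Ttri).
    apply: sub_finite_set (finite_set0 _) => p /=.
    by rewrite (lambda_zero (svalP p)) eqxx.
  - by split=> -[TY Yf]; (split; first exact/(tri_shift Ttri));
      apply: sub_finite_set Yf => p /=; rewrite lambda_shift oppr_eq0.
  split; first exact: (tri_cone Ttri).
  have Uf : finite_set ([set p : {p | S p} | lambda (sval p) Y != 0] `|`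
                        [set p : {p | S p} | lambda (sval p) Z != 0]).
    by rewrite finite_setU; split; [exact: Yf | exact: Zf].
  have sub0 (a b : int) : a - b != 0 -> b != 0 \/ a != 0.
    by have [->|] := eqVneq b 0; [rewrite subr0; right | left].
  apply: sub_finite_set Uf => p /=; rewrite (lambda_cone f (svalP p) TY TZ).
  exact: sub0.
move=> q Sq; split; first exact: generator_cone_T.
apply: sub_finite_set (finite_set1 (exist _ q Sq)) => p /=.
rewrite (lambda_generator _ (not_zero_spec Sq)); case: asboolP => // pq _.
by case: p pq => p Sp /= pq; subst p; congr exist; exact: Prop_irrelevance.
Qed.

(** [H] is the set of vectors attained on $C$. The last hypothesis, which density or the choice of
    $S$ will supply, yields the double of $R/p$ for each $p\in S$. *)
Lemma classification_torsion C : triangulated_subcategory C ->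
  (forall X, C X -> T_ S X) -> (forall p, S p -> exists2 Z, C Z & ~ acyclic_at p Z) ->
  exists H : set ({p | S p} -> int), subgroup_of_dsum H /\ same_objects C (T_H H).
Proof.
(* Counting generators in lists requires decidable equality on $S$, which is taken from classical
   logic. *)
move=> Ctri CT CS; pose I : eqType := {classic {p : Spec R | S p}}.
pose e (p : I) X := lambda (sval (p : {p | S p})) X.
have C_gen (p : I) : C (perf_dsum (perf_shift (E (sval (p : {p | S p})))) (E (sval (p : {p | S p})))).
  have [Z CZ Zp] := CS _ (svalP (p : {p | S p})).
  by apply/(tri_cone_scal0 Ctri); exact: half_cone CZ Zp.
pose G (p : I) := E (sval (p : {p | S p})).
have e_iso (p : I) X Y : homotopy_equivalent X Y -> T_ S X -> e p Y = e p X.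
  exact: lambda_iso (svalP (p : {p | S p})).
have e_shift (p : I) X : T_ S X -> e p (perf_shift X) = - e p X.
  by move=> _; exact: lambda_shift.
have e_cone (p : I) X Y (f : chain_map X Y) : T_ S X -> T_ S Y ->
    e p (perf_cone f) = e p Y - e p X.
  exact: lambda_cone (svalP (p : {p | S p})).
have G_mem (p : I) : T_ S (G p) by exact: generator_cone_T (svalP (p : {p | S p})).
have e_gen (p q : I) : e p (G q) = (p == q)%:Z.
  rewrite /e (lambda_generator _ (not_zero_spec (svalP (q : {p | S p})))).
  congr (nat_of_bool _)%:Z; apply/asboolP/eqP => [|-> //].
  case: p q => [p Sp] [q Sq] /= pq; subst q; congr exist; exact: Prop_irrelevance.
have T_gen K : triangulated_subcategory K -> (forall p : I, K (G p)) -> forall X, T_ S X -> K X.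
  move=> Ktri KG W; apply: (T_generated (R_pid := R_pid) S0 Ktri) => p Sp.
  exact: (KG (exist _ p Sp)).
have Ceq X Z : T_ S X -> C Z -> (forall p : I, e p X = e p Z) -> C X.
  exact: (mem_euler_eq Ctri (T_triangulated S) e_iso e_shift e_cone T_gen G_mem e_gen C_gen CT).
exists [set c : {p | S p} -> int | exists2 X, C X & c = (fun p : {p | S p} => lambda (sval p) X)];
split.
  split=> [c [X CX ->]| |c d [X CX ->] [Y CY ->]].
  - by apply: lambda_support; exact: CT.
  - exists (perf0 R); first exact: (tri_zero Ctri).
    by apply/funext => p; rewrite (lambda_zero (svalP p)).
  exists (perf_cone (zero_map Y X)); first exact: (tri_cone Ctri).
  by apply/funext => p; rewrite (lambda_cone _ (svalP p)) //; exact: CT.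
move=> X; split=> [CX|[TX [Z CZ XZ]]]; first by split; [exact: CT | exists X].
apply: (Ceq X Z TX CZ) => p; exact: (congr1 (fun c : {p | S p} -> int => c p) XZ).
Qed.

Variable H : set ({p | S p} -> int).
Hypothesis H_sub : subgroup_of_dsum H.

Lemma T_H_triangulated : triangulated_subcategory (T_H H).
Proof.
have Ttri := T_triangulated S; have [_ H0 HB] := H_sub.
have HN c : H c -> H (fun t => - c t).
  move=> Hc; rewrite (_ : (fun t => - c t) = (fun t => 0 - c t)); first exact: HB.
  by apply/funext => t; rewrite sub0r.
split=> [X Y XY [TX HX]| |X|X Y f [TX HX] [TY HY]].
- split; first exact: (tri_iso Ttri XY).
  by under eq_fun do rewrite (lambda_iso (svalP _) XY TX).
- split; first exact: (tri_zero Ttri).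
  by under eq_fun do rewrite (lambda_zero (svalP _)).
- split=> -[TX HX]; (split; first exact/(tri_shift Ttri)).
    under eq_fun do rewrite -[lambda _ X]opprK -lambda_shift; exact: HN.
  by under eq_fun do rewrite lambda_shift; exact: HN.
split; first exact: (tri_cone Ttri).
rewrite (_ : (fun t : {p | S p} => lambda (sval t) (perf_cone f)) =
  (fun t : {p | S p} => lambda (sval t) Y - lambda (sval t) X)); first exact: HB HY HX.
by apply/funext => t; exact: lambda_cone (svalP t) TX TY.
Qed.

Lemma T_H_dense : dense_in (T_ S) (T_H H).
Proof.
have Ttri := T_triangulated S; have [_ H0 _] := H_sub.
split=> [X [] //|X TX]; have TsX := proj2 (tri_shift Ttri X) TX.
exists (perf_shift X), (perf_dsum X (perf_shift X)); split=> //; last first.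
  exact: homotopy_equivalent_refl.
split; first exact: (tri_dsum Ttri).
by under eq_fun do rewrite (lambda_dsum (svalP _) TX TsX) lambda_shift subrr.
Qed.
End Support.
End Torsion.

Theorem mainTheorem10 (R : idomainType) (R_pid : all_ideals_principal R) :
  [/\ (forall C : subcategory R,
         (triangulated_subcategory C /\ dense_in (fun _ => True) C) <->
         (exists k : int, same_objects C (@D_ R k))),
      (forall S : set (Spec R), S <> [set: Spec R] -> specialisation_closed S ->
       forall C : subcategory R,
         (triangulated_subcategory C /\ dense_in (T_ S) C) <->
         (exists H : set ({p : Spec R | S p} -> int),
            subgroup_of_dsum H /\ same_objects C (T_H H))) &
      (forall C : subcategory R, triangulated_subcategory C ->
         (exists k : int, same_objects C (@D_ R k)) \/
         (exists (S : set (Spec R)) (H : set ({p : Spec R | S p} -> int)),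
            [/\ S <> [set: Spec R], specialisation_closed S,
                subgroup_of_dsum H & same_objects C (T_H H)]))].
Proof.
have same_eq (C D : subcategory R) : same_objects C D -> C = D.
  by move=> CD; apply/funext => X; apply/propext; exact: CD.
have summand_supp (C T : subcategory R) X p : dense_in T C -> T X -> ~ acyclic_at p X ->
    exists2 Z, C Z & ~ acyclic_at p Z.
  (* An object of $C$ having $X$ as a summand cannot be acyclic where $X$ is not. *)
  move=> [_ CT] TX Xp; have [Y [Z [_ CZ XYZ]]] := CT X TX.
  exists Z; [exact: CZ | move=> Zp; apply: Xp].
  apply: (proj1 (proj1 (acyclic_dsum p X Y) _)).
  exact: (tri_iso (acyclic_tri p) (homotopy_equivalent_sym XYZ) Zp).
have no_zero (S : set (Spec R)) : S <> [set: Spec R] -> specialisation_closed S ->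
    ~ S (zero_spec R).
  move=> ST Scl S0; apply: ST; apply/seteqP; split=> // q _.
  by apply: (Scl _ _ S0) => x; rewrite zero_specP => /eqP->; exact: idealr0.
split.
- move=> C; split=> [[Ctri Cdense]|[k /same_eq ->]]; last first.
    by split; [exact: D_triangulated | exact: D_dense].
  (* $R$ is not acyclic at the zero ideal, so by density neither is some object of $C$. *)
  have [Z CZ Z0] := summand_supp _ _ _ _ Cdense I (@stalk_supp R (zero_spec R) 0).
  exact: classification_full CZ Z0.
- move=> S ST Scl C; have S0 := no_zero S ST Scl.
  split=> [[Ctri Cdense]|[H [Hsub /same_eq ->]]]; last first.
    by split; [exact: T_H_triangulated | exact: T_H_dense].
  apply: (classification_torsion R_pid S0 Scl Ctri); first by case: Cdense.
  move=> p Sp; have Ep := @cone_supp R p (generator R_pid p) 0 (generator_in R_pid p).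
  exact: (summand_supp C (T_ S) _ p Cdense (generator_cone_T (R_pid := R_pid) Scl Sp) Ep).
move=> C Ctri.
have [[Z CZ Z0]|no0] := pselect (exists2 Z, C Z & ~ acyclic_at (zero_spec R) Z).
  by left; exact: classification_full CZ Z0.
(* The smallest possible $S$: the union of the supports of the objects of $C$. *)
right; pose S : set (Spec R) := [set p | exists2 Z, C Z & ~ acyclic_at p Z].
(* Elements outside $q$ are outside $p$, so acyclicity at $q$ implies acyclicity at the smaller
   prime $p$. *)
have Scl : specialisation_closed S.
  move=> p q [Z CZ Zp] pq; exists Z; [exact: CZ | move=> Zq; apply: Zp].
  apply/(acyclicE (localising_prime p)) => i x dx.
  have /(acyclicE (localising_prime q))/(_ i x dx)[s sq sx] := Zq.
  by exists s => //; apply: contra sq; exact: pq.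
have [||H [Hsub CH]] := @classification_torsion R R_pid S no0 Scl C Ctri.
- by move=> X CX; apply/T_E => p nSp; apply: contrapT => Xp; apply: nSp; exists X.
- by move=> p; exact: id.
exists S, H; split=> // ST; apply: no0; have : [set: Spec R] (zero_spec R) by [].
by rewrite -ST.
Qed.
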